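(* Let $\mathcal{C}$ be a semisimple rigid balanced braided tensor category over $\mathbb{C}$, let $A$ be a rigid $\mathcal{C}$-algebra with $\theta_A=\mathrm{id}$, and let $G$ be a compact group acting faithfully on $A$ by algebra automorphisms with $A^G=\mathbf{1}$. Then: (1) $A\simeq\bigoplus_{\lambda\in\widehat G}V_\lambda\boxtimes M_\lambda$ (as an object of $\mathcal{C}$ with $G$-action), where the objects $M_\lambda=\Phi(V_\lambda^* )$ of $\mathcal{C}$ are non-zero and simple, and $M_\lambda\not\simeq M_\mu$ for $\lambda\ne\mu$. (2) Let $\mathcal{C}_1$ be the full subcategory of $\mathcal{C}$ generated as an abelian category by $M_\lambda$, $\lambda\in\widehat G$. Then $\mathcal{C}_1$ is a symmetric tensor subcategory in $\mathcal{C}$, and the functor $\Phi\colon\mathrm{Rep}\,G\to\mathcal{C}_1$, $\Phi(V)=(V\boxtimes A)^G$, is an equivalence of tensor categories.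
   Context: Conventions on $\mathcal{C}$: semisimple abelian over $\mathbb{C}$, finite-dimensional Hom spaces, objects are finite direct sums of simples $L_i$, $i\in I$, unit $\mathbf{1}=L_0$ simple; braiding $\check R$; rigid; balancing $\theta$ compatible with braiding and duality (ribbon). For a finite-dimensional complex vector space $V$ and $L\in\mathcal{C}$, $V\boxtimes L\in\mathcal{C}$ is defined by $\mathrm{Hom}(L_i,V\boxtimes L)=V\otimes\mathrm{Hom}(L_i,L)$. For an object $M$ with a $G$-action, $M^G$ is defined by $\mathrm{Hom}(L_i,M^G)=\mathrm{Hom}(L_i,M)^G$; there is a canonical embedding $X^G\otimes Y^G\hookrightarrow(X\otimes Y)^G$. A $\mathcal{C}$-algebra is an object $A$ with an associative $\mu\colon A\otimes A\to A$, commutative ($\mu\check R_{AA}=\mu$), with a unit embedding $\iota\colon\mathbf{1}\hookrightarrow A$ and $\dim\mathrm{Hom}(\mathbf{1},A)=1$. It is rigid if the pairing $A\otimes A\xrightarrow{\mu}A\xrightarrow{\varepsilon}\mathbf{1}$ ($\varepsilon\iota=\mathrm{id}$) is nondegenerate and $\dim A\ne0$. Faithful: every $g\ne1$ in $G$ acts by a non-trivial automorphism of $A$. $\mathrm{Rep}\,G$ is the category of finite-dimensional complex representations of $G$, $\widehat G$ the set of isomorphism classes of simple ones, $V_\lambda$ a representative of $\lambda\in\widehat G$. The tensor structure on $\Phi$ is $J\colon\Phi(V)\otimes\Phi(W)\to\Phi(V\otimes W)$, the composition $(V\boxtimes A)^G\otimes(W\boxtimes A)^G\hookrightarrow((V\otimes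 W)\boxtimes(A\otimes A))^G\xrightarrow{\mu}((V\otimes W)\boxtimes A)^G$. *)

(* Defs.v *)
From HB Require Import structures.
From mathcomp Require Import all_boot all_order all_algebra.
From mathcomp Require Import boolp classical_sets reals topology normedtype.
From mathcomp Require Import complex.

Set Implicit Arguments.
Unset Strict Implicit.
Unset Printing Implicit Defensive.

Import Order.TTheory GRing.Theory Num.Theory.
Import numFieldNormedType.Exports.
Local Open Scope ring_scope.

Section LinearAlgebra.
Variable K : fieldType.
Implicit Types U V W : vectType K.

Lemma linfunP U V (f : U -> V) : linear f -> forall u, linfun f u = f u.
Proof.
move=> Hf u.
pose F : {linear U -> V} :=
  HB.pack_for {linear U -> V} f (GRing.isLinear.Build K U V _ f Hf).
exact: (lfunE F u).
Qed.

Lemma vspace_of_subproof V (P : V -> Prop) :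
  P 0 -> (forall a u v, P u -> P v -> P (a *: u + v)) ->
  exists U : {vspace V}, forall u, u \in U <-> P u.
Proof.
move=> P0 Plin.
have step n : (exists2 U : {vspace V}, n <= \dim U & forall u, u \in U -> P u)%N
    \/ exists U : {vspace V}, forall u, u \in U <-> P u.
  elim: n => [|n [[U leU PU]|]]; [left|idtac|by right].
    by exists 0%VS => // u; rewrite memv0 => /eqP->.
  have [allU|/existsNP[x /not_implyP[Px xU]]] := pselect (forall u, P u -> u \in U).
    by right; exists U => u; split; [exact: PU|exact: allU].
  left; exists (U + <[x]>)%VS.
    have xU' : x \notin U by apply/negP.
    apply: (leq_ltn_trans leU).
    have [le_d eq_d] := dimv_leqif_sup (addvSl U <[x]>).
    rewrite ltn_neqAle le_d eq_d subv_add subvv andbT.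
    by rewrite -memvE.
  move=> u /memv_addP[y yU [_ /vlineP[a ->] ->]].
  by rewrite addrC; apply: Plin => //; exact: PU.
have [[U leU _]|//] := step (\dim {: V}).+1.
by have := dimvS (subvf U); rewrite leqNgt leU.
Qed.

(* the subspace cut out by a predicate closed under linear combinations *)
Definition vspace_of V (P : V -> Prop) (P0 : P 0)
    (Plin : forall a u v, P u -> P v -> P (a *: u + v)) : {vspace V} :=
  projT1 (cid (vspace_of_subproof P0 Plin)).

Lemma vspace_ofP V (P : V -> Prop) P0 Plin u :
  u \in @vspace_of V P P0 Plin <-> P u.
Proof. by rewrite /vspace_of; case: cid. Qed.

Definition vdual V : vectType K := 'Hom(V, K^o).

(* V (x) W is modelled as Hom(V^*, W), the pure tensor v (x) w being the map
   phi |-> phi(v) w. *)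
Definition vtens V W : vectType K := 'Hom(vdual V, W).

Definition vpure V W (v : V) (w : W) : vtens V W :=
  linfun (fun phi : vdual V => (phi v : K) *: w).

Lemma vpureE V W (v : V) (w : W) phi : vpure v w phi = (phi v : K) *: w.
Proof.
by rewrite linfunP // => a x y; rewrite add_lfunE scale_lfunE scalerDl scalerA.
Qed.

Definition vtr V W (f : 'Hom(V, W)) : 'Hom(vdual W, vdual V) :=
  linfun (fun phi : vdual W => (phi \o f)%VF).

Lemma vtrE V W (f : 'Hom(V, W)) phi : vtr f phi = (phi \o f)%VF.
Proof. by rewrite linfunP // => a x y; rewrite comp_lfunDl -comp_lfunZl. Qed.

Definition vtensm V V' W W' (f : 'Hom(V, V')) (g : 'Hom(W, W')) :
    'Hom(vtens V W, vtens V' W') :=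
  linfun (fun T : vtens V W => (g \o T \o vtr f)%VF : vtens V' W').

Lemma vtensmE V V' W W' (f : 'Hom(V, V')) (g : 'Hom(W, W')) T phi :
  vtensm f g T phi = g (T (phi \o f)%VF).
Proof.
rewrite linfunP => [|a x y]; first by rewrite !comp_lfunE vtrE.
by rewrite comp_lfunDr comp_lfunDl -comp_lfunZr -comp_lfunZl.
Qed.

Lemma vtensm_pure V V' W W' (f : 'Hom(V, V')) (g : 'Hom(W, W')) v w :
  vtensm f g (vpure v w) = vpure (f v) (g w).
Proof. by apply/lfunP => phi; rewrite vtensmE !vpureE linearZ comp_lfunE. Qed.

(* the functional phi (x) psi on V (x) W *)
Definition vtdual V W (phi : vdual V) (psi : vdual W) : vdual (vtens V W) :=
  linfun (fun S : vtens V W => psi (S phi)).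

Lemma vtdualE V W (phi : vdual V) (psi : vdual W) S :
  vtdual phi psi S = psi (S phi).
Proof.
by rewrite linfunP // => a x y; rewrite add_lfunE scale_lfunE linearP.
Qed.

Lemma vtdual_linl V W (psi : vdual W) : linear (fun phi : vdual V => vtdual phi psi).
Proof.
move=> a x y; apply/lfunP => S.
by rewrite add_lfunE scale_lfunE !vtdualE !linearP.
Qed.

Lemma vtdual_linr V W (phi : vdual V) : linear (fun psi : vdual W => vtdual phi psi).
Proof.
move=> a x y; apply/lfunP => S.
by rewrite add_lfunE scale_lfunE !vtdualE add_lfunE scale_lfunE.
Qed.

Lemma scaleoC (a b : K) : a *: (b : K^o) = b *: (a : K^o).
Proof. exact: mulrC. Qed.

Definition vb V (k : 'I_(\dim {: V})) : V := (vbasis {: V})`_k.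
Definition vbd V (k : 'I_(\dim {: V})) : vdual V :=
  linfun (coord (vbasis {: V}) k : V -> K^o).

Lemma vbdE V k v : vbd k v = coord (vbasis {: V}) k v.
Proof. by rewrite lfunE. Qed.

Lemma vb_expand V (v : V) : v = \sum_k (vbd k v : K) *: vb k.
Proof.
rewrite {1}(coord_vbasis (memvf v)); apply: eq_bigr => k _.
by rewrite vbdE.
Qed.

Lemma vbd_vb V (k l : 'I_(\dim {: V})) : vbd k (vb l) = (k == l)%:R.
Proof. by rewrite vbdE coord_free ?(basis_free (vbasisP _)) // eq_sym. Qed.

Lemma vbd_expand V (phi : vdual V) : phi = \sum_k (phi (vb k) : K) *: vbd k.
Proof.
apply/lfunP => v; rewrite {1}(vb_expand v) linear_sum sum_lfunE.
by apply: eq_bigr => k _; rewrite linearZ scale_lfunE scaleoC.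
Qed.

Lemma vtens_expand V W (S : vtens V W) :
  S = \sum_k \sum_l (vbd l (S (vbd k)) : K) *: vpure (vb k) (vb l).
Proof.
apply/lfunP => phi; rewrite {1}(vbd_expand phi) linear_sum sum_lfunE.
apply: eq_bigr => k _; rewrite linearZ /= [S _ in LHS]vb_expand scaler_sumr.
rewrite sum_lfunE; apply: eq_bigr => l _.
by rewrite scale_lfunE vpureE !scalerA; congr (_ *: _); apply: mulrC.
Qed.

Lemma vtensdual_expand V W (Xi : vdual (vtens V W)) :
  Xi = \sum_k \sum_l (Xi (vpure (vb k) (vb l)) : K) *: vtdual (vbd k) (vbd l).
Proof.
apply/lfunP => S; rewrite {1}(vtens_expand S) linear_sum sum_lfunE.
apply: eq_bigr => k _; rewrite linear_sum sum_lfunE; apply: eq_bigr => l _.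
by rewrite linearZ scale_lfunE vtdualE scaleoC.
Qed.

(* (u (x) v) (x) w |-> u (x) (v (x) w) *)
Definition vassoc U V W : 'Hom(vtens (vtens U V) W, vtens U (vtens V W)) :=
  linfun (fun T : vtens (vtens U V) W =>
    linfun (fun phi : vdual U =>
      linfun (fun psi : vdual V => T (vtdual phi psi)) : vtens V W)
    : vtens U (vtens V W)).

Lemma vassocE U V W T (phi : vdual U) (psi : vdual V) :
  vassoc U V W T phi psi = T (vtdual phi psi).
Proof.
have E1 (S : vtens (vtens U V) W) (p : vdual U) (q : vdual V) : (linfun (fun psi : vdual V => S (vtdual p psi)) : vtens V W) q
    = S (vtdual p q).
  by rewrite linfunP // => a x y; rewrite vtdual_linr linearP.
have E2 (S : vtens (vtens U V) W) (p : vdual U) : (linfun (fun phi : vdual U =>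
    linfun (fun psi : vdual V => S (vtdual phi psi)) : vtens V W)
    : vtens U (vtens V W)) p = linfun (fun psi : vdual V => S (vtdual p psi)).
  rewrite linfunP // => a x y; apply/lfunP => q.
  by rewrite add_lfunE scale_lfunE !E1 vtdual_linl linearP.
rewrite linfunP ?E2 ?E1 // => a x y; apply/lfunP => p; apply/lfunP => q.
by rewrite E2 E1 add_lfunE scale_lfunE; do 2!rewrite add_lfunE scale_lfunE;
  rewrite !E2 !E1.
Qed.

Definition vassoci U V W : 'Hom(vtens U (vtens V W), vtens (vtens U V) W) :=
  linfun (fun X : vtens U (vtens V W) =>
    linfun (fun Xi : vdual (vtens U V) =>
      \sum_k \sum_l (Xi (vpure (vb k) (vb l)) : K) *: X (vbd k) (vbd l))
    : vtens (vtens U V) W).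

Lemma vassociE U V W X (Xi : vdual (vtens U V)) :
  vassoci U V W X Xi =
  \sum_k \sum_l (Xi (vpure (vb k) (vb l)) : K) *: X (vbd k) (vbd l).
Proof.
have E1 (Y : vtens U (vtens V W)) xi : (linfun (fun Xi : vdual (vtens U V) =>
      \sum_k \sum_l (Xi (vpure (vb k) (vb l)) : K) *: Y (vbd k) (vbd l))
    : vtens (vtens U V) W) xi
    = \sum_k \sum_l (xi (vpure (vb k) (vb l)) : K) *: Y (vbd k) (vbd l).
  rewrite linfunP // => a x y; rewrite scaler_sumr -big_split; apply: eq_bigr => k _.
  rewrite scaler_sumr -big_split; apply: eq_bigr => l _.
  by rewrite add_lfunE scale_lfunE /= scalerDl scalerA.
rewrite linfunP ?E1 // => a x y; apply/lfunP => xi.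
rewrite add_lfunE scale_lfunE !E1 scaler_sumr -big_split; apply: eq_bigr => k _.
rewrite scaler_sumr -big_split; apply: eq_bigr => l _.
by do 2!rewrite add_lfunE scale_lfunE; rewrite scalerDr !scalerA (mulrC a).
Qed.

Lemma vassocK U V W T : vassoci U V W (vassoc U V W T) = T.
Proof.
apply/lfunP => Xi; rewrite vassociE {2}(vtensdual_expand Xi) linear_sum.
apply: eq_bigr => k _; rewrite linear_sum; apply: eq_bigr => l _.
by rewrite vassocE linearZ.
Qed.

Lemma vassociK U V W T : vassoc U V W (vassoci U V W T) = T.
Proof.
apply/lfunP => phi; apply/lfunP => psi; rewrite vassocE vassociE.
rewrite [in RHS](vbd_expand phi) linear_sum sum_lfunE; apply: eq_bigr => k _.
rewrite {2}(vbd_expand psi) linear_sum; apply: eq_bigr => l _.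
rewrite vtdualE vpureE !linearZ /= scale_lfunE /= scalerA.
by rewrite mulrC.
Qed.

Definition vlunit V : 'Hom(vtens K^o V, V) :=
  linfun (fun T : vtens K^o V => T (\1%VF : vdual K^o)).
Definition vluniti V : 'Hom(V, vtens K^o V) :=
  linfun (fun v : V => vpure (1 : K^o) v).
Definition vrunit V : 'Hom(vtens V K^o, V) :=
  linfun (fun T : vtens V K^o => \sum_k (T (vbd k) : K) *: vb k).
Definition vruniti V : 'Hom(V, vtens V K^o) :=
  linfun (fun v : V => vpure v (1 : K^o)).

Lemma vlunitE V T : vlunit V T = T (\1%VF : vdual K^o).
Proof. by rewrite linfunP // => a x y; rewrite add_lfunE scale_lfunE. Qed.

Lemma vlunitiE V v : vluniti V v = vpure (1 : K^o) v.
Proof.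
rewrite linfunP // => a x y; apply/lfunP => p.
rewrite add_lfunE scale_lfunE !vpureE scalerDr !scalerA.
by congr (_ *: _ + _); apply: mulrC.
Qed.

Lemma vrunitE V T : vrunit V T = \sum_k (T (vbd k) : K) *: vb k.
Proof.
rewrite linfunP // => a x y; rewrite scaler_sumr -big_split; apply: eq_bigr => k _.
by rewrite add_lfunE scale_lfunE /= scalerDl scalerA.
Qed.

Lemma vrunitiE V v : vruniti V v = vpure v (1 : K^o).
Proof.
rewrite linfunP // => a x y; apply/lfunP => p.
by rewrite add_lfunE scale_lfunE !vpureE linearP scalerDl scalerA.
Qed.

Lemma vlunitK V T : vluniti V (vlunit V T) = T.
Proof.
apply/lfunP => p; rewrite vlunitiE vlunitE vpureE -linearZ; congr (T _).
apply/lfunP => a; rewrite scale_lfunE id_lfunE.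
by rewrite -[in RHS](mulr1 a) -/(a *: (1 : K^o)) linearZ /= scaleoC.
Qed.

Lemma vlunitiK V v : vlunit V (vluniti V v) = v.
Proof. by rewrite vlunitiE vlunitE vpureE id_lfunE scale1r. Qed.

Lemma vrunitiK V v : vrunit V (vruniti V v) = v.
Proof.
rewrite vrunitiE vrunitE {2}(vb_expand v); apply: eq_bigr => k _.
by rewrite vpureE /= -[X in X *: _]/(vbd k v * 1) mulr1.
Qed.

Lemma vrunitK V T : vruniti V (vrunit V T) = T.
Proof.
apply/lfunP => p; rewrite vrunitiE vrunitE vpureE linear_sum.
rewrite -[LHS]/(_ * 1) mulr1 {2}(vbd_expand p) linear_sum; apply: eq_bigr => k _.
by rewrite !linearZ /= scaleoC.
Qed.

End LinearAlgebra.

Record linCat (K : fieldType) := LinCat {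
  ob :> Type;
  Mor : ob -> ob -> vectType K;
  idm : forall X, Mor X X;
  ccomp : forall X Y Z, Mor Y Z -> Mor X Y -> Mor X Z;
  comp_linl : forall X Y Z (f : Mor X Y),
    linear (fun g : Mor Y Z => ccomp g f);
  comp_linr : forall X Y Z (g : Mor Y Z), linear (@ccomp X Y Z g);
  compA : forall X Y Z W (h : Mor Z W) (g : Mor Y Z) (f : Mor X Y),
    ccomp h (ccomp g f) = ccomp (ccomp h g) f;
  comp1m : forall X Y (f : Mor X Y), ccomp (idm Y) f = f;
  compm1 : forall X Y (f : Mor X Y), ccomp f (idm X) = f
}.
Arguments Mor {K C} X Y : rename.
Arguments idm {K C} X : rename.
Arguments ccomp {K C X Y Z} g f : rename.
Notation "g \oc f" := (ccomp g f) (at level 40, left associativity).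

Section CategoryTheory.
Variables (K : fieldType) (C : linCat K).
Implicit Types X Y Z : C.

Definition is_inv X Y (f : Mor X Y) (g : Mor Y X) :=
  g \oc f = idm X /\ f \oc g = idm Y.
Definition is_iso X Y (f : Mor X Y) := exists g, is_inv f g.
Definition isomorphic X Y := exists f : Mor X Y, is_iso f.

Definition monic X Y (f : Mor X Y) :=
  forall Z (u v : Mor Z X), f \oc u = f \oc v -> u = v.
Definition epic X Y (f : Mor X Y) :=
  forall Z (u v : Mor Y Z), u \oc f = v \oc f -> u = v.

Definition is_zero Z :=
  forall X, (forall f : Mor X Z, f = 0) /\ (forall f : Mor Z X, f = 0).

Definition is_biproduct X Y P (i1 : Mor X P) (i2 : Mor Y P)
    (p1 : Mor P X) (p2 : Mor P Y) :=
  [/\ p1 \oc i1 = idm X, p2 \oc i2 = idm Y, p1 \oc i2 = 0, p2 \oc i1 = 0 &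
      i1 \oc p1 + i2 \oc p2 = idm P].

Definition is_kernel X Y (f : Mor X Y) N (k : Mor N X) :=
  f \oc k = 0 /\
  forall Z (u : Mor Z X), f \oc u = 0 -> exists! v, k \oc v = u.

Definition is_cokernel X Y (f : Mor X Y) Q (q : Mor Y Q) :=
  q \oc f = 0 /\
  forall Z (u : Mor Y Z), u \oc f = 0 -> exists! v, v \oc q = u.

(* S is the direct sum (coproduct) of an arbitrary family; for finite families
   in an additive category this is the same as a biproduct *)
Definition is_dsum (J : Type) (F : J -> C) S (inj : forall k, Mor (F k) S) :=
  forall Y (f : forall k, Mor (F k) Y),
    exists! h : Mor S Y, forall k, h \oc inj k = f k.

Record abelian : Prop := Abelian {
  ab_zero : exists Z, is_zero Z;
  ab_biproduct : forall X Y, exists P (i1 : Mor X P) (i2 : Mor Y P)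
    (p1 : Mor P X) (p2 : Mor P Y), is_biproduct i1 i2 p1 p2;
  ab_kernel : forall X Y (f : Mor X Y), exists N (k : Mor N X), is_kernel f k;
  ab_cokernel : forall X Y (f : Mor X Y),
    exists Q (q : Mor Y Q), is_cokernel f q;
  ab_monic : forall X Y (f : Mor X Y), monic f ->
    exists Z (g : Mor Y Z), is_kernel g f;
  ab_epic : forall X Y (f : Mor X Y), epic f ->
    exists Z (g : Mor Z X), is_cokernel g f
}.

Definition simple X :=
  ~ is_zero X /\
  forall Y (m : Mor Y X), monic m -> is_zero Y \/ is_iso m.

Definition semisimple := forall X, exists n (S : 'I_n -> C)
  (inj : forall k, Mor (S k) X), (forall k, simple (S k)) /\ is_dsum inj.

(* the smallest full abelian subcategory containing the objects F k *)
Inductive ab_generated (J : Type) (F : J -> C) : C -> Prop :=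
| AbGen k : ab_generated F (F k)
| AbZero Z : is_zero Z -> ab_generated F Z
| AbBiproduct X Y P (i1 : Mor X P) (i2 : Mor Y P) (p1 : Mor P X)
    (p2 : Mor P Y) : is_biproduct i1 i2 p1 p2 ->
    ab_generated F X -> ab_generated F Y -> ab_generated F P
| AbKernel X Y (f : Mor X Y) N (k : Mor N X) : is_kernel f k ->
    ab_generated F X -> ab_generated F Y -> ab_generated F N
| AbCokernel X Y (f : Mor X Y) Q (q : Mor Y Q) : is_cokernel f q ->
    ab_generated F X -> ab_generated F Y -> ab_generated F Q.

Lemma comp0m X Y Z (f : Mor X Y) : (0 : Mor Y Z) \oc f = 0.
Proof.
have := comp_linl (Z := Z) f 1 0 0.
by rewrite !scale1r addr0 => /(congr1 (fun x => x - 0 \oc f)); rewrite subrr addrK.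
Qed.

Lemma compm0 X Y Z (g : Mor Y Z) : g \oc (0 : Mor X Y) = 0.
Proof.
have := comp_linr (X := X) g 1 0 0.
by rewrite !scale1r addr0 => /(congr1 (fun x => x - g \oc 0)); rewrite subrr addrK.
Qed.

Lemma compDl X Y Z (f : Mor X Y) (g g' : Mor Y Z) :
  (g + g') \oc f = g \oc f + g' \oc f.
Proof. by have := comp_linl f 1 g g'; rewrite !scale1r. Qed.

Lemma compDr X Y Z (g : Mor Y Z) (f f' : Mor X Y) :
  g \oc (f + f') = g \oc f + g \oc f'.
Proof. by have := comp_linr g 1 f f'; rewrite !scale1r. Qed.

Lemma compZl X Y Z (f : Mor X Y) a (g : Mor Y Z) :
  (a *: g) \oc f = a *: (g \oc f).
Proof. by have := comp_linl f a g 0; rewrite comp0m !addr0. Qed.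

Lemma compZr X Y Z (g : Mor Y Z) a (f : Mor X Y) :
  g \oc (a *: f) = a *: (g \oc f).
Proof. by have := comp_linr g a f 0; rewrite compm0 !addr0. Qed.

Lemma comp_suml X Y Z (f : Mor X Y) J (r : seq J) (g : J -> Mor Y Z) :
  (\sum_(j <- r) g j) \oc f = \sum_(j <- r) g j \oc f.
Proof. by apply: (big_morph (fun x => x \oc f)) => [x y|]; rewrite ?compDl ?comp0m. Qed.

Lemma comp_sumr X Y Z (g : Mor Y Z) J (r : seq J) (f : J -> Mor X Y) :
  g \oc (\sum_(j <- r) f j) = \sum_(j <- r) g \oc f j.
Proof. by apply: (big_morph (ccomp g)) => [x y|]; rewrite ?compDr ?compm0. Qed.

End CategoryTheory.

Arguments is_dsum {K C J F S} inj.

Record functor (K : fieldType) (C D : linCat K) := Functor {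
  fob :> C -> D;
  fmor : forall X Y : C, Mor X Y -> Mor (fob X) (fob Y);
  fmor_lin : forall X Y : C, linear (@fmor X Y);
  fmor_id : forall X : C, fmor (idm X) = idm (fob X);
  fmor_comp : forall (X Y Z : C) (g : Mor Y Z) (f : Mor X Y),
    fmor (g \oc f) = fmor g \oc fmor f
}.
Arguments fmor {K C D} F {X Y} f : rename.

Definition is_equivalence (K : fieldType) (C D : linCat K) (F : functor C D) :=
  exists (G : functor D C) (eta : forall X : C, Mor X (G (F X)))
    (eps : forall Y : D, Mor (F (G Y)) Y),
    [/\ forall X, is_iso (eta X),
        forall X X' (f : Mor X X'), eta X' \oc f = fmor G (fmor F f) \oc eta X,
        forall Y, is_iso (eps Y) &
        forall Y Y' (f : Mor Y Y'), eps Y' \oc fmor F (fmor G f) = f \oc eps Y].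

Section FullSubcategory.
Variables (K : fieldType) (C : linCat K) (P : C -> Prop).

Definition fullsub : linCat K :=
  @LinCat K {X : C | P X} (fun X Y => Mor (sval X) (sval Y))
    (fun X => idm (sval X)) (fun X Y Z => @ccomp K C (sval X) (sval Y) (sval Z))
    (fun X Y Z => @comp_linl K C (sval X) (sval Y) (sval Z))
    (fun X Y Z => @comp_linr K C (sval X) (sval Y) (sval Z))
    (fun X Y Z W => @compA K C (sval X) (sval Y) (sval Z) (sval W))
    (fun X Y => @comp1m K C (sval X) (sval Y))
    (fun X Y => @compm1 K C (sval X) (sval Y)).

Definition corestrict (B : linCat K) (F : functor B C) (PF : forall X, P (F X)) :
    functor B fullsub :=
  @Functor K B fullsub (fun X => exist _ (F X) (PF X)) (fun X Y => @fmor K B C F X Y)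
    (@fmor_lin K B C F) (@fmor_id K B C F) (@fmor_comp K B C F).

End FullSubcategory.

Record monCat (K : fieldType) := MonCat {
  mcat :> linCat K;
  tens : mcat -> mcat -> mcat;
  tensm : forall X X' Y Y' : mcat,
    Mor X X' -> Mor Y Y' -> Mor (tens X Y) (tens X' Y');
  tensm_linl : forall (X X' Y Y' : mcat) (g : Mor Y Y'),
    linear (fun f : Mor X X' => tensm f g);
  tensm_linr : forall (X X' Y Y' : mcat) (f : Mor X X'),
    linear (@tensm X X' Y Y' f);
  tensm_id : forall X Y : mcat, tensm (idm X) (idm Y) = idm (tens X Y);
  tensm_comp : forall (X X' X'' Y Y' Y'' : mcat) (f' : Mor X' X'')
    (f : Mor X X') (g' : Mor Y' Y'') (g : Mor Y Y'),
    tensm (f' \oc f) (g' \oc g) = tensm f' g' \oc tensm f g;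
  tone : mcat;
  assoc : forall X Y Z : mcat, Mor (tens (tens X Y) Z) (tens X (tens Y Z));
  associ : forall X Y Z : mcat, Mor (tens X (tens Y Z)) (tens (tens X Y) Z);
  assocP : forall X Y Z, is_inv (assoc X Y Z) (associ X Y Z);
  assoc_nat : forall (X X' Y Y' Z Z' : mcat) (f : Mor X X') (g : Mor Y Y')
    (h : Mor Z Z'),
    assoc X' Y' Z' \oc tensm (tensm f g) h
    = tensm f (tensm g h) \oc assoc X Y Z;
  lunit : forall X : mcat, Mor (tens tone X) X;
  luniti : forall X : mcat, Mor X (tens tone X);
  lunitP : forall X, is_inv (lunit X) (luniti X);
  lunit_nat : forall (X X' : mcat) (f : Mor X X'),
    lunit X' \oc tensm (idm tone) f = f \oc lunit X;
  runit : forall X : mcat, Mor (tens X tone) X;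
  runiti : forall X : mcat, Mor X (tens X tone);
  runitP : forall X, is_inv (runit X) (runiti X);
  runit_nat : forall (X X' : mcat) (f : Mor X X'),
    runit X' \oc tensm f (idm tone) = f \oc runit X;
  pentagon : forall X Y Z W : mcat,
    tensm (idm X) (assoc Y Z W) \oc assoc X (tens Y Z) W
      \oc tensm (assoc X Y Z) (idm W)
    = assoc X Y (tens Z W) \oc assoc (tens X Y) Z W;
  triangle : forall X Y : mcat,
    tensm (idm X) (lunit Y) \oc assoc X tone Y = tensm (runit X) (idm Y)
}.
Arguments tens {K C} X Y : rename.
Arguments tensm {K C X X' Y Y'} f g : rename.
Arguments tone {K C} : rename.
Arguments assoc {K C} X Y Z : rename.
Arguments associ {K C} X Y Z : rename.
Arguments lunit {K C} X : rename.
Arguments luniti {K C} X : rename.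
Arguments runit {K C} X : rename.
Arguments runiti {K C} X : rename.
Notation "X \ox Y" := (tens X Y) (at level 39, left associativity).
Notation "f \om g" := (tensm f g) (at level 39, left associativity).

Section Monoidal.
Variables (K : fieldType) (C : monCat K).
Implicit Types X Y Z : C.

(* D is a dual of X, with ev : D (x) X -> 1 and coev : 1 -> X (x) D *)
Definition is_dual X D (ev : Mor (D \ox X) tone) (coev : Mor tone (X \ox D)) :=
  runit X \oc (idm X \om ev) \oc assoc X D X \oc (coev \om idm X) \oc luniti X
    = idm X /\
  lunit D \oc (ev \om idm D) \oc associ D X D \oc (idm D \om coev) \oc runiti D
    = idm D.

End Monoidal.

Section FullMonoidalSubcategory.
Variables (K : fieldType) (C : monCat K).

Definition fullsub_mon (P : C -> Prop) (P1 : P tone)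
    (PM : forall X Y : C, P X -> P Y -> P (X \ox Y)) : monCat K :=
  @MonCat K (fullsub P)
    (fun X Y => exist _ (sval X \ox sval Y) (PM _ _ (svalP X) (svalP Y)))
    (fun X X' Y Y' => @tensm K C (sval X) (sval X') (sval Y) (sval Y'))
    (fun X X' Y Y' => @tensm_linl K C (sval X) (sval X') (sval Y) (sval Y'))
    (fun X X' Y Y' => @tensm_linr K C (sval X) (sval X') (sval Y) (sval Y'))
    (fun X Y => @tensm_id K C (sval X) (sval Y))
    (fun X X' X'' Y Y' Y'' => @tensm_comp K C (sval X) (sval X') (sval X'')
       (sval Y) (sval Y') (sval Y''))
    (exist _ tone P1)
    (fun X Y Z => assoc (sval X) (sval Y) (sval Z))
    (fun X Y Z => associ (sval X) (sval Y) (sval Z))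
    (fun X Y Z => assocP (sval X) (sval Y) (sval Z))
    (fun X X' Y Y' Z Z' => @assoc_nat K C (sval X) (sval X') (sval Y) (sval Y')
       (sval Z) (sval Z'))
    (fun X => lunit (sval X)) (fun X => luniti (sval X))
    (fun X => lunitP (sval X))
    (fun X X' => @lunit_nat K C (sval X) (sval X'))
    (fun X => runit (sval X)) (fun X => runiti (sval X))
    (fun X => runitP (sval X))
    (fun X X' => @runit_nat K C (sval X) (sval X'))
    (fun X Y Z W => pentagon (sval X) (sval Y) (sval Z) (sval W))
    (fun X Y => triangle (sval X) (sval Y)).

End FullMonoidalSubcategory.

(* (F, J) is a tensor functor: J is a natural isomorphism compatible with the
   associativity and unit constraints *)
Definition is_tensor_functor (K : fieldType) (C D : monCat K) (F : functor C D)
    (J : forall X Y : C, Mor (F X \ox F Y) (F (X \ox Y))) :=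
  [/\ forall X Y, is_iso (J X Y),
      forall X X' Y Y' (f : Mor X X') (g : Mor Y Y'),
        J X' Y' \oc (fmor F f \om fmor F g) = fmor F (f \om g) \oc J X Y,
      forall X Y Z,
        fmor F (assoc X Y Z) \oc J (X \ox Y) Z \oc (J X Y \om idm (F Z))
        = J X (Y \ox Z) \oc (idm (F X) \om J Y Z) \oc assoc (F X) (F Y) (F Z) &
      exists2 u : Mor tone (F tone), is_iso u &
        (forall X, fmor F (lunit X) \oc J tone X \oc (u \om idm (F X))
          = lunit (F X)) /\
        (forall X, fmor F (runit X) \oc J X tone \oc (idm (F X) \om u)
          = runit (F X))].

Definition is_tensor_equivalence (K : fieldType) (C D : monCat K)
    (F : functor C D) (J : forall X Y : C, Mor (F X \ox F Y) (F (X \ox Y))) :=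
  is_tensor_functor J /\ is_equivalence F.

Record ribbonCat (K : fieldType) := RibbonCat {
  rcat :> monCat K;
  rc_abelian : abelian rcat;
  rc_semisimple : semisimple rcat;
  rc_simple1 : simple (tone : rcat);
  braid : forall X Y : rcat, Mor (X \ox Y) (Y \ox X);
  braid_iso : forall X Y, is_iso (braid X Y);
  braid_nat : forall (X X' Y Y' : rcat) (f : Mor X X') (g : Mor Y Y'),
    braid X' Y' \oc (f \om g) = (g \om f) \oc braid X Y;
  hexagon1 : forall X Y Z : rcat,
    assoc Y Z X \oc braid X (Y \ox Z) \oc assoc X Y Z
    = (idm Y \om braid X Z) \oc assoc Y X Z \oc (braid X Y \om idm Z);
  hexagon2 : forall X Y Z : rcat,
    associ Z X Y \oc braid (X \ox Y) Z \oc associ X Y Z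
    = (braid X Z \om idm Y) \oc associ X Z Y \oc (idm X \om braid Y Z);
  cdual : rcat -> rcat;
  ev : forall X, Mor (cdual X \ox X) tone;
  coev : forall X, Mor tone (X \ox cdual X);
  dualP : forall X, is_dual (ev X) (coev X);
  predual : forall X : rcat, exists (D : rcat) (e : Mor (X \ox D) tone)
    (c : Mor tone (D \ox X)), is_dual e c;
  twist : forall X : rcat, Mor X X;
  twist_iso : forall X, is_iso (twist X);
  twist_nat : forall (X Y : rcat) (f : Mor X Y),
    twist Y \oc f = f \oc twist X;
  twist1 : twist tone = idm tone;
  twist_tens : forall X Y : rcat,
    twist (X \ox Y) = braid Y X \oc braid X Y \oc (twist X \om twist Y);
  (* theta_{X^*} = (theta_X)^* *)
  twist_dual : forall X : rcat, twist (cdual X) =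
    lunit (cdual X) \oc (ev X \om idm (cdual X)) \oc associ (cdual X) X (cdual X)
      \oc (idm (cdual X) \om (twist X \om idm (cdual X)))
      \oc (idm (cdual X) \om coev X) \oc runiti (cdual X)
}.
Arguments braid {K C} X Y : rename.
Arguments cdual {K C} X : rename.
Arguments ev {K C} X : rename.
Arguments coev {K C} X : rename.
Arguments twist {K C} X : rename.

Section Ribbon.
Variables (K : fieldType) (C : ribbonCat K).

(* the quantum dimension, an element of End(1) = K *)
Definition qdim (X : C) : Mor (tone : C) tone :=
  ev X \oc braid X (cdual X) \oc (twist X \om idm (cdual X)) \oc coev X.

Definition nondegenerate (X : C) (e : Mor (X \ox X) tone) :=
  exists2 phi : Mor X (cdual X), is_iso phi & ev X \oc (phi \om idm X) = e.

Record calgebra := CAlgebra {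
  alg :> C;
  mul : Mor (alg \ox alg) alg;
  mulA : mul \oc (mul \om idm alg)
    = mul \oc (idm alg \om mul) \oc assoc alg alg alg;
  mulC : mul \oc braid alg alg = mul;
  aone : Mor tone alg;
  aone_monic : monic aone;
  mul1 : mul \oc (aone \om idm alg) = lunit alg;
  aone_dim : \dim {: Mor (tone : C) alg} = 1%N
}.

Definition rigid_alg (A : calgebra) :=
  (exists2 eps : Mor (alg A) tone,
      eps \oc aone A = idm tone & nondegenerate (eps \oc mul A)) /\
  qdim A <> 0.

Definition symmetric_on (P : C -> Prop) :=
  forall X Y : C, P X -> P Y -> braid Y X \oc braid X Y = idm (X \ox Y).

End Ribbon.

Section Box.
Variables (K : fieldType) (C : ribbonCat K).
Implicit Types (V W : vectType K) (L M Y : C).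

(* V [x] L is the object with Mor(Y, V [x] L) = V (x) Mor(Y, L): with
   V (x) Mor(Y, L) = Hom(V^*, Mor(Y, L)), the identification sends h to
   phi |-> bx_proj phi \oc h. *)
Record box (V : vectType K) (L : C) := Box {
  bx_ob :> C;
  bx_proj : 'Hom(vdual V, Mor bx_ob L);
  bx_univ : forall (Y : C) (T : vtens V (Mor Y L)),
    exists! h : Mor Y bx_ob, forall phi, bx_proj phi \oc h = T phi
}.

Lemma power_exists (L : C) n : exists (X : C) (p : 'I_n -> Mor X L),
  forall Y (t : 'I_n -> Mor Y L), exists! h : Mor Y X, forall k, p k \oc h = t k.
Proof.
elim: n => [|n [X [p Xp]]].
  have [Z Z0] := ab_zero (rc_abelian C).
  exists Z, (fun=> 0) => Y t; exists 0; split=> [[]//|h _].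
  by rewrite ((Z0 _).1 h).
have [P [i1 [i2 [p1 [p2 [p1i1 p2i2 p1i2 p2i1 ip]]]]]] :=
  ab_biproduct (rc_abelian C) L X.
exists P, (fun k => oapp (fun j => p j \oc p2) p1 (unlift ord0 k)) => Y t.
have [h [ht hu]] := Xp Y (fun j => t (lift ord0 j)).
exists (i1 \oc t ord0 + i2 \oc h); split=> [k|h' h't].
  case: (unliftP ord0 k) => [j ->|->] /=.
    by rewrite -compA compDr !compA p2i1 p2i2 comp0m comp1m add0r ht.
  by rewrite compDr !compA p1i1 p1i2 comp0m comp1m addr0.
have <- : p1 \oc h' = t ord0 by have := h't ord0; rewrite unlift_none.
have <- : p2 \oc h' = h.
  by apply/esym/hu => j; have := h't (lift ord0 j); rewrite liftK /= compA.
by rewrite !compA -compDl ip comp1m.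
Qed.

Lemma box_exists V L : inhabited (box V L).
Proof.
have [X [p Xp]] := power_exists L (\dim {: V}).
pose q : 'Hom(vdual V, Mor X L) :=
  linfun (fun phi : vdual V => \sum_k (phi (vb k) : K) *: p k).
have qE phi : q phi = \sum_k (phi (vb k) : K) *: p k.
  rewrite linfunP // => a x y; rewrite scaler_sumr -big_split.
  by apply: eq_bigr => k _; rewrite add_lfunE scale_lfunE scalerDl scalerA.
have qb k : q (vbd k) = p k.
  rewrite qE (bigD1 k) //= big1 ?addr0 => [|j jk]; rewrite vbd_vb.
    by rewrite eqxx scale1r.
  by rewrite eq_sym (negPf jk) scale0r.
constructor; exists X q => Y T.
have [h [hT hu]] := Xp Y (fun k => T (vbd k)).
exists h; split=> [phi|h' h'T]; last by apply: hu => k; rewrite -qb.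
rewrite qE comp_suml [in RHS](vbd_expand phi) linear_sum; apply: eq_bigr => k _.
by rewrite compZl hT linearZ.
Qed.

Definition the_box V L : box V L := inhabited_witness (box_exists V L).
Notation "V \bx L" := (the_box V L) (at level 39, left associativity).

Lemma box_ext V L Y (h h' : Mor Y (V \bx L)) :
  (forall phi, bx_proj (V \bx L) phi \oc h = bx_proj (V \bx L) phi \oc h') ->
  h = h'.
Proof.
move=> hh'; pose t (phi : vdual V) := bx_proj (V \bx L) phi \oc h.
have tE phi : linfun t phi = t phi.
  by rewrite linfunP // => a x y; rewrite /t linearP compDl compZl.
have [h0 [_ hu]] := bx_univ (V \bx L) (linfun t : vtens V (Mor Y L)).
by rewrite -(hu h) => [|phi]; [apply: hu => phi; rewrite tE /t hh'|rewrite tE].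
Qed.

Definition box_lift V L Y (T : vtens V (Mor Y L)) : Mor Y (V \bx L) :=
  projT1 (cid (bx_univ (V \bx L) T)).

Lemma box_liftE V L Y (T : vtens V (Mor Y L)) phi :
  bx_proj (V \bx L) phi \oc box_lift T = T phi.
Proof. by rewrite /box_lift; case: cid => h /= []. Qed.

Definition boxm V W L M (f : 'Hom(V, W)) (u : Mor L M) : Mor (V \bx L) (W \bx M) :=
  box_lift (linfun (fun psi : vdual W =>
    u \oc bx_proj (V \bx L) (psi \o f)%VF) : vtens W (Mor (V \bx L) M)).

Lemma boxmE V W L M (f : 'Hom(V, W)) (u : Mor L M) psi :
  bx_proj (W \bx M) psi \oc boxm f u = u \oc bx_proj (V \bx L) (psi \o f)%VF.
Proof.
rewrite box_liftE linfunP // => a x y.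
by rewrite comp_lfunDl -comp_lfunZl linearP compDr compZr.
Qed.

Lemma boxm_id V L : boxm \1%VF (idm L) = idm (V \bx L).
Proof. by apply: box_ext => p; rewrite boxmE comp_lfun1r comp1m compm1. Qed.

Lemma boxm_comp V V' V'' L L' L'' (f' : 'Hom(V', V'')) (f : 'Hom(V, V'))
    (u' : Mor L' L'') (u : Mor L L') :
  boxm (f' \o f)%VF (u' \oc u) = boxm f' u' \oc boxm f u.
Proof.
by apply: box_ext => p; rewrite boxmE compA boxmE -!compA boxmE comp_lfunA.
Qed.

Lemma boxm_linl V W L M (u : Mor L M) :
  linear (fun f : 'Hom(V, W) => boxm f u).
Proof.
move=> a f g; apply: box_ext => p.
rewrite boxmE compDr compZr !boxmE comp_lfunDr -comp_lfunZr linearP.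
by rewrite compDr compZr.
Qed.

(* the canonical identification
   (V [x] L) (x) (W [x] M) = (V (x) W) [x] (L (x) M) *)
Definition box_tens V W L M :
    Mor ((V \bx L) \ox (W \bx M)) (vtens V W \bx (L \ox M)) :=
  box_lift (linfun (fun Xi : vdual (vtens V W) =>
      \sum_k \sum_l (Xi (vpure (vb k) (vb l)) : K) *:
        (bx_proj (V \bx L) (vbd k) \om bx_proj (W \bx M) (vbd l)))
    : vtens (vtens V W) (Mor ((V \bx L) \ox (W \bx M)) (L \ox M))).

Lemma tensm_suml (X X' Y Y' : C) J (r : seq J) (f : J -> Mor X X') (g : Mor Y Y') :
  (\sum_(j <- r) f j) \om g = \sum_(j <- r) f j \om g.
Proof.
have D (x y : Mor X X') : (x + y) \om g = x \om g + y \om g.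
  by have := tensm_linl g 1 x y; rewrite !scale1r.
apply: (big_morph (fun x => x \om g)) => // .
by have := D 0 0; rewrite addr0 => /(congr1 (fun x => x - 0 \om g)); rewrite subrr addrK.
Qed.

Lemma tensm_sumr (X X' Y Y' : C) J (r : seq J) (f : Mor X X') (g : J -> Mor Y Y') :
  f \om (\sum_(j <- r) g j) = \sum_(j <- r) f \om g j.
Proof.
have D (x y : Mor Y Y') : f \om (x + y) = f \om x + f \om y.
  by have := tensm_linr f 1 x y; rewrite !scale1r.
apply: (big_morph (fun x => f \om x)) => // .
by have := D 0 0; rewrite addr0 => /(congr1 (fun x => x - f \om 0)); rewrite subrr addrK.
Qed.

Lemma tensmZl (X X' Y Y' : C) a (f : Mor X X') (g : Mor Y Y') :
  (a *: f) \om g = a *: (f \om g).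
Proof.
have := tensm_linl g a f 0; rewrite addr0 => ->.
suff -> : (0 : Mor X X') \om g = 0 by rewrite addr0.
by have := tensm_suml (Nil nat) (fun=> 0 : Mor X X') g; rewrite !big_nil.
Qed.

Lemma tensmZr (X X' Y Y' : C) a (f : Mor X X') (g : Mor Y Y') :
  f \om (a *: g) = a *: (f \om g).
Proof.
have := tensm_linr f a g 0; rewrite addr0 => ->.
suff -> : f \om (0 : Mor Y Y') = 0 by rewrite addr0.
by have := tensm_sumr (Nil nat) f (fun=> 0 : Mor Y Y'); rewrite !big_nil.
Qed.

Lemma box_tensE V W L M (phi : vdual V) (psi : vdual W) :
  bx_proj (vtens V W \bx (L \ox M)) (vtdual phi psi) \oc box_tens V W L M
  = bx_proj (V \bx L) phi \om bx_proj (W \bx M) psi.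
Proof.
rewrite box_liftE linfunP => [|a x y]; last first.
  rewrite scaler_sumr -big_split; apply: eq_bigr => k _.
  rewrite scaler_sumr -big_split; apply: eq_bigr => l _.
  by rewrite add_lfunE scale_lfunE scalerDl scalerA.
rewrite [in RHS](vbd_expand phi) linear_sum tensm_suml; apply: eq_bigr => k _.
rewrite [in RHS](vbd_expand psi) linear_sum tensm_sumr; apply: eq_bigr => l _.
by rewrite !linearZ /= tensmZl tensmZr scalerA vtdualE vpureE linearZ.
Qed.

Lemma box_ext2 V W L Y (h h' : Mor Y (vtens V W \bx L)) :
  (forall (phi : vdual V) (psi : vdual W),
     bx_proj (vtens V W \bx L) (vtdual phi psi) \oc h
     = bx_proj (vtens V W \bx L) (vtdual phi psi) \oc h') -> h = h'.
Proof.
move=> hh'; apply: box_ext => Xi; rewrite (vtensdual_expand Xi).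
rewrite !linear_sum !comp_suml; apply: eq_bigr => k _.
rewrite !linear_sum !comp_suml; apply: eq_bigr => l _.
by rewrite !linearZ /= !compZl hh'.
Qed.

Lemma box_tens_nat V V' W W' L L' M M' (f : 'Hom(V, V')) (u : Mor L L')
    (g : 'Hom(W, W')) (v : Mor M M') :
  box_tens V' W' L' M' \oc (boxm f u \om boxm g v)
  = boxm (vtensm f g) (u \om v) \oc box_tens V W L M.
Proof.
apply: box_ext2 => phi psi; rewrite compA box_tensE -tensm_comp !boxmE.
rewrite compA boxmE -compA tensm_comp -box_tensE; congr (_ \oc (bx_proj _ _ \oc _)).
by apply/lfunP => S; rewrite !(comp_lfunE, vtdualE, vtensmE).
Qed.

End Box.
Notation "V \bx L" := (the_box V L) (at level 39, left associativity).

Section Invariants.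
Variables (K : fieldType) (C : ribbonCat K) (G : Type).

Definition equivariant (M N : C) (rho : G -> Mor M M) (sigma : G -> Mor N N)
  (f : Mor M N) := forall g, sigma g \oc f = f \oc rho g.

(* the object M^G with Mor(Y, M^G) = Mor(Y, M)^G, the identification being
   composition with fx_incl *)
Record fixed (M : C) (rho : G -> Mor M M) := Fixed {
  fx_ob :> C;
  fx_incl : Mor fx_ob M;
  fx_inv : forall g, rho g \oc fx_incl = fx_incl;
  fx_univ : forall (Y : C) (x : Mor Y M), (forall g, rho g \oc x = x) ->
    exists! h : Mor Y fx_ob, fx_incl \oc h = x
}.

Lemma common_kernel (M : C) n (f : 'I_n -> Mor M M) : exists (N : C) (k : Mor N M),
  (forall j, f j \oc k = 0) /\
  forall Y (x : Mor Y M), (forall j, f j \oc x = 0) -> exists! h, k \oc h = x.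
Proof.
elim: n f => [|n IH] f.
  exists M, (idm M); split=> [[]//|Y x _]; exists x.
  by split=> [|h]; rewrite comp1m.
have [N [k [fk ku]]] := IH (fun j => f (lift ord0 j)).
have [N' [k' [fk' k'u]]] := ab_kernel (rc_abelian C) (f ord0 \oc k).
exists N', (k \oc k'); split=> [j|Y x fx].
  case: (unliftP ord0 j) => [i|] ->; first by rewrite compA fk comp0m.
  by rewrite compA.
have [y [ky yu]] := ku _ x (fun j => fx _).
have [|z [k'z zu]] := k'u _ y; first by rewrite -compA ky.
exists z; split=> [|z' xz']; first by rewrite -compA k'z.
by apply: zu; apply/esym/yu; rewrite compA.
Qed.

Lemma fixed_exists M (rho : G -> Mor M M) : inhabited (fixed rho).
Proof.
(* End(M) is finite-dimensional, so the span of the rho g - id is the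
   annihilator of an object obtained from finitely many endomorphisms *)
pose P (f : Mor M M) := forall Y (x : Mor Y M),
  (forall g, rho g \oc x = x) -> f \oc x = 0.
have P0 : P 0 by move=> Y x _; rewrite comp0m.
have Plin a u v : P u -> P v -> P (a *: u + v).
  by move=> Pu Pv Y x xi; rewrite compDl compZl Pu // Pv // scaler0 addr0.
have [U UP] := vspace_of_subproof P0 Plin.
have [N [k [Uk ku]]] := common_kernel (fun j : 'I_(\dim U) => (vbasis U)`_j).
have Uk' f : f \in U -> f \oc k = 0.
  move=> fU; rewrite (coord_vbasis fU) comp_suml big1 // => j _.
  by rewrite compZl Uk scaler0.
constructor; exists N k => [g|Y x xi].
  have : (rho g - idm M) \oc k = 0.
    apply: Uk'; apply/UP => Y x xi.
    by rewrite compDl -scaleN1r compZl scaleN1r xi comp1m subrr.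
  by rewrite compDl -scaleN1r compZl scaleN1r comp1m => /eqP; rewrite subr_eq0 => /eqP.
apply: ku => j; have /UP Pj : (vbasis U)`_j \in U by rewrite vbasis_mem ?mem_nth ?size_tuple.
exact: Pj.
Qed.

Definition the_fixed M (rho : G -> Mor M M) : fixed rho :=
  inhabited_witness (fixed_exists rho).

Definition fixed_lift M (rho : G -> Mor M M) Y (x : Mor Y M)
    (xi : forall g, rho g \oc x = x) : Mor Y (the_fixed rho) :=
  projT1 (cid (fx_univ (the_fixed rho) xi)).

Lemma fixed_liftE M (rho : G -> Mor M M) Y (x : Mor Y M) xi :
  fx_incl (the_fixed rho) \oc @fixed_lift M rho Y x xi = x.
Proof. by rewrite /fixed_lift; case: cid => h /= []. Qed.

Lemma fixed_ext M (rho : G -> Mor M M) : monic (fx_incl (the_fixed rho)).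
Proof.
move=> Y h h' hh'; have xi g : rho g \oc (fx_incl (the_fixed rho) \oc h)
    = fx_incl (the_fixed rho) \oc h by rewrite compA fx_inv.
have [h0 [_ hu]] := fx_univ (the_fixed rho) xi.
by rewrite -(hu h) // -(hu h').
Qed.

Lemma fixedm_subproof M N (rho : G -> Mor M M) (sigma : G -> Mor N N)
    (f : Mor M N) : equivariant rho sigma f ->
  forall g, sigma g \oc (f \oc fx_incl (the_fixed rho))
    = f \oc fx_incl (the_fixed rho).
Proof. by move=> fe g; rewrite compA fe -compA fx_inv. Qed.

Definition fixedm M N (rho : G -> Mor M M) (sigma : G -> Mor N N) (f : Mor M N)
    (fe : equivariant rho sigma f) : Mor (the_fixed rho) (the_fixed sigma) :=
  fixed_lift (fixedm_subproof fe).

Lemma fixedmE M N rho sigma f fe :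
  fx_incl _ \oc @fixedm M N rho sigma f fe = f \oc fx_incl _.
Proof. exact: fixed_liftE. Qed.

Lemma fixed_tens_subproof M N (rho : G -> Mor M M) (sigma : G -> Mor N N) g :
  (rho g \om sigma g) \oc (fx_incl (the_fixed rho) \om fx_incl (the_fixed sigma))
  = fx_incl (the_fixed rho) \om fx_incl (the_fixed sigma).
Proof. by rewrite -tensm_comp !fx_inv. Qed.

Definition fixed_tens M N (rho : G -> Mor M M) (sigma : G -> Mor N N) :
    Mor (the_fixed rho \ox the_fixed sigma)
        (the_fixed (fun g => rho g \om sigma g)) :=
  fixed_lift (fixed_tens_subproof rho sigma).

End Invariants.

HB.mixin Record isTopGroup G of Group G & Topological G := {
  mulg_continuous : continuous (fun x : G * G => (x.1 * x.2)%g);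
  invg_continuous : continuous (fun x : G => (x^-1)%g)
}.
HB.structure Definition TopGroup := {G of isTopGroup G & Group G & Topological G}.
Notation topGroupType := TopGroup.type.

Section Representations.
Variables (K : numFieldType) (G : topGroupType).
Implicit Types (V W : vectType K).

(* continuity of a map into a finite-dimensional space *)
Definition vcontinuous V (f : G -> V) :=
  forall l : vdual V, continuous (fun g => l (f g) : K^o).

Lemma vcontinuous_lin V W (L : 'Hom(V, W)) (f : G -> V) :
  vcontinuous f -> vcontinuous (fun g => L (f g)).
Proof.
move=> fc l; rewrite (_ : (fun g => _) = (fun g => (l \o L)%VF (f g) : K^o)).
  exact: fc.
by apply/funext => g; rewrite comp_lfunE.
Qed.

Lemma vcontinuous_bilin V V' W (B : V -> V' -> W) (f : G -> V) (f' : G -> V') :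
  (forall v', linear (B^~ v')) -> (forall v, linear (B v)) ->
  vcontinuous f -> vcontinuous f' -> vcontinuous (fun g => B (f g) (f' g)).
Proof.
move=> Bl Br fc fc' l.
have E g : l (B (f g) (f' g)) = \sum_(k < \dim {: V}) \sum_(j < \dim {: V'})
    (((vbd k (f g) : K^o) * (vbd j (f' g) : K^o) * (l (B (vb k) (vb j)) : K^o))
     : K^o).
  rewrite -(linfunP (Bl (f' g))) {1}(vb_expand (f g)) !linear_sum.
  apply: eq_bigr => k _; rewrite !linearZ /= (linfunP (Bl (f' g))).
  rewrite -(linfunP (Br (vb k))) {1}(vb_expand (f' g)) !linear_sum /=.
  apply: eq_bigr => j _.
  by rewrite !linearZ /= (linfunP (Br (vb k))) scalerA; congr (_ * _); apply: mulrC.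
rewrite (_ : (fun g => _) = (fun g => \sum_(k < \dim {: V})
    \sum_(j < \dim {: V'}) (((vbd k (f g) : K^o) * (vbd j (f' g) : K^o)
      * (l (B (vb k) (vb j)) : K^o)) : K^o))); last exact/funext.
have addc : continuous (fun x : K^o * K^o => x.1 + x.2) by exact: add_continuous.
move=> g; apply: (cvg_big addc) => k _; apply: (cvg_big addc) => j _.
apply: cvgM; last exact: cvg_cst.
by apply: cvgM; [exact: fc|exact: fc'].
Qed.

Record rep := Rep {
  rsp :> vectType K;
  ract : G -> 'End(rsp);
  ract1 : ract 1%g = \1%VF;
  ractM : forall g h, ract (g * h)%g = (ract g \o ract h)%VF;
  ract_cont : vcontinuous ract
}.
Arguments ract : clear implicits.

Definition intertwines (V W : rep) (f : 'Hom(V, W)) :=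
  forall g, (f \o ract V g = ract W g \o f)%VF.

Lemma intertwines0 (V W : rep) : @intertwines V W 0.
Proof. by move=> g; rewrite comp_lfun0l comp_lfun0r. Qed.

Lemma intertwines_lin (V W : rep) a (f f' : 'Hom(V, W)) :
  intertwines f -> intertwines f' -> intertwines (a *: f + f').
Proof.
move=> fi f'i g.
by rewrite comp_lfunDl comp_lfunDr -comp_lfunZl -comp_lfunZr fi f'i.
Qed.

Definition hom_rep (V W : rep) : {vspace 'Hom(V, W)} :=
  vspace_of (@intertwines0 V W) (@intertwines_lin V W).

Lemma hom_repP (V W : rep) f : f \in hom_rep V W <-> intertwines f.
Proof. exact: vspace_ofP. Qed.

Definition rhom (V W : rep) : vectType K := subvs_of (hom_rep V W).

Definition mk_rhom (V W : rep) (f : 'Hom(V, W)) (fi : intertwines f) : rhom V W :=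
  Subvs (proj2 (hom_repP f) fi).

Lemma rhom_intertwines (V W : rep) (f : rhom V W) : intertwines (vsval f).
Proof. exact/hom_repP/subvsP. Qed.

Lemma id_intertwines (V : rep) : @intertwines V V \1%VF.
Proof. by move=> g; rewrite comp_lfun1l comp_lfun1r. Qed.

Lemma comp_intertwines (U V W : rep) (f : 'Hom(V, W)) (f' : 'Hom(U, V)) :
  intertwines f -> intertwines f' -> @intertwines U W (f \o f')%VF.
Proof. by move=> fi f'i g; rewrite -comp_lfunA f'i !comp_lfunA fi. Qed.

Definition rid (V : rep) : rhom V V := mk_rhom (@id_intertwines V).
Definition rcomp (U V W : rep) (f : rhom V W) (f' : rhom U V) : rhom U W :=
  mk_rhom (comp_intertwines (rhom_intertwines f) (rhom_intertwines f')).

Lemma rhomP (V W : rep) (f f' : rhom V W) : vsval f = vsval f' -> f = f'.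
Proof. exact: val_inj. Qed.

Lemma rcomp_linl (U V W : rep) (f : rhom U V) :
  linear (fun g : rhom V W => rcomp g f).
Proof.
by move=> a x y; apply: rhomP; rewrite /= comp_lfunDl -comp_lfunZl.
Qed.

Lemma rcomp_linr (U V W : rep) (g : rhom V W) : linear (@rcomp U V W g).
Proof.
by move=> a x y; apply: rhomP; rewrite /= comp_lfunDr -comp_lfunZr.
Qed.

Lemma rcompA (U V W X : rep) (h : rhom W X) (g : rhom V W) (f : rhom U V) :
  rcomp h (rcomp g f) = rcomp (rcomp h g) f.
Proof. by apply: rhomP; rewrite /= comp_lfunA. Qed.

Lemma rcomp1m (V W : rep) (f : rhom V W) : rcomp (rid W) f = f.
Proof. by apply: rhomP; rewrite /= comp_lfun1l. Qed.

Lemma rcompm1 (V W : rep) (f : rhom V W) : rcomp f (rid V) = f.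
Proof. by apply: rhomP; rewrite /= comp_lfun1r. Qed.

Definition repLin : linCat K :=
  LinCat rcomp_linl rcomp_linr rcompA rcomp1m rcompm1.

Section Dual.
Variable V : rep.
Let act (g : G) : 'End(vdual V) := vtr (ract V g^-1%g).
Lemma rdual1 : act 1%g = \1%VF.
Proof.
by apply/lfunP => p; rewrite /act vtrE invg1 ract1 comp_lfun1r id_lfunE.
Qed.
Lemma rdualM g h : act (g * h)%g = (act g \o act h)%VF.
Proof.
by apply/lfunP => p; rewrite comp_lfunE /act !vtrE invgM ractM comp_lfunA.
Qed.
Lemma rdual_cont : vcontinuous act.
Proof.
pose tr : 'Hom('End(V), 'End(vdual V)) := linfun (@vtr K V V).
have trE f : tr f = vtr f.
  rewrite linfunP // => a x y; apply/lfunP => p.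
  by rewrite add_lfunE scale_lfunE !vtrE comp_lfunDr -comp_lfunZr.
move=> l; have lc : vcontinuous (fun g => tr (ract V g)).
  by apply: vcontinuous_lin; exact: ract_cont.
rewrite (_ : (fun g => _) =
    (fun g => l (tr (ract V g)) : K^o) \o (fun g : G => g^-1%g)).
  by move=> g; apply: continuous_comp; [exact: invg_continuous|exact: (lc l)].
by apply/funext => g; rewrite /= trE.
Qed.
Definition rdual : rep := Rep rdual1 rdualM rdual_cont.
End Dual.

Section Tensor.
Variables V W : rep.
Let act (g : G) : 'End(vtens V W) := vtensm (ract V g) (ract W g).
Lemma rtens1 : act 1%g = \1%VF.
Proof.
apply/lfunP => T; apply/lfunP => p.
by rewrite vtensmE !ract1 comp_lfun1r !id_lfunE.
Qed.
Lemma rtensM g h : act (g * h)%g = (act g \o act h)%VF.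
Proof.
apply/lfunP => T; apply/lfunP => p.
by rewrite comp_lfunE !vtensmE !ractM comp_lfunE comp_lfunA.
Qed.
Lemma rtens_cont : vcontinuous act.
Proof.
apply: (@vcontinuous_bilin _ _ _ (@vtensm K V V W W)) => [f' a x y|f a x y||].
- apply/lfunP => T; apply/lfunP => p.
  rewrite add_lfunE scale_lfunE add_lfunE scale_lfunE !vtensmE.
  by rewrite comp_lfunDr -comp_lfunZr !linearP.
- apply/lfunP => T; apply/lfunP => p.
  by rewrite add_lfunE scale_lfunE add_lfunE scale_lfunE !vtensmE
    add_lfunE scale_lfunE.
- exact: ract_cont.
- exact: ract_cont.
Qed.
Definition rtens : rep := Rep rtens1 rtensM rtens_cont.
End Tensor.

Section Trivial.
Let act (g : G) : 'End(K^o) := \1%VF.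
Lemma rone1 : act 1%g = \1%VF. Proof. by []. Qed.
Lemma roneM g h : act (g * h)%g = (act g \o act h)%VF.
Proof. by rewrite /act comp_lfun1l. Qed.
Lemma rone_cont : vcontinuous act.
Proof. by move=> l g; exact: cvg_cst. Qed.
Definition rone : rep := Rep rone1 roneM rone_cont.
End Trivial.

Lemma rtensm_subproof (V V' W W' : rep) (f : rhom V V') (g : rhom W W') :
  @intertwines (rtens V W) (rtens V' W') (vtensm (vsval f) (vsval g)).
Proof.
move=> a; apply/lfunP => T; apply/lfunP => p; rewrite !comp_lfunE !vtensmE.
have /lfunP/(_ (T (p \o ract V' a \o vsval f)%VF)) := rhom_intertwines g a.
rewrite !comp_lfunE => <-; rewrite -!comp_lfunA.
by rewrite (rhom_intertwines f a).
Qed.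
Definition rtensm (V V' W W' : rep) (f : rhom V V') (g : rhom W W') :
    rhom (rtens V W) (rtens V' W') := mk_rhom (rtensm_subproof f g).

Lemma vtdual_act (V W : rep) (p : vdual V) (q : vdual W) g :
  (vtdual p q \o vtensm (ract V g) (ract W g))%VF
  = vtdual (p \o ract V g)%VF (q \o ract W g)%VF.
Proof. by apply/lfunP => S; rewrite !(comp_lfunE, vtdualE, vtensmE). Qed.

Lemma rassoc_subproof (U V W : rep) :
  @intertwines (rtens (rtens U V) W) (rtens U (rtens V W)) (vassoc U V W).
Proof.
move=> g; apply/lfunP => T; apply/lfunP => p; apply/lfunP => q.
rewrite !comp_lfunE vassocE vtensmE vtdual_act.
by rewrite vtensmE vtensmE vassocE.
Qed.
Definition rassoc (U V W : rep) := mk_rhom (@rassoc_subproof U V W).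

Lemma inv_intertwines (V W : rep) (f : 'Hom(V, W)) (f' : 'Hom(W, V)) :
  cancel f f' -> cancel f' f -> intertwines f -> intertwines f'.
Proof.
move=> fK f'K fi g; apply/lfunP => x; rewrite !comp_lfunE.
by have /lfunP/(_ (f' x)) := fi g; rewrite !comp_lfunE f'K => <-; rewrite fK.
Qed.

Definition rassoci (U V W : rep) :=
  mk_rhom (@inv_intertwines (rtens (rtens U V) W) (rtens U (rtens V W))
    (vassoc U V W) (vassoci U V W) (@vassocK K U V W) (@vassociK K U V W)
    (@rassoc_subproof U V W)).

Lemma rluniti_subproof (V : rep) : @intertwines V (rtens rone V) (vluniti V).
Proof.
move=> g; apply/lfunP => v.
by rewrite !comp_lfunE !vlunitiE vtensm_pure id_lfunE.
Qed.

Lemma rruniti_subproof (V : rep) : @intertwines V (rtens V rone) (vruniti V).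
Proof.
move=> g; apply/lfunP => v.
by rewrite !comp_lfunE !vrunitiE vtensm_pure id_lfunE.
Qed.

Definition rluniti (V : rep) := mk_rhom (@rluniti_subproof V).
Definition rlunit (V : rep) :=
  mk_rhom (@inv_intertwines V (rtens rone V) (vluniti V) (vlunit V)
    (@vlunitiK K V) (@vlunitK K V) (@rluniti_subproof V)).
Definition rruniti (V : rep) := mk_rhom (@rruniti_subproof V).
Definition rrunit (V : rep) :=
  mk_rhom (@inv_intertwines V (rtens V rone) (vruniti V) (vrunit V)
    (@vrunitiK K V) (@vrunitK K V) (@rruniti_subproof V)).

Lemma rtensm_linl (V V' W W' : rep) (g : rhom W W') :
  linear (fun f : rhom V V' => rtensm f g).
Proof.
move=> a x y; apply: rhomP; rewrite /=; apply/lfunP => T; apply/lfunP => p.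
rewrite add_lfunE scale_lfunE add_lfunE scale_lfunE !vtensmE.
by rewrite comp_lfunDr -comp_lfunZr !linearP.
Qed.

Lemma rtensm_linr (V V' W W' : rep) (f : rhom V V') :
  linear (@rtensm V V' W W' f).
Proof.
move=> a x y; apply: rhomP; rewrite /=; apply/lfunP => T; apply/lfunP => p.
by rewrite add_lfunE scale_lfunE add_lfunE scale_lfunE !vtensmE
  add_lfunE scale_lfunE.
Qed.

Lemma rtensm_id (V W : rep) : rtensm (rid V) (rid W) = rid (rtens V W).
Proof.
apply: rhomP; apply/lfunP => T; apply/lfunP => p /=.
by rewrite vtensmE comp_lfun1r !id_lfunE.
Qed.

Lemma rtensm_comp (V V' V'' W W' W'' : rep) (f' : rhom V' V'') (f : rhom V V')
    (g' : rhom W' W'') (g : rhom W W') :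
  rtensm (rcomp f' f) (rcomp g' g) = rcomp (rtensm f' g') (rtensm f g).
Proof.
apply: rhomP; apply/lfunP => T; apply/lfunP => p /=.
by rewrite comp_lfunE !vtensmE comp_lfunE comp_lfunA.
Qed.

Lemma rassocP (U V W : rep) : @is_inv K repLin _ _ (rassoc U V W) (rassoci U V W).
Proof.
by split; apply: rhomP; apply/lfunP => T /=;
  rewrite comp_lfunE id_lfunE ?vassocK ?vassociK.
Qed.

Lemma rlunitP (V : rep) : @is_inv K repLin _ _ (rlunit V) (rluniti V).
Proof.
by split; apply: rhomP; apply/lfunP => T /=;
  rewrite comp_lfunE id_lfunE ?vlunitK ?vlunitiK.
Qed.

Lemma rrunitP (V : rep) : @is_inv K repLin _ _ (rrunit V) (rruniti V).
Proof.
by split; apply: rhomP; apply/lfunP => T /=;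
  rewrite comp_lfunE id_lfunE ?vrunitK ?vrunitiK.
Qed.

Lemma rassoc_nat (U U' V V' W W' : rep) (f : rhom U U') (g : rhom V V')
    (h : rhom W W') :
  rcomp (rassoc U' V' W') (rtensm (rtensm f g) h)
  = rcomp (rtensm f (rtensm g h)) (rassoc U V W).
Proof.
apply: rhomP; apply/lfunP => T /=; apply/lfunP => p; apply/lfunP => q.
rewrite !comp_lfunE vassocE !vtensmE vassocE; congr (vsval h (T _)).
by apply/lfunP => S; rewrite !(comp_lfunE, vtdualE, vtensmE).
Qed.

Lemma rlunit_nat (V V' : rep) (f : rhom V V') :
  rcomp (rlunit V') (rtensm (rid rone) f) = rcomp f (rlunit V).
Proof.
apply: rhomP; apply/lfunP => T /=.
by rewrite !comp_lfunE !vlunitE vtensmE comp_lfun1r.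
Qed.

Lemma rruniti_nat (V V' : rep) (f : rhom V V') :
  rcomp (rtensm f (rid rone)) (rruniti V) = rcomp (rruniti V') f.
Proof.
apply: rhomP; apply/lfunP => v /=.
by rewrite !comp_lfunE !vrunitiE vtensm_pure id_lfunE.
Qed.

Lemma rrunit_nat (V V' : rep) (f : rhom V V') :
  rcomp (rrunit V') (rtensm f (rid rone)) = rcomp f (rrunit V).
Proof.
have [K1 _] := rrunitP V; have [_ K2] := rrunitP V'.
have {}K1 : rcomp (rruniti V) (rrunit V) = rid (rtens V rone) := K1.
have {}K2 : rcomp (rrunit V') (rruniti V') = rid V' := K2.
rewrite -[LHS]rcompm1 -K1 -rcompA (rcompA (rtensm _ _)) rruniti_nat.
by rewrite !rcompA K2 rcomp1m.
Qed.

Lemma rpentagon (X Y Z W : rep) :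
  rcomp (rcomp (rtensm (rid X) (rassoc Y Z W)) (rassoc X (rtens Y Z) W))
    (rtensm (rassoc X Y Z) (rid W))
  = rcomp (rassoc X Y (rtens Z W)) (rassoc (rtens X Y) Z W).
Proof.
apply: rhomP; apply/lfunP => T /=.
apply/lfunP => p; apply/lfunP => q; apply/lfunP => s.
rewrite !comp_lfunE vtensmE comp_lfun1r !vassocE vtensmE id_lfunE.
congr (T _); apply/lfunP => S.
by rewrite !(comp_lfunE, vtdualE, vassocE).
Qed.

Lemma rtriangle (X Y : rep) :
  rcomp (rtensm (rid X) (rlunit Y)) (rassoc X rone Y)
  = rtensm (rrunit X) (rid Y).
Proof.
apply: rhomP; apply/lfunP => T /=; apply/lfunP => p.
rewrite !comp_lfunE !vtensmE comp_lfun1r vlunitE vassocE id_lfunE.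
congr (T _); apply/lfunP => S; rewrite vtdualE comp_lfunE id_lfunE vrunitE.
rewrite {1}(vbd_expand p) !linear_sum /=; apply: eq_bigr => k _.
by rewrite !linearZ /= scaleoC.
Qed.

Definition repCat : monCat K :=
  @MonCat K repLin rtens rtensm rtensm_linl rtensm_linr rtensm_id rtensm_comp
    rone rassoc rassoci rassocP rassoc_nat rlunit rluniti rlunitP rlunit_nat
    rrunit rruniti rrunitP rrunit_nat rpentagon rtriangle.

(* V k, k : J, is a system of representatives of the isomorphism classes of
   simple representations *)
Definition is_irreps (J : Type) (V : J -> repCat) :=
  [/\ forall k, simple (V k),
      forall k l, isomorphic (V k) (V l) -> k = l &
      forall W : repCat, simple W -> exists k, isomorphic W (V k)].

End Representations.
Arguments ract {K G} r g.
Arguments repCat : clear implicits.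

Section Phi.
Variables (K : numFieldType) (C : ribbonCat K) (G : topGroupType).
Variable A : calgebra C.

Record alg_action := AlgAction {
  aact :> G -> Mor (alg A) (alg A);
  aact1 : aact 1%g = idm (alg A);
  aactM : forall g h, aact (g * h)%g = aact g \oc aact h;
  aact_mul : forall g, aact g \oc mul A = mul A \oc (aact g \om aact g);
  aact_one : forall g, aact g \oc aone A = aone A;
  aact_cont : vcontinuous aact
}.

Definition faithful (pi : alg_action) := forall g, g <> 1%g -> pi g <> idm (alg A).

Variable pi : alg_action.

(* the diagonal action on V [x] A *)
Definition bact (V : repCat K G) (g : G) : Mor (V \bx alg A) (V \bx alg A) :=
  boxm (ract V g) (pi g).

Definition Phi_ob (V : repCat K G) : C := the_fixed (bact V).

Lemma Phi_mor_subproof (V W : repCat K G) (f : Mor V W) :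
  equivariant (bact V) (bact W) (boxm (vsval f) (idm (alg A))).
Proof.
move=> g; rewrite -!boxm_comp comp1m compm1.
by rewrite (rhom_intertwines f).
Qed.

Definition Phi_mor (V W : repCat K G) (f : Mor V W) : Mor (Phi_ob V) (Phi_ob W) :=
  fixedm (Phi_mor_subproof f).

Lemma Phi_lin (V W : repCat K G) : linear (@Phi_mor V W).
Proof.
move=> a x y; apply: fixed_ext; rewrite compDr compZr !fixedmE /=.
by rewrite boxm_linl compDl compZl.
Qed.

Lemma Phi_id (V : repCat K G) : Phi_mor (idm V) = idm (Phi_ob V).
Proof. by apply: fixed_ext; rewrite fixedmE /= boxm_id comp1m compm1. Qed.

Lemma Phi_comp (V W X : repCat K G) (g : Mor W X) (f : Mor V W) :
  Phi_mor (g \oc f) = Phi_mor g \oc Phi_mor f.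
Proof.
apply: fixed_ext; rewrite compA !fixedmE /= -compA fixedmE compA -boxm_comp.
by rewrite comp1m.
Qed.

Definition Phi : functor (repCat K G) C := Functor Phi_lin Phi_id Phi_comp.

(* the diagonal action on (V (x) W) [x] (A (x) A) *)
Definition bact2 (V W : repCat K G) (g : G) :
    Mor (vtens V W \bx (alg A \ox alg A)) (vtens V W \bx (alg A \ox alg A)) :=
  boxm (ract (V \ox W) g) (pi g \om pi g).

Lemma J1_subproof (V W : repCat K G) :
  equivariant (fun g => bact V g \om bact W g) (bact2 V W)
    (box_tens V W (alg A) (alg A)).
Proof. by move=> g; rewrite box_tens_nat. Qed.

Lemma J2_subproof (V W : repCat K G) :
  equivariant (bact2 V W) (bact (V \ox W)) (boxm \1%VF (mul A)).
Proof.
by move=> g; rewrite -!boxm_comp comp_lfun1l comp_lfun1r aact_mul.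
Qed.

(* (V [x] A)^G (x) (W [x] A)^G -> ((V [x] A) (x) (W [x] A))^G
     = ((V (x) W) [x] (A (x) A))^G -> ((V (x) W) [x] A)^G *)
Definition PhiJ (V W : repCat K G) : Mor (Phi V \ox Phi W) (Phi (V \ox W)) :=
  fixedm (@J2_subproof V W) \oc fixedm (@J1_subproof V W)
    \oc fixed_tens (bact V) (bact W).

End Phi.
Arguments bact {K C G A} pi V g.
Arguments Phi {K C G A} pi.
Arguments PhiJ {K C G A} pi V W.

(* Main.v *)
Require Import Defs.
From mathcomp Require Import all_boot all_order all_algebra.
From mathcomp Require Import boolp classical_sets reals topology normedtype.
From mathcomp Require Import complex.
Import Defs.
Set Implicit Arguments.
Unset Strict Implicit.
Unset Printing Implicit Defensive.
Import Order.TTheory GRing.Theory Num.Theory.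
Import numFieldNormedType.Exports.
Local Open Scope ring_scope.

(** Write eps for the retraction of the unit of A and sum x_i (x) y_i for a vector of
   A (x) A, as if objects had elements.

   Since A is rigid, eps mul is a nondegenerate invariant form, and the mate D of
   the multiplication under it is a map of A-bimodules from A to A (x) A.  As A is
   commutative with trivial twist, mul D is the scalar dim A, which is not zero;
   so A is separable (rigid_separable), and after rescaling D(1) = sum x_i (x) y_i is
   a separability idempotent.  Dedekind's theorem on the independence of
   characters follows: for automorphisms f and g of A the sum of the
   f(x_i) g(y_i) is 1 if f = g and 0 otherwise (pi_orth).  Hence the elements of G
   are linearly independent in End(A), and G is finite (group_finite).  Because
   A^G = 1, the sum over G is a trace A -> 1, and the orthogonality relations say
   that A is a Galois extension of 1 with group G.  What remains is Galois descent
   along this extension, together with the representation theory of G.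

   A morphism Y -> Phi(V) is a G-equivariant linear family of morphisms Y -> A
   indexed by the dual of V.  In these coordinates the structure map J of Phi is
   given by mul, and averaging the two legs of D over G gives an inverse of J up
   to the factor |G| (PhiJ_inv, inv_PhiJ).  A morphism Phi(V) -> Phi(W) extends to
   an A-linear map V (x) A -> W (x) A, whose entries are scalars because
   Hom(1, A) is a line (linear_full); so Phi is a fully faithful tensor functor.
   Its image is symmetric since J is built from a commutative multiplication.

   By Maschke's theorem all morphisms of Rep G are von Neumann regular and its
   idempotents split; these equations pass through Phi, so the essential image of
   Phi is closed under kernels and cokernels and is the category generated by the
   M_lambda (Phi_generated, generated_Phi).  Full faithfulness makes the M_lambda
   simple and pairwise non-isomorphic.  For the decomposition of A, the evaluation
   maps V_lambda (x) M_lambda -> A have orthogonal retractions by Schur's lemma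
   (isotypic_proj_incl, isotypic_proj_incl_distinct), and finitely many of them
   are jointly epimorphic, as one sees by decomposing the representation of G on
   End(A) (equivariant_span). *)

(** * Isomorphisms and linear categories *)

Section Iso.
Variables (K : fieldType) (C : linCat K).
Implicit Types X Y Z W : C.

(** Composites are kept nested to the left, so that consecutive inner factors do
   not form a subterm; the next three lemmas rewrite such factors. *)
Lemma comp_eql X Y Z W (g : Mor Y Z) (f : Mor X Y) (h : Mor X Z) (x : Mor Z W) :
  g \oc f = h -> x \oc g \oc f = x \oc h.
Proof. by move=> <-; rewrite compA. Qed.

Lemma comp_eq2 X Y Y' Z W (g : Mor Y Z) (f : Mor X Y) (g' : Mor Y' Z)
    (f' : Mor X Y') (x : Mor Z W) :
  g \oc f = g' \oc f' -> x \oc g \oc f = x \oc g' \oc f'.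
Proof. by move=> E; rewrite -!compA E. Qed.

Lemma comp_eq3 X Y Y' U Z W (h : Mor U Z) (g : Mor Y U) (f : Mor X Y)
    (g' : Mor Y' Z) (f' : Mor X Y') (x : Mor Z W) :
  h \oc g \oc f = g' \oc f' -> x \oc h \oc g \oc f = x \oc g' \oc f'.
Proof. by move=> E; rewrite -[RHS]compA -E !compA. Qed.

Lemma iso_epi X Y Z (f : Mor X Y) (u v : Mor Y Z) :
  is_iso f -> u \oc f = v \oc f -> u = v.
Proof.
move=> [g [gf fg]] /(congr1 (fun x => x \oc g)).
by rewrite -!compA fg !compm1.
Qed.

Lemma iso_mono X Y Z (f : Mor Y Z) (u v : Mor X Y) :
  is_iso f -> f \oc u = f \oc v -> u = v.
Proof.
by move=> [g [gf fg]] /(congr1 (ccomp g)); rewrite !compA gf !comp1m.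
Qed.

Lemma inv_iso X Y (f : Mor X Y) g : is_inv f g -> is_iso f.
Proof. by exists g. Qed.

Lemma inv_isoV X Y (f : Mor X Y) g : is_inv f g -> is_iso g.
Proof. by case=> gf fg; exists f. Qed.

Lemma iso_id X : is_iso (idm X).
Proof. by exists (idm X); split; rewrite comp1m. Qed.

Lemma iso_comp X Y Z (g : Mor Y Z) (f : Mor X Y) :
  is_iso g -> is_iso f -> is_iso (g \oc f).
Proof.
move=> [g' [g'g gg']] [f' [f'f ff']]; exists (f' \oc g'); split.
  by rewrite compA (comp_eql _ g'g) compm1.
by rewrite compA (comp_eql _ ff') compm1.
Qed.

Lemma isomorphic_sym X Y : isomorphic X Y -> isomorphic Y X.
Proof. by move=> [f [g fg]]; exists g; exact: inv_isoV fg. Qed.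

Lemma isomorphic_trans X Y Z : isomorphic X Y -> isomorphic Y Z -> isomorphic X Z.
Proof. by move=> [f ff] [g gg]; exists (g \oc f); exact: iso_comp. Qed.

Lemma compNl X Y Z (g : Mor Y Z) (f : Mor X Y) : (- g) \oc f = - (g \oc f).
Proof. by rewrite -scaleN1r compZl scaleN1r. Qed.

Lemma compNr X Y Z (g : Mor Y Z) (f : Mor X Y) : g \oc (- f) = - (g \oc f).
Proof. by rewrite -scaleN1r compZr scaleN1r. Qed.

Lemma compBl X Y Z (g g' : Mor Y Z) (f : Mor X Y) :
  (g - g') \oc f = g \oc f - g' \oc f.
Proof. by rewrite compDl compNl. Qed.

Lemma compBr X Y Z (g : Mor Y Z) (f f' : Mor X Y) :
  g \oc (f - f') = g \oc f - g \oc f'.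
Proof. by rewrite compDr compNr. Qed.

Lemma zero_id X : idm X = 0 -> is_zero X.
Proof.
by move=> X0 Y; split=> f; [rewrite -(comp1m f)|rewrite -(compm1 f)];
  rewrite X0 ?comp0m ?compm0.
Qed.

Lemma id_zero X : is_zero X -> idm X = 0.
Proof. by move=> X0; apply: (X0 X).1. Qed.

End Iso.

(** * Unit constraints of a monoidal category *)

Section Coherence.
Variables (K : fieldType) (C : monCat K).
Implicit Types X Y Z W : C.

Lemma assocK X Y Z : associ X Y Z \oc assoc X Y Z = idm _.
Proof. exact: (assocP X Y Z).1. Qed.
Lemma associK X Y Z : assoc X Y Z \oc associ X Y Z = idm _.
Proof. exact: (assocP X Y Z).2. Qed.
Lemma lunitiK X : lunit X \oc luniti X = idm _.
Proof. exact: (lunitP X).2. Qed.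
Lemma runitiK X : runit X \oc runiti X = idm _.
Proof. exact: (runitP X).2. Qed.

Lemma assoc_iso X Y Z : is_iso (assoc X Y Z).
Proof. exact: inv_iso (assocP X Y Z). Qed.
Lemma associ_iso X Y Z : is_iso (associ X Y Z).
Proof. exact: inv_isoV (assocP X Y Z). Qed.
Lemma lunit_iso X : is_iso (lunit X).
Proof. exact: inv_iso (lunitP X). Qed.
Lemma runit_iso X : is_iso (runit X).
Proof. exact: inv_iso (runitP X). Qed.

Lemma tens_iso X X' Y Y' (f : Mor X X') (g : Mor Y Y') :
  is_iso f -> is_iso g -> is_iso (f \om g).
Proof.
move=> [f' [ff1 ff2]] [g' [gg1 gg2]]; exists (f' \om g').
by split; rewrite -tensm_comp ?ff1 ?gg1 ?ff2 ?gg2 tensm_id.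
Qed.

Lemma tens_comp1 X Y Y' Y'' (g' : Mor Y' Y'') (g : Mor Y Y') :
  idm X \om (g' \oc g) = (idm X \om g') \oc (idm X \om g).
Proof. by rewrite -tensm_comp comp1m. Qed.

Lemma tens_1comp X X' X'' Y (f' : Mor X' X'') (f : Mor X X') :
  (f' \oc f) \om idm Y = (f' \om idm Y) \oc (f \om idm Y).
Proof. by rewrite -tensm_comp comp1m. Qed.

Lemma tens_lr X X' Y Y' (f : Mor X X') (g : Mor Y Y') :
  (f \om idm Y') \oc (idm X \om g) = f \om g.
Proof. by rewrite -tensm_comp compm1 comp1m. Qed.

Lemma tens_rl X X' Y Y' (f : Mor X X') (g : Mor Y Y') :
  (idm X' \om g) \oc (f \om idm Y) = f \om g.
Proof. by rewrite -tensm_comp compm1 comp1m. Qed.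

Lemma associ_nat X X' Y Y' Z Z' (f : Mor X X') (g : Mor Y Y') (h : Mor Z Z') :
  associ X' Y' Z' \oc (f \om (g \om h)) = ((f \om g) \om h) \oc associ X Y Z.
Proof.
apply: (iso_mono (assoc_iso X' Y' Z')); rewrite !compA associK comp1m assoc_nat.
by rewrite -compA associK compm1.
Qed.

Lemma luniti_nat X X' (f : Mor X X') :
  luniti X' \oc f = (idm tone \om f) \oc luniti X.
Proof.
apply: (iso_mono (lunit_iso X')); rewrite !compA lunitiK comp1m lunit_nat.
by rewrite -compA lunitiK compm1.
Qed.

Lemma runiti_nat X X' (f : Mor X X') :
  runiti X' \oc f = (f \om idm tone) \oc runiti X.
Proof.
apply: (iso_mono (runit_iso X')); rewrite !compA runitiK comp1m runit_nat.
by rewrite -compA runitiK compm1.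
Qed.

Lemma tens1_inj X Y (f g : Mor X Y) :
  idm tone \om f = idm tone \om g :> Mor (tone \ox X) (tone \ox Y) -> f = g.
Proof.
move=> fg; apply: (iso_epi (lunit_iso X)).
by rewrite -!lunit_nat fg.
Qed.

Lemma tensr1_inj X Y (f g : Mor X Y) :
  f \om idm tone = g \om idm tone :> Mor (X \ox tone) (Y \ox tone) -> f = g.
Proof.
move=> fg; apply: (iso_epi (runit_iso X)).
by rewrite -!runit_nat fg.
Qed.

(** Tensoring with the unit object is faithful, and after tensoring with it the
   claim is one face of a pentagon whose other faces are triangles and naturality
   squares. *)
Lemma lunit_tens X Y : lunit (X \ox Y) \oc assoc tone X Y = lunit X \om idm Y.
Proof.
apply: tens1_inj; rewrite tens_comp1.
apply: (iso_epi (assoc_iso tone (tone \ox X) Y)).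
apply: (iso_epi (tens_iso (assoc_iso tone tone X) (iso_id Y))).
rewrite -(assoc_nat (idm tone) (lunit X) (idm Y)).
rewrite (comp_eql (h := (runit tone \om idm X) \om idm Y)); last first.
  by rewrite -tens_1comp triangle.
rewrite assoc_nat tensm_id -(triangle tone (X \ox Y)) -!compA; congr (_ \oc _).
by rewrite compA pentagon.
Qed.

Lemma lunit_tone : lunit tone = runit (tone : C).
Proof.
apply: tensr1_inj; rewrite -triangle -lunit_tens; congr (_ \oc _).
apply: (iso_mono (lunit_iso tone)).
by rewrite lunit_nat.
Qed.

Lemma lunit_tens_inv X Y : (lunit X \om idm Y) \oc associ tone X Y = lunit (X \ox Y).
Proof. by rewrite -lunit_tens -compA associK compm1. Qed.

Lemma luniti_tens X Y : assoc tone X Y \oc (luniti X \om idm Y) = luniti (X \ox Y).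
Proof.
apply: (iso_mono (lunit_iso (X \ox Y))); rewrite compA lunit_tens lunitiK.
by rewrite -tens_1comp lunitiK tensm_id.
Qed.

Lemma triangle_runiti X Y :
  assoc X tone Y \oc (runiti X \om idm Y) = idm X \om luniti Y.
Proof.
apply: (iso_mono (tens_iso (iso_id X) (lunit_iso Y))).
by rewrite compA triangle -tens_1comp -tens_comp1 runitiK lunitiK !tensm_id.
Qed.

End Coherence.

Section BraidUnit.
Variables (K : fieldType) (C : ribbonCat K).

(** Once the isomorphism lunit o braid is cancelled, the hexagon for X, 1, 1 becomes
   the claim tensored with the unit object. *)
Lemma lunit_braid (X : C) : lunit X \oc braid X tone = runit X.
Proof.
apply: tensr1_inj.
apply: (iso_mono (iso_comp (lunit_iso X) (braid_iso X tone))).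
have := congr1 (ccomp (idm tone \om lunit X)) (hexagon1 X tone tone).
rewrite !compA triangle -lunit_tone -braid_nat.
rewrite -[_ \oc assoc X tone tone]compA lunit_tone -lunit_tone triangle.
rewrite -tens_comp1 => /(congr1 (ccomp (lunit X))).
rewrite !compA lunit_nat (comp_eql _ (lunit_tens _ _)) => ->.
by rewrite tens_1comp compA.
Qed.

End BraidUnit.

(** * Frobenius structure from a nondegenerate invariant form *)

Section Pentagon.
Variables (K : fieldType) (C : monCat K).
Implicit Types X Y Z W : C.

Lemma pentagon_inv X Y Z W :
  associ (X \ox Y) Z W \oc associ X Y (Z \ox W)
  = (associ X Y Z \om idm W) \oc associ X (Y \ox Z) W \oc (idm X \om associ Y Z W).
Proof.
have K1 : (assoc X Y Z \om idm W) \oc (associ X Y Z \om idm W) = idm _.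
  by rewrite -tens_1comp associK tensm_id.
apply: (iso_mono (iso_comp (assoc_iso X Y (Z \ox W)) (assoc_iso (X \ox Y) Z W))).
rewrite compA (comp_eql _ (associK _ _ _)) compm1 associK -pentagon !compA.
rewrite (comp_eql _ K1) compm1 (comp_eql _ (associK _ _ _)) compm1.
by rewrite -tens_comp1 associK tensm_id.
Qed.

Lemma pentagon_associ_assoc X Y Z W :
  associ X Y (Z \ox W) \oc (idm X \om assoc Y Z W)
  = assoc (X \ox Y) Z W \oc (associ X Y Z \om idm W) \oc associ X (Y \ox Z) W.
Proof.
apply: (iso_mono (associ_iso (X \ox Y) Z W)).
rewrite !compA pentagon_inv assocK comp1m -compA -tens_comp1 assocK tensm_id.
by rewrite compm1.
Qed.

Lemma pentagon_assoc_associ X Y Z W :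
  (idm X \om associ Y Z W) \oc assoc X Y (Z \ox W)
  = assoc X (Y \ox Z) W \oc (assoc X Y Z \om idm W) \oc associ (X \ox Y) Z W.
Proof.
apply: (iso_mono (tens_iso (iso_id X) (assoc_iso Y Z W))).
rewrite !compA pentagon -tens_comp1 associK tensm_id comp1m -compA associK.
by rewrite compm1.
Qed.

End Pentagon.

(** A morphism from one tensor power of A to another induces a natural
   family between iterates of the functor Z |-> A (x) Z.  In terms of such
   families no associator is left: m, k and e below stand for a multiplication,
   an invariant form and its copairing. *)
Section ActionCalculus.
Variables (K : fieldType) (C : monCat K) (A : C).
Variables (m : forall Z, Mor (A \ox (A \ox Z)) (A \ox Z))
  (k : forall Z, Mor (A \ox (A \ox Z)) Z) (e : forall Z, Mor Z (A \ox (A \ox Z))).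
Hypothesis m_nat : forall Z Z' (f : Mor Z Z'),
  m Z' \oc (idm A \om (idm A \om f)) = (idm A \om f) \oc m Z.
Hypothesis k_nat : forall Z Z' (f : Mor Z Z'),
  k Z' \oc (idm A \om (idm A \om f)) = f \oc k Z.
Hypothesis e_nat : forall Z Z' (f : Mor Z Z'),
  e Z' \oc f = (idm A \om (idm A \om f)) \oc e Z.
Hypothesis mA : forall Z, m Z \oc (idm A \om m Z) = m Z \oc m (A \ox Z).
Hypothesis kA : forall Z, k Z \oc (idm A \om m Z) = k Z \oc m (A \ox Z).
Hypothesis zig1 : forall Z, (idm A \om k Z) \oc e (A \ox Z) = idm (A \ox Z).
Hypothesis zig2 : forall Z, k (A \ox Z) \oc (idm A \om e Z) = idm (A \ox Z).

(** The mate of the multiplication under the self-duality of A may be formed on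
   either side; invariance of the form makes the two agree. *)
Lemma mate_eq Z :
  m (A \ox Z) \oc (idm A \om e Z) = (idm A \om m Z) \oc e (A \ox Z).
Proof.
have inj W (u v : Mor W (A \ox (A \ox Z))) :
    k (A \ox Z) \oc (idm A \om u) = k (A \ox Z) \oc (idm A \om v) -> u = v.
  move=> uv; rewrite -(comp1m u) -(comp1m v) -zig1 -!compA !e_nat !compA.
  by rewrite -!tens_comp1 uv.
apply: inj; rewrite !tens_comp1 !compA kA (comp_eql _ (m_nat _)) compA zig2 comp1m.
by rewrite k_nat -compA zig2 compm1.
Qed.

Lemma mate_left Z :
  m (A \ox Z) \oc (idm A \om e Z) \oc m Z
  = m (A \ox Z) \oc (idm A \om (m (A \ox Z) \oc (idm A \om e Z))).
Proof.
by rewrite -compA -m_nat compA -mA tens_comp1 compA.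
Qed.

Lemma mate_right Z :
  m (A \ox Z) \oc (idm A \om e Z) \oc m Z
  = (idm A \om m Z) \oc (m (A \ox (A \ox Z)) \oc (idm A \om e (A \ox Z))).
Proof.
rewrite mate_eq mate_eq -compA e_nat !compA -!tens_comp1.
by rewrite mA.
Qed.

End ActionCalculus.

Section Frobenius.
Variables (K : fieldType) (C : monCat K) (A : C).
Variables (m : Mor (A \ox A) A) (k : Mor (A \ox A) tone) (e : Mor tone (A \ox A)).
Hypothesis mA : m \oc (m \om idm A) = m \oc (idm A \om m) \oc assoc A A A.
Hypothesis kA : k \oc (m \om idm A) = k \oc (idm A \om m) \oc assoc A A A.
Hypothesis ke : is_dual k e.
Implicit Types Z W : C.

(** The natural families attached to m, k and e satisfy the axioms of the calculus:
   here naturality, for m and k at once, then associativity and the zigzags. *)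
Lemma assoc_ext_nat B (h : Mor (A \ox A) B) Z Z' (f : Mor Z Z') :
  (h \om idm Z') \oc associ A A Z' \oc (idm A \om (idm A \om f))
  = (idm B \om f) \oc ((h \om idm Z) \oc associ A A Z).
Proof. by rewrite -compA associ_nat tensm_id compA tens_lr compA tens_rl. Qed.

Lemma assoc_ext_mul B (h : Mor (A \ox A) B) Z :
  h \oc (m \om idm A) = h \oc (idm A \om m) \oc assoc A A A ->
  (h \om idm Z) \oc associ A A Z \oc (idm A \om ((m \om idm Z) \oc associ A A Z))
  = (h \om idm Z) \oc associ A A Z
      \oc ((m \om idm (A \ox Z)) \oc associ A A (A \ox Z)).
Proof.
move=> hA; rewrite tens_comp1 !compA.
rewrite (comp_eql _ (associ_nat _ _ _)) compA -tens_1comp.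
rewrite -[in RHS]tensm_id (comp_eql _ (associ_nat _ _ _)) compA -tens_1comp hA.
rewrite (comp_eql _ (pentagon_inv _ _ _ _)) !compA -tens_1comp.
by rewrite (comp_eql _ (associK _ _ _)) compm1.
Qed.

Lemma zigzag1 Z :
  (idm A \om (lunit Z \oc ((k \om idm Z) \oc associ A A Z)))
    \oc (assoc A A (A \ox Z) \oc (e \om idm (A \ox Z)) \oc luniti (A \ox Z))
  = idm (A \ox Z).
Proof.
have E : (k \om idm Z) \oc associ A A Z \oc assoc A A Z = k \om idm Z.
  by rewrite -compA assocK compm1.
have := congr1 (fun f => f \om idm Z) ke.1; rewrite tensm_id; apply: etrans.
rewrite !tens_1comp -triangle.
rewrite [in RHS](comp_eq2 _ (assoc_nat _ _ _)) -[in RHS]E !tens_comp1 !compA.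
rewrite [in RHS](comp_eq3 _ (pentagon _ _ _ _)).
rewrite [in RHS](comp_eq2 _ (assoc_nat _ _ _)) tensm_id.
by rewrite [in RHS](comp_eql _ (luniti_tens _ _)).
Qed.

Lemma zigzag2 Z :
  lunit (A \ox Z) \oc ((k \om idm (A \ox Z)) \oc associ A A (A \ox Z))
    \oc (idm A \om (assoc A A Z \oc (e \om idm Z) \oc luniti Z))
  = idm (A \ox Z).
Proof.
have E : associ A tone Z \oc assoc A tone Z = idm _ by exact: assocK.
have := congr1 (fun f => f \om idm Z) ke.2; rewrite tensm_id; apply: etrans.
rewrite !tens_1comp !tens_comp1 !compA.
rewrite -lunit_tens_inv -triangle_runiti !compA.
rewrite [RHS](_ : _ = (lunit A \om idm Z) \oc ((k \om idm A) \om idm Z)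
  \oc (associ A A A \om idm Z) \oc associ A (A \ox A) Z
  \oc (idm A \om (e \om idm Z)) \oc assoc A tone Z \oc (runiti A \om idm Z)); last first.
  by rewrite (comp_eq2 _ (associ_nat _ _ _)) (comp_eql _ E) compm1.
have aK : (idm A \om associ A A Z) \oc (idm A \om assoc A A Z) = idm _.
  by rewrite -tens_comp1 assocK tensm_id.
rewrite -[idm (A \ox Z)]tensm_id (comp_eq2 _ (associ_nat _ _ _)).
by rewrite (comp_eql _ (pentagon_inv _ _ _ _)) !compA (comp_eql _ aK) compm1.
Qed.

(** With e written as sum x_i (x) y_i, this is x |-> sum (x x_i) (x) y_i. *)
Definition comul : Mor A (A \ox A) :=
  (m \om idm A) \oc associ A A A \oc (idm A \om e) \oc runiti A.

Let mZ Z := (m \om idm Z) \oc associ A A Z.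
Let kZ Z := lunit Z \oc ((k \om idm Z) \oc associ A A Z).
Let eZ Z := assoc A A Z \oc (e \om idm Z) \oc luniti Z.
Let dZ Z := mZ (A \ox Z) \oc (idm A \om eZ Z).

Let kZ_nat Z Z' (f : Mor Z Z') : kZ Z' \oc (idm A \om (idm A \om f)) = f \oc kZ Z.
Proof. by rewrite -[LHS]compA assoc_ext_nat compA lunit_nat -compA. Qed.

Let kZ_mul Z : kZ Z \oc (idm A \om mZ Z) = kZ Z \oc mZ (A \ox Z).
Proof. by rewrite -[LHS]compA (assoc_ext_mul _ kA) compA. Qed.

Let eZ_nat Z Z' (f : Mor Z Z') : eZ Z' \oc f = (idm A \om (idm A \om f)) \oc eZ Z.
Proof.
rewrite -[LHS]compA luniti_nat /eZ !compA -assoc_nat tensm_id.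
by rewrite (comp_eql _ (tens_lr _ _)) (comp_eql _ (tens_rl _ _)).
Qed.

(* so identities of the calculus at the unit object are identities for comul *)
Let dZE Z : dZ Z = assoc A A Z \oc (comul \om idm Z).
Proof.
rewrite /dZ /mZ /eZ /comul !tens_1comp !tens_comp1 !compA.
rewrite (comp_eql _ (pentagon_associ_assoc _ _ _ _)) !compA.
rewrite -[idm (A \ox Z)]tensm_id -assoc_nat (comp_eq2 _ (associ_nat _ _ _)).
rewrite -triangle_runiti !compA.
by rewrite (comp_eql _ (assocK _ _ _)) compm1.
Qed.

Lemma comul_mul_left :
  comul \oc m = (m \om idm A) \oc associ A A A \oc (idm A \om comul).
Proof.
have : dZ tone \oc mZ tone = mZ (A \ox tone) \oc (idm A \om dZ tone).
  by apply: mate_left => Z *; [exact: assoc_ext_nat|exact: (assoc_ext_mul _ mA)].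
rewrite dZE /mZ; move: comul => D E; apply: tensr1_inj.
apply: (iso_mono (assoc_iso A A tone)); apply: (iso_epi (associ_iso A A tone)).
move: E; rewrite !tens_1comp !tens_comp1 !compA => ->.
rewrite (comp_eql _ (pentagon_associ_assoc _ _ _ _)) !compA.
rewrite -[idm (A \ox tone)]tensm_id -assoc_nat.
by rewrite (comp_eq2 _ (associ_nat _ _ _)).
Qed.

Lemma comul_mul_right :
  comul \oc m = (idm A \om m) \oc assoc A A A \oc (comul \om idm A).
Proof.
have : dZ tone \oc mZ tone = (idm A \om mZ tone) \oc dZ (A \ox tone).
  apply: (mate_right (k := kZ)) => // Z.
  - exact: assoc_ext_nat.
  - exact: (assoc_ext_mul _ mA).
  - exact: zigzag1.
  - exact: zigzag2.
rewrite !dZE /mZ; move: comul => D E; apply: tensr1_inj.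
apply: (iso_mono (assoc_iso A A tone)); apply: (iso_epi (associ_iso A A tone)).
move: E; rewrite !tens_1comp !tens_comp1 !compA => ->.
rewrite (comp_eql _ (pentagon_assoc_associ _ _ _ _)) !compA.
rewrite -assoc_nat -[idm (A \ox tone)]tensm_id.
by rewrite (comp_eq2 _ (associ_nat _ _ _)).
Qed.

End Frobenius.

(** * Separability of a rigid algebra *)

Section Duals.
Variables (K : fieldType) (C : monCat K).

(** Used to turn the duality between A and its dual into a duality of A with
   itself, along the isomorphism defined by a nondegenerate form. *)
Lemma is_dual_transport (X D D' : C) (v : Mor (D \ox X) tone) (c : Mor tone (X \ox D))
    (f : Mor D' D) (f' : Mor D D') :
  is_dual v c -> is_inv f f' -> is_dual (v \oc (f \om idm X)) ((idm X \om f') \oc c).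
Proof.
move=> [z1 z2] [f'f ff']; split.
  rewrite -[RHS]z1 tens_comp1 tens_1comp !compA -[in LHS](comp_eq2 _ (assoc_nat _ _ _)).
  rewrite [in LHS](comp_eql (h := idm _) _ (g := _ \om f \om _)) ?compm1 //.
  by rewrite -tens_1comp -tens_comp1 ff' !tensm_id.
transitivity (f' \oc (lunit D \oc (v \om idm D) \oc associ D X D \oc (idm D \om c)
    \oc runiti D) \oc f); last by rewrite z2 compm1.
rewrite !compA -lunit_nat (comp_eql _ (tens_rl _ _)) -[in RHS](comp_eql _ (tens_lr v f')).
rewrite [in RHS](comp_eql _ (runiti_nat f)) !compA -[idm (D \ox X)]tensm_id.
rewrite -[in RHS](comp_eq2 _ (associ_nat _ _ _)) tens_1comp !compA.
rewrite -[in LHS](comp_eq2 _ (associ_nat _ _ _)) tensm_id.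
congr (_ \oc _); rewrite -!compA; do 3!congr (_ \oc _).
by rewrite -!tensm_comp !compm1 !comp1m.
Qed.

End Duals.

Section Separability.
Variables (K : fieldType) (C : ribbonCat K) (A : calgebra C).
Local Notation a := (alg A).

Lemma mul_aone : mul A \oc (idm a \om aone A) = runit a.
Proof. by rewrite -lunit_braid -mul1 -compA -braid_nat compA mulC. Qed.

Lemma aone_neq0 : aone A <> 0.
Proof.
move=> A0; apply: (rc_simple1 C).1; apply: zero_id; apply: (@aone_monic _ _ A).
by rewrite A0 !comp0m.
Qed.

Lemma hom1_scalar (x : Mor (tone : C) a) : exists s : K, x = s *: aone A.
Proof.
have : <[aone A]>%VS = fullv.
  apply/eqP; rewrite eqEdim subvf aone_dim dim_vline.
  by have /eqP -> := aone_neq0.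
by move=> E; apply/vlineP; rewrite E memvf.
Qed.

(** Separability is carried by the bimodule section sep of the multiplication
   rather than by the idempotent sep(1) = sum x_i (x) y_i, because the bimodule
   equations are what every later computation rewrites with. *)
Record separable_alg := SeparableAlg {
  sep : Mor a (a \ox a);
  sep_left : sep \oc mul A = (mul A \om idm a) \oc associ a a a \oc (idm a \om sep);
  sep_right : sep \oc mul A = (idm a \om mul A) \oc assoc a a a \oc (sep \om idm a);
  sepK : mul A \oc sep = idm a
}.

(** Endomorphisms of A as a left module over itself are scalars: they are
   determined by their value in Hom(1, A). *)
Lemma left_linear_scalar (w : Mor a a) : w \oc mul A = mul A \oc (idm a \om w) ->
  exists s : K, w = s *: idm a.
Proof.
move=> wM; have [s E] := hom1_scalar (w \oc aone A); exists s.
apply: (iso_epi (runit_iso a)); rewrite -!mul_aone !compA wM.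
rewrite (comp_eql _ (esym (tens_comp1 _ _ _))) E.
by rewrite tensmZr compZr !compZl comp1m.
Qed.

(** With D(1) = sum x_i (x) y_i, the map x |-> sum (x x_i) u(y_i) is left
   linear.  For u = id this gives the dimension; for general u it extracts
   a number from u. *)
Lemma average_left_linear D (u : Mor a a) :
    D \oc mul A = (mul A \om idm a) \oc associ a a a \oc (idm a \om D) ->
  exists s : K, mul A \oc (idm a \om u) \oc D = s *: idm a.
Proof.
move=> DM; apply: left_linear_scalar.
rewrite -[LHS]compA DM !compA (comp_eql _ (tens_rl _ _)) -(tens_lr (mul A) u) compA mulA.
rewrite -[idm (a \ox a)]tensm_id -(comp_eq2 _ (associ_nat _ _ _)).
rewrite (comp_eql _ (associK _ _ _)) compm1.
by rewrite !(comp_eql _ (esym (tens_comp1 _ _ _))) compA.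
Qed.

(** The mate D of the multiplication is a bimodule map, so mul D is a scalar; since
   A is commutative and its twist is trivial, that scalar is the dimension of A,
   and D may be divided by it. *)
Lemma rigid_separable : rigid_alg A -> twist a = idm a -> inhabited separable_alg.
Proof.
move=> [[eps eps1 [phi phi_iso evphi]] dim0] tw.
have [phi' phiK] := phi_iso.
pose k := eps \oc mul A; pose e := (idm a \om phi') \oc coev a.
have ke : is_dual k e.
  by rewrite /k -evphi; apply: is_dual_transport phiK; exact: dualP.
have kA : k \oc (mul A \om idm a) = k \oc (idm a \om mul A) \oc assoc a a a.
  by rewrite /k -!compA mulA !compA.
have DL := comul_mul_left e (mulA A); have DR := comul_mul_right (mulA A) kA ke.
have [s s2] := average_left_linear (idm a) DL.
rewrite tensm_id compm1 in s2.
have De : comul (mul A) e \oc aone A = e.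
  rewrite /comul -[_ \oc aone A]compA runiti_nat compA (comp_eql _ (tens_rl _ _)).
  rewrite -(tens_lr (aone A) e) -[idm (a \ox a)]tensm_id compA (comp_eq2 _ (associ_nat _ _ _)).
  rewrite -tens_1comp mul1 lunit_tens_inv lunit_nat -compA lunit_tone runitiK.
  by rewrite compm1.
have sE : eps \oc mul A \oc e = s *: idm tone.
  by rewrite -[X in _ \oc X = _]De -compA (compA (mul A)) s2 compZl comp1m compZr eps1.
(* eps mul e is dim A: phi turns evaluation and coevaluation into eps mul and e,
   and mul absorbs the braiding *)
have s_neq0 : s != 0.
  apply/eqP => s0; apply: dim0; rewrite -[RHS](scale0r (idm tone)) -s0 -sE.
  rewrite /qdim tw tensm_id compm1 /e -(mulC A) !compA (comp_eq2 _ (braid_nat _ _)).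
  by rewrite -evphi (comp_eql _ (esym (tens_1comp _ _ _))) phiK.2 tensm_id compm1.
constructor; exists (s^-1 *: comul (mul A) e).
- by rewrite compZl DL tensmZr compZr.
- by rewrite compZl DR tensmZl compZr.
- by rewrite compZr s2 scalerA mulVf // scale1r.
Qed.

End Separability.

(** * Automorphisms of a separable algebra *)

Section Characters.
Variables (K : fieldType) (C : ribbonCat K) (A : calgebra C) (S : separable_alg A).
Local Notation a := (alg A).

Definition alg_endo (f : Mor a a) :=
  f \oc mul A = mul A \oc (f \om f) /\ f \oc aone A = aone A.

(** Write sep(1) as sum x_i (x) y_i.  The element c = sum f(x_i) g(y_i) is a scalar
   with f(x) c = c g(x) for all x, hence vanishes unless f = g. *)
Lemma sep_orth f g : alg_endo f -> alg_endo g -> f <> g ->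
  mul A \oc (f \om g) \oc sep S = 0.
Proof.
move=> [fM f1] [gM g1] fg; set w := (X in X = 0).
have wL : w \oc mul A = mul A \oc (f \om w).
  have E : (mul A \oc (f \om f)) \om g = (mul A \om idm a) \oc ((f \om f) \om g).
    by rewrite -tensm_comp comp1m.
  rewrite -[LHS]compA sep_left !compA (comp_eql _ (esym (tensm_comp _ _ _ _))).
  rewrite fM compm1 E compA mulA -(comp_eq2 _ (associ_nat _ _ _)).
  rewrite (comp_eql _ (associK _ _ _)) compm1 -2!compA -!tensm_comp.
  by rewrite compm1 comp1m compA.
have wR : w \oc mul A = mul A \oc (w \om g).
  have E : f \om (mul A \oc (g \om g)) = (idm a \om mul A) \oc (f \om (g \om g)).
    by rewrite -tensm_comp comp1m.
  rewrite -[LHS]compA sep_right !compA (comp_eql _ (esym (tensm_comp _ _ _ _))).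
  rewrite gM compm1 E compA -[in LHS](comp_eq2 _ (assoc_nat _ _ _)) -mulA.
  rewrite -2!compA -!tensm_comp.
  by rewrite compm1 comp1m compA.
have [s ws] := hom1_scalar (w \oc aone A).
have wf : w = s *: f.
  apply: (iso_epi (runit_iso a)); rewrite -{1}(mul_aone A) compA wL -compA -tensm_comp ws.
  by rewrite compm1 tensmZr compZr compZl -runit_nat -(mul_aone A) -compA tens_rl.
have wg : w = s *: g.
  apply: (iso_epi (lunit_iso a)); rewrite -{1}(mul1 A) compA wR -compA -tensm_comp ws.
  by rewrite compm1 tensmZl compZr compZl -lunit_nat -(mul1 A) -compA tens_lr.
have [s0|s_neq0] := eqVneq s 0; first by rewrite wf s0 scale0r.
by case: fg; apply: (scalerI s_neq0); rewrite -wf -wg.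
Qed.

Lemma sep_diag f : alg_endo f -> mul A \oc (f \om f) \oc sep S = f.
Proof. by move=> [fM _]; rewrite -fM -compA sepK compm1. Qed.

End Characters.

Section GaloisGroup.
Variables (K : numFieldType) (C : ribbonCat K) (G : topGroupType) (A : calgebra C).
Variables (S : separable_alg A) (pi : alg_action G A).
Hypothesis pi_faithful : faithful pi.
Hypothesis A_fixed : isomorphic (the_fixed pi : C) tone.
Local Notation a := (alg A).

Lemma pi_endo g : alg_endo (pi g).
Proof. by split; [exact: aact_mul|exact: aact_one]. Qed.

Lemma pi_inj g h : pi g = pi h -> g = h.
Proof.
move=> gh; apply: contrapT => /= neq; apply: (pi_faithful (g := (g * h^-1)%g)).
  by move=> E; apply: neq; rewrite -[h]mul1g -E -mulgA mulVg mulg1.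
by rewrite aactM gh -aactM mulgV aact1.
Qed.

Lemma pi_orth g h : mul A \oc (pi g \om pi h) \oc sep S = (g == h)%:R *: pi g.
Proof.
case: eqVneq => [->|/eqP gh]; first by rewrite (sep_diag S (pi_endo h)) scale1r.
rewrite scale0r; apply: sep_orth; [exact: pi_endo|exact: pi_endo|].
by move/pi_inj.
Qed.

Lemma pi_neq0 g : pi g != 0.
Proof.
apply/eqP => E; apply: (@aone_neq0 _ _ A).
by rewrite -(aact_one pi g) E comp0m.
Qed.

(** Dedekind's independence of characters: pairing a linear relation with one
   automorphism through sep isolates the coefficient of that automorphism. *)
Lemma pi_free (I : eqType) (r : seq I) (x : I -> G) (c : I -> K) :
  uniq r -> injective x -> \sum_(i <- r) c i *: pi (x i) = 0 ->
  forall i, i \in r -> c i = 0.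
Proof.
move=> r_uniq x_inj E i ir.
have := congr1 (fun f => mul A \oc (pi (x i) \om f) \oc sep S) E.
rewrite tensm_sumr comp_sumr comp_suml (bigD1_seq i) //= big1 => [|j ji]; last first.
  by rewrite tensmZr compZr compZl pi_orth (inj_eq x_inj) eq_sym (negPf ji) scale0r scaler0.
rewrite addr0 tensmZr compZr compZl pi_orth eqxx scale1r.
rewrite -[0 in RHS](scale0r (0 : Mor a a)) tensmZr scale0r compm0 comp0m.
by move/eqP; rewrite scaler_eq0 (negPf (pi_neq0 _)) orbF => /eqP.
Qed.

(** The elements of G are linearly independent in End(A), which has finite
   dimension. *)
Lemma group_finite : exists s : seq G, uniq s /\ forall g, g \in s.
Proof.
pose N := \dim {: Mor a a}.
have bound (s : seq G) : uniq s -> (size s <= N)%N.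
  move=> s_uniq; rewrite -(size_map pi s).
  suff : free (map_tuple pi (in_tuple s)) by rewrite /free => /eqP <-; rewrite dimvS ?subvf.
  apply/freeP => c E i.
  apply: (@pi_free _ (index_enum _) (fun j : 'I_(size s) => nth 1%g s j) c) => //.
  - exact: index_enum_uniq.
  - by move=> j l /eqP; rewrite nth_uniq // => /eqP/val_inj.
  - by rewrite -[RHS]E; apply: eq_bigr => j _; rewrite (nth_map 1%g).
have step n : (exists s : seq G, uniq s /\ size s = n) \/
    exists s : seq G, uniq s /\ forall g, g \in s.
  elim: n => [|n [[s [us sn]]|]]; [by left; exists [::]| |by right].
  have [all|/existsNP[g gs]] := pselect (forall g, g \in s); first by right; exists s.
  by left; exists (g :: s); rewrite /= us sn andbT; split=> //; apply/negP.
have [[s [us sN]]|//] := step N.+1.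
by have := bound s us; rewrite sN ltnn.
Qed.

End GaloisGroup.

(** * The functor Phi in coordinates *)

Section GroupSums.
Variables (G : topGroupType) (s : seq G).
Hypotheses (s_uniq : uniq s) (s_full : forall g, g \in s).

Lemma sum_mulgl (V : nmodType) (F : G -> V) h :
  \sum_(g <- s) F (h * g)%g = \sum_(g <- s) F g.
Proof.
rewrite -(big_map (fun g => h * g)%g xpredT F); apply: perm_big; apply: uniq_perm => //.
  by rewrite map_inj_uniq //; exact: mulgI.
move=> g; rewrite s_full; apply/mapP; exists (h^-1 * g)%g => //.
by rewrite mulgA mulgV mul1g.
Qed.

Lemma sum_mulgr (V : nmodType) (F : G -> V) h :
  \sum_(g <- s) F (g * h)%g = \sum_(g <- s) F g.
Proof.
rewrite -(big_map (fun g => g * h)%g xpredT F); apply: perm_big; apply: uniq_perm => //.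
  by rewrite map_inj_uniq //; exact: mulIg.
move=> g; rewrite s_full; apply/mapP; exists (g * h^-1)%g => //.
by rewrite -mulgA mulVg mulg1.
Qed.

Lemma card_neq0 (K : numFieldType) : (size s)%:R != 0 :> K.
Proof. by rewrite pnatr_eq0; have := s_full 1%g; case: s. Qed.

End GroupSums.

Section Functionals.
Variables (K : fieldType) (V : vectType K).

Lemma vdual_sep (v w : V) :
  (forall phi : vdual V, phi v = phi w) -> v = w.
Proof.
move=> E; rewrite (vb_expand v) (vb_expand w).
by apply: eq_bigr => k _; rewrite E.
Qed.

Lemma vdual_normalized (v : V) : v <> 0 -> exists L : vdual V, L v = 1.
Proof.
move=> v0; have [k k0] : exists k, vbd k v != 0 :> K.
  apply: contrapT => /forallNP H; apply: v0; rewrite (vb_expand v) big1 // => k _.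
  by have /negP := H k; rewrite negbK => /eqP ->; rewrite scale0r.
exists ((vbd k v : K)^-1 *: vbd k); rewrite scale_lfunE.
exact: mulVf.
Qed.

End Functionals.

Section Coordinates.
Variables (K : numFieldType) (C : ribbonCat K) (G : topGroupType) (A : calgebra C).
Variables (S : separable_alg A) (pi : alg_action G A).
Hypothesis pi_faithful : faithful pi.
Hypothesis A_fixed : isomorphic (the_fixed pi : C) tone.
Variable s : seq G.
Hypotheses (s_uniq : uniq s) (s_full : forall g, g \in s).
Local Notation a := (alg A).

(** As A^G = 1 and Hom(1, A) is a line, the inclusion of A^G in A is a multiple of
   the unit. *)
Lemma invariant_factor (Y : C) (x : Mor Y a) : (forall g, pi g \oc x = x) ->
  exists y : Mor Y tone, aone A \oc y = x.
Proof.
have [w [w' [w'w ww']]] := A_fixed; pose i := fx_incl (the_fixed pi).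
have [c ic] := hom1_scalar (i \oc w').
have iE : i = c *: (aone A \oc w) by rewrite -compZl -ic -compA w'w compm1.
move=> xi; exists (c *: w \oc fixed_lift xi).
by rewrite -[RHS](fixed_liftE xi) -/i iE !compZl compZr compA.
Qed.

Lemma sum_pi_invariant g : pi g \oc (\sum_(h <- s) pi h) = \sum_(h <- s) pi h.
Proof.
rewrite comp_sumr -[RHS](sum_mulgl s_uniq s_full _ g).
by apply: eq_bigr => h _; rewrite aactM.
Qed.

Definition trace : Mor a tone := projT1 (cid (invariant_factor sum_pi_invariant)).

Lemma traceE : aone A \oc trace = \sum_(g <- s) pi g.
Proof. by rewrite /trace; case: cid. Qed.

(** The trace is the counit of the comultiplication sep: by orthogonality only
   the summand of the neutral element survives. *)
Lemma trace_right : runit a \oc (idm a \om trace) \oc sep S = idm a.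
Proof.
rewrite -mul_aone (comp_eql _ (esym (tens_comp1 _ _ _))) traceE tensm_sumr comp_sumr comp_suml.
rewrite (bigD1_seq 1%g) //= big1 ?addr0 => [|g g1]; rewrite -(aact1 pi) pi_orth //.
  by rewrite eqxx scale1r.
by rewrite eq_sym (negPf g1) scale0r.
Qed.

Local Notation rep := (repCat K G).
Implicit Types V W : rep.

(** Phi V represents the equivariant linear families of morphisms to A indexed by
   the dual of V, and coef is the universal such family: coef phi applies phi to
   the first factor of V (x) A. *)
Definition coef V : 'Hom(vdual V, Mor (Phi pi V : C) a) :=
  linfun (fun phi => bx_proj (V \bx a) phi \oc fx_incl (the_fixed (bact pi V))).

Lemma coef_def V phi :
  coef V phi = bx_proj (V \bx a) phi \oc fx_incl (the_fixed (bact pi V)).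
Proof. by rewrite linfunP // => c x y; rewrite linearP compDl compZl. Qed.

Lemma coef_act V g (phi : vdual V) : pi g \oc coef V (phi \o ract V g)%VF = coef V phi.
Proof. by rewrite !coef_def compA -boxmE -compA fx_inv. Qed.

Lemma coef_actV V g (phi : vdual V) : pi g \oc coef V phi = coef V (phi \o ract V (g^-1)%g)%VF.
Proof.
by rewrite -[RHS](coef_act g) -comp_lfunA -ractM mulVg ract1 comp_lfun1r.
Qed.

Lemma coef_ext V (Y : C) (h h' : Mor Y (Phi pi V)) :
  (forall phi : vdual V, coef V phi \oc h = coef V phi \oc h') -> h = h'.
Proof.
by move=> E; apply: fixed_ext; apply: box_ext => phi; rewrite !compA -!coef_def.
Qed.

Lemma coef_lift V (Y : C) (T : vdual V -> Mor Y a) : linear T ->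
  (forall g phi, pi g \oc T (phi \o ract V g)%VF = T phi) ->
  exists h : Mor Y (Phi pi V), forall phi, coef V phi \oc h = T phi.
Proof.
move=> Tlin Tact; pose x := box_lift (linfun T : vtens V (Mor Y a)).
have xE phi : bx_proj (V \bx a) phi \oc x = T phi by rewrite box_liftE linfunP.
have xi g : bact pi V g \oc x = x.
  by apply: box_ext => phi; rewrite compA boxmE -compA !xE.
by exists (fixed_lift xi) => phi; rewrite coef_def -compA fixed_liftE.
Qed.

Lemma coef_mor V W (f : Mor V W) (psi : vdual W) :
  coef W psi \oc fmor (Phi pi) f = coef V (psi \o vsval f)%VF.
Proof. by rewrite !coef_def -compA fixedmE compA boxmE comp1m. Qed.

Lemma coef_morE V W (f : Mor V W) (psi : vdual W) (phi : vdual V) :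
  (forall v, psi (vsval f v) = phi v) -> coef W psi \oc fmor (Phi pi) f = coef V phi.
Proof.
by move=> E; rewrite coef_mor; congr (coef V _); apply/lfunP => v; rewrite comp_lfunE.
Qed.

Lemma coef_J V W (phi : vdual V) (psi : vdual W) :
  coef (V \ox W) (vtdual phi psi) \oc PhiJ pi V W = mul A \oc (coef V phi \om coef W psi).
Proof.
rewrite !coef_def /PhiJ -!compA (compA (fx_incl _)) fixedmE -compA (compA (fx_incl _)).
rewrite fixedmE -compA fixed_liftE compA boxmE comp_lfun1r.
by rewrite -compA (compA (bx_proj _ _)) box_tensE tensm_comp.
Qed.

Lemma coef_ext2 V W (Y : C) (h h' : Mor Y (Phi pi (V \ox W))) :
  (forall (phi : vdual V) (psi : vdual W),
    coef (V \ox W) (vtdual phi psi) \oc h = coef (V \ox W) (vtdual phi psi) \oc h') -> h = h'.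
Proof.
move=> E; apply: coef_ext => Xi; rewrite (vtensdual_expand Xi).
rewrite !linear_sum !comp_suml; apply: eq_bigr => k _.
rewrite !linear_sum !comp_suml; apply: eq_bigr => l _.
by rewrite !linearZ /= !compZl E.
Qed.

Let tau_family V (v : V) (phi : vdual V) : Mor a a :=
  \sum_(g <- s) (phi (ract V g v) : K) *: pi g.

Let tau_lift V (v : V) :
  exists h : Mor a (Phi pi V), forall phi, coef V phi \oc h = tau_family v phi.
Proof.
apply: coef_lift => [c x y|g phi].
  rewrite /tau_family scaler_sumr -big_split; apply: eq_bigr => g _.
  by rewrite add_lfunE scale_lfunE scalerDl scalerA.
rewrite comp_sumr /tau_family -[RHS](sum_mulgl s_uniq s_full _ g); apply: eq_bigr => h _.
by rewrite compZr -aactM !comp_lfunE ractM comp_lfunE.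
Qed.

(* the average over G of the map A -> V (x) A sending x to v (x) x *)
Let tau_ V (v : V) : Mor a (Phi pi V) := projT1 (cid (tau_lift v)).

Let coef_tau_ V (v : V) phi : coef V phi \oc tau_ v = tau_family v phi.
Proof. by rewrite /tau_; case: cid. Qed.

Definition tau V : 'Hom(V, Mor a (Phi pi V : C)) := linfun (@tau_ V).

Lemma coef_tau V (v : V) (phi : vdual V) :
  coef V phi \oc tau V v = \sum_(g <- s) (phi (ract V g v) : K) *: pi g.
Proof.
suff -> : tau V v = tau_ v by exact: coef_tau_.
apply: linfunP => c x y; apply: coef_ext => psi; 
  rewrite compDr compZr !coef_tau_ scaler_sumr -big_split.
by apply: eq_bigr => g _; rewrite !linearP /= scalerDl scalerA.
Qed.

(** Composed with tau, coef phi becomes a combination of automorphisms, and these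
   are linearly independent. *)
Lemma coef_inj V (phi : vdual V) : coef V phi = 0 -> phi = 0.
Proof.
move=> E; apply/lfunP => v; rewrite zero_lfunE.
have := coef_tau v phi; rewrite E comp0m => /esym /(pi_free S pi_faithful) H.
have := H s_uniq (fun x y e => e) 1%g (s_full _).
by rewrite ract1 id_lfunE.
Qed.

(** * Phi is a tensor functor *)

Lemma coef_comb V (phi : vdual V) :
  \sum_k (phi (vb k) : K) *: coef V (vbd k) = coef V phi.
Proof.
rewrite [in RHS](vbd_expand phi) linear_sum; apply: eq_bigr => k _.
by rewrite linearZ.
Qed.

Lemma coef_comb_act V (phi : vdual V) g :
  pi g \oc (\sum_k (phi (ract V g (vb k)) : K) *: coef V (vbd k)) = coef V phi.
Proof.
rewrite -[RHS](coef_act g) -coef_comb; congr (_ \oc _); apply: eq_bigr => k _.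
by rewrite comp_lfunE.
Qed.

(** The factor is the order of G: averaging a family that is already invariant
   repeats it once for every group element. *)
Lemma sum_tau_coef V : \sum_k tau V (vb k) \oc coef V (vbd k) = (size s)%:R *: idm (Phi pi V).
Proof.
apply: coef_ext => phi; rewrite comp_sumr compZr compm1.
transitivity (\sum_(g <- s) coef V phi); last first.
  by rewrite big_const_seq count_predT iter_addr_0 scaler_nat.
under eq_bigr => k _.
  rewrite compA coef_tau comp_suml.
  under eq_bigr => g _ do rewrite compZl -compZr.
  over.
rewrite exchange_big; apply: eq_bigr => g _ /=.
by rewrite -comp_sumr coef_comb_act.
Qed.

(** The counit property of the trace, transported across an associator. *)
Lemma trace_snake (Y Z : C) (x : Mor Y a) :
  (idm a \om (lunit Z \oc (trace \om idm Z))) \oc assoc a a Z \oc ((sep S \oc x) \om idm Z)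
  = x \om idm Z.
Proof.
rewrite tens_comp1 -(comp_eq2 _ (assoc_nat _ _ _)) triangle tens_1comp compA.
by rewrite -!tens_1comp trace_right comp1m.
Qed.

(** Projection formula: the average of x m is trace(x) m when m is invariant. *)
Lemma tau_mul V : \sum_k tau V (vb k) \oc mul A \oc (idm a \om coef V (vbd k))
  = lunit (Phi pi V) \oc (trace \om idm (Phi pi V)).
Proof.
apply: coef_ext => phi; rewrite comp_sumr.
transitivity (\sum_(g <- s) mul A \oc (pi g \om coef V phi)).
  under eq_bigr => k _.
    rewrite !compA coef_tau !comp_suml.
    under eq_bigr => g _ do rewrite !compZl aact_mul (comp_eql _ (esym (tensm_comp _ _ _ _)))
      compm1 -compZr -tensmZr -compZr.
    over.
  rewrite exchange_big; apply: eq_bigr => g _ /=.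
  by rewrite -comp_sumr -tensm_sumr -comp_sumr coef_comb_act.
rewrite -comp_sumr -tensm_suml -traceE.
rewrite -tens_lr tens_1comp compA (compA (mul A)) mul1 -compA tens_lr.
by rewrite -tens_rl compA lunit_nat compA.
Qed.

Lemma vtdual_actE V W (phi : vdual V) (psi : vdual W) g :
  (vtdual phi psi \o ract (V \ox W : rep) g)%VF
  = vtdual (phi \o ract V g)%VF (psi \o ract W g)%VF.
Proof. exact: vtdual_act. Qed.

(** In elements, with sep(1) = sum x_i (x) y_i: v (x) w (x) x is sent to the sum over
   i of the average of v (x) x_i tensored with the average of w (x) y_i x.  Up to
   the order of G this inverts J. *)
Definition J_inv V W : Mor (Phi pi (V \ox W) : C) (Phi pi V \ox Phi pi W) :=
  \sum_k \sum_l (tau V (vb k) \om tau W (vb l)) \oc sep S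
    \oc coef (V \ox W) (vtdual (vbd k) (vbd l)).

Lemma coef_comb2 V W (phi : vdual V) (psi : vdual W) g :
  \sum_k \sum_l ((phi (ract V g (vb k)) : K) * (psi (ract W g (vb l)) : K))
     *: coef (V \ox W) (vtdual (vbd k) (vbd l))
  = coef (V \ox W) (vtdual phi psi \o ract (V \ox W : rep) g)%VF.
Proof.
rewrite vtdual_actE [in RHS](vtensdual_expand (vtdual _ _)) linear_sum.
apply: eq_bigr => k _; rewrite linear_sum; apply: eq_bigr => l _.
by rewrite linearZ /= vtdualE vpureE linearZ /= !comp_lfunE.
Qed.

(** Multiplying out leaves a double sum over G, from which the orthogonality of
   automorphisms keeps the diagonal. *)
Lemma PhiJ_inv V W : PhiJ pi V W \oc J_inv V W = (size s)%:R *: idm (Phi pi (V \ox W)).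
Proof.
apply: coef_ext2 => phi psi; rewrite compA coef_J compZr compm1.
transitivity (\sum_(g <- s) coef (V \ox W) (vtdual phi psi)); last first.
  by rewrite big_const_seq count_predT iter_addr_0 scaler_nat.
have E k l : mul A \oc (coef V phi \om coef W psi)
      \oc ((tau V (vb k) \om tau W (vb l)) \oc sep S \oc coef (V \ox W) (vtdual (vbd k) (vbd l)))
    = \sum_(g <- s) pi g \oc (((phi (ract V g (vb k)) : K) * (psi (ract W g (vb l)) : K))
         *: coef (V \ox W) (vtdual (vbd k) (vbd l))).
  rewrite !compA (comp_eql _ (esym (tensm_comp _ _ _ _))) !coef_tau.
  rewrite tensm_suml !(comp_sumr, comp_suml); apply: eq_big_seq => g gs.
  rewrite tensm_sumr !(comp_sumr, comp_suml) (bigD1_seq g) //= big1 => [|h hg]; last first.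
    rewrite tensmZl tensmZr !(compZr, compZl) (pi_orth S pi_faithful) eq_sym (negPf hg).
    by rewrite scale0r comp0m !scaler0.
  rewrite addr0 tensmZl tensmZr !(compZr, compZl) (pi_orth S pi_faithful) eqxx.
  by rewrite scale1r scalerA.
rewrite /J_inv comp_sumr.
under eq_bigr => k _.
  rewrite comp_sumr; under eq_bigr => l _ do rewrite E; rewrite exchange_big; over.
rewrite exchange_big; apply: eq_bigr => g _ /=.
under eq_bigr => k _ do rewrite -comp_sumr.
by rewrite -comp_sumr coef_comb2 coef_act.
Qed.

(** Right linearity of sep turns the second average into the projection formula,
   and the trace then cancels against sep. *)
Lemma inv_PhiJ V W : J_inv V W \oc PhiJ pi V W = (size s)%:R *: idm (Phi pi V \ox Phi pi W).
Proof.
rewrite -tensm_id -tensmZl -sum_tau_coef tensm_suml /J_inv comp_suml.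
apply: eq_bigr => k _; rewrite comp_suml.
rewrite tens_1comp -trace_snake -tau_mul !compA tens_lr tensm_sumr !comp_suml.
apply: eq_bigr => l _.
have -> : tau V (vb k) \om (tau W (vb l) \oc mul A \oc (idm a \om coef W (vbd l)))
    = (tau V (vb k) \om (tau W (vb l) \oc mul A)) \oc (idm a \om (idm a \om coef W (vbd l))).
  by rewrite -tensm_comp compm1.
rewrite -(comp_eq2 _ (assoc_nat _ _ _)) tensm_id (comp_eql _ (tens_rl _ _)).
rewrite -[LHS]compA coef_J !compA (comp_eql _ (sep_right S)) !compA.
rewrite (comp_eql _ (esym (tensm_comp _ _ _ _))) comp1m; congr (_ \oc _ \oc _).
by rewrite -tensm_comp compm1.
Qed.

Lemma PhiJ_iso V W : is_iso (PhiJ pi V W).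
Proof.
have n0 : (size s)%:R != 0 :> K := card_neq0 s_full K.
exists ((size s)%:R^-1 *: J_inv V W); split.
  by rewrite compZl inv_PhiJ scalerA mulVf // scale1r.
by rewrite compZr PhiJ_inv scalerA mulVf // scale1r.
Qed.

Lemma PhiJ_nat V V' W W' (f : Mor V V') (g : Mor W W') :
  PhiJ pi V' W' \oc (fmor (Phi pi) f \om fmor (Phi pi) g)
  = fmor (Phi pi) (f \om g) \oc PhiJ pi V W.
Proof.
apply: coef_ext2 => phi psi; rewrite 2!(compA (coef _ _)) coef_J.
rewrite (coef_morE (V := V \ox W) (phi := vtdual (phi \o vsval f)%VF (psi \o vsval g)%VF)) => [|T].
  by rewrite coef_J -compA -tensm_comp !coef_mor.
by rewrite !(vtdualE, vtensmE, comp_lfunE).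
Qed.

Lemma coef_ext3 U V W (Y : C) (h h' : Mor Y (Phi pi (U \ox (V \ox W)))) :
  (forall (phi : vdual U) (psi : vdual V) (chi : vdual W),
    coef (U \ox (V \ox W)) (vtdual phi (vtdual psi chi)) \oc h
    = coef (U \ox (V \ox W)) (vtdual phi (vtdual psi chi)) \oc h') -> h = h'.
Proof.
move=> E; apply: coef_ext2 => phi Xi.
pose L := linfun (fun Xi : vdual (V \ox W : rep) => vtdual phi Xi).
have LE Xi' : vtdual phi Xi' = L Xi' by rewrite linfunP //; exact: vtdual_linr.
rewrite LE (vtensdual_expand Xi) !linear_sum !comp_suml; apply: eq_bigr => k _.
rewrite !linear_sum !comp_suml; apply: eq_bigr => l _.
by rewrite !linearZ /= !compZl -LE E.
Qed.

Lemma PhiJ_assoc U V W :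
  fmor (Phi pi) (assoc U V W) \oc PhiJ pi (U \ox V) W \oc (PhiJ pi U V \om idm _)
  = PhiJ pi U (V \ox W) \oc (idm _ \om PhiJ pi V W) \oc assoc (Phi pi U) (Phi pi V) (Phi pi W).
Proof.
apply: coef_ext3 => phi psi chi; rewrite 4!(compA (coef _ _)) coef_J.
rewrite (coef_morE (V := (U \ox V) \ox W) (phi := vtdual (vtdual phi psi) chi)) => [|T].
  rewrite coef_J -[LHS]compA -tensm_comp coef_J compm1.
  rewrite -[mul A \oc _ \oc _]compA -tensm_comp coef_J compm1.
  rewrite -[coef W chi]comp1m tensm_comp compA mulA comp1m.
  rewrite -[coef U phi in RHS]comp1m tensm_comp !compA.
  by rewrite (comp_eq2 _ (assoc_nat _ _ _)).
by rewrite !vtdualE vassocE.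
Qed.

Lemma tensor_unit : exists2 u : Mor tone (Phi pi (tone : rep)), is_iso u &
  (forall V, fmor (Phi pi) (lunit V) \oc PhiJ pi tone V \oc (u \om idm (Phi pi V))
     = lunit (Phi pi V)) /\
  (forall V, fmor (Phi pi) (runit V) \oc PhiJ pi V tone \oc (idm (Phi pi V) \om u)
     = runit (Phi pi V)).
Proof.
pose one1 : vdual (tone : rep) := (\1%VF : vdual (K^o)).
have phi1 (phi : vdual (tone : rep)) : phi = (phi (1 : K^o) : K) *: one1.
  apply/lfunP => c; rewrite scale_lfunE id_lfunE -[c in LHS]mulr1 -[c * 1]/(c *: (1 : K^o)).
  by rewrite linearZ; exact: mulrC.
have [u uE] : exists u : Mor tone (Phi pi (tone : rep)),
    forall phi, coef tone phi \oc u = (phi (1 : K^o) : K) *: aone A.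
  apply: coef_lift => [c x y|g phi].
    by rewrite add_lfunE scale_lfunE scalerDl scalerA.
  by rewrite compZr aact_one comp_lfunE id_lfunE.
have u1 : coef tone one1 \oc u = aone A by rewrite uE id_lfunE scale1r.
exists u.
  have [y yE] : exists y, aone A \oc y = coef tone one1.
    by apply: invariant_factor => g; rewrite -[in RHS](coef_act g) comp_lfun1l.
  exists y; split.
    by apply: (@aone_monic _ _ A); rewrite compA yE u1 compm1.
  apply: coef_ext => phi; rewrite compA uE compZl yE compm1 [in RHS](phi1 phi).
  by rewrite linearZ.
split=> V; apply: coef_ext => phi; rewrite 2!(compA (coef _ _)).
  rewrite (coef_morE (V := tone \ox V) (phi := vtdual one1 phi)) => [|T].
    by rewrite coef_J -compA -tensm_comp u1 compm1 -tens_lr compA mul1 lunit_nat.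
  by rewrite vlunitE vtdualE.
rewrite (coef_morE (V := V \ox tone) (phi := vtdual phi one1)) => [|T].
  by rewrite coef_J -compA -tensm_comp u1 compm1 -tens_rl compA mul_aone runit_nat.
rewrite vrunitE vtdualE id_lfunE.
rewrite [in RHS](vbd_expand phi) !linear_sum; apply: eq_bigr => k _.
by rewrite !linearZ; exact: mulrC.
Qed.

Lemma Phi_tensor_functor : is_tensor_functor (PhiJ pi).
Proof.
split; [exact: PhiJ_iso|exact: PhiJ_nat|exact: PhiJ_assoc|exact: tensor_unit].
Qed.

(** The structure map J is built from the multiplication of A, which absorbs
   braidings; so J absorbs the double braiding. *)
Lemma Phi_symmetric V W :
  braid (Phi pi W) (Phi pi V) \oc braid (Phi pi V) (Phi pi W) = idm _.
Proof.
apply: (iso_mono (PhiJ_iso V W)); apply: coef_ext2 => phi psi.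
rewrite compm1 (compA (coef _ _)) coef_J compA (comp_eql _ (esym (braid_nat _ _))).
by rewrite compA mulC (comp_eql _ (esym (braid_nat _ _))) compA mulC.
Qed.

(** * Phi is fully faithful *)

Lemma coef_inj2 V (phi psi : vdual V) : coef V phi = coef V psi -> phi = psi.
Proof.
move=> E; apply/eqP; rewrite -subr_eq0; apply/eqP/coef_inj.
by rewrite linearB /= E subrr.
Qed.

Lemma Phi_faithful V W (f f' : Mor V W) : fmor (Phi pi) f = fmor (Phi pi) f' -> f = f'.
Proof.
move=> E; apply: rhomP; apply/lfunP => v; apply: vdual_sep => psi.
have : coef W psi \oc fmor (Phi pi) f = coef W psi \oc fmor (Phi pi) f' by rewrite E.
by rewrite !coef_mor => /coef_inj2 /lfunP/(_ v); rewrite !comp_lfunE.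
Qed.

Let avg (u : Mor a a) := mul A \oc (idm a \om u) \oc sep S.

(* linearity lets linear_full assemble these scalars into a linear map *)
Let avg_functional : exists L : vdual (Mor a a), forall u, avg u = (L u : K) *: idm a.
Proof.
have [L0 L01] : exists L0 : vdual (Mor a a), L0 (idm a) = 1.
  by apply: vdual_normalized => E; apply: (elimN eqP (pi_neq0 pi 1%g)); rewrite aact1.
pose L u : K^o := L0 (avg u).
have Llin : linear L.
  by move=> c x y; rewrite /L /avg tensm_linr compDr compZr compDl compZl linearP.
exists (linfun L) => u; rewrite linfunP // /L.
have [c ->] : exists c : K, avg u = c *: idm a.
  by apply: average_left_linear; exact: sep_left.
by rewrite linearZ /= L01; congr (_ *: _); rewrite -[RHS]/(c * 1) mulr1.
Qed.

(** Galois descent: a morphism f : Phi V -> Phi W extends to an A-linear map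
   V (x) A -> W (x) A, whose matrix coefficients are A-linear endomorphisms of A,
   that is scalars. *)
Lemma linear_full V W (f : Mor (Phi pi V) (Phi pi W)) :
  exists h : 'Hom(V, W), forall psi : vdual W, coef V (psi \o h)%VF = coef W psi \oc f.
Proof.
have [L LE] := avg_functional.
pose F (psi : vdual W) (v : V) : K^o := L (coef W psi \oc f \oc tau V v).
pose h (v : V) : W := \sum_k (F (vbd k) v : K) *: vb k.
have hlin : linear h.
  move=> c x y; rewrite /h scaler_sumr -big_split; apply: eq_bigr => k _.
  by rewrite /F linearP compDr compZr linearP scalerDl scalerA.
have hE (psi : vdual W) v : psi (h v) = F psi v.
  rewrite /h linear_sum [in RHS](vbd_expand psi) /F linear_sum !comp_suml linear_sum.
  by apply: eq_bigr => k _; rewrite !linearZ /= !compZl linearZ; exact: mulrC.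
exists (linfun h) => psi; rewrite -coef_comb.
transitivity (\sum_k avg (coef W psi \oc f \oc tau V (vb k)) \oc coef V (vbd k)).
  by apply: eq_bigr => k _; rewrite comp_lfunE linfunP // hE LE compZl comp1m.
apply: (iso_epi (lunit_iso _)); rewrite comp_suml.
have sepE : sep S \oc lunit a = (idm a \om mul A) \oc assoc a a a
    \oc ((sep S \oc aone A) \om idm a).
  by rewrite -mul1 compA sep_right -compA -tens_1comp.
transitivity (\sum_k mul A \oc (idm a \om (coef W psi \oc f \oc (tau V (vb k) \oc mul A
     \oc (idm a \om coef V (vbd k))))) \oc assoc a a (Phi pi V)
     \oc ((sep S \oc aone A) \om idm (Phi pi V))).
  apply: eq_bigr => k _; rewrite -[LHS]compA -lunit_nat /avg !compA (comp_eql _ sepE) !compA.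
  rewrite (comp_eql _ (tens_lr _ _)) -(tens_rl (sep S \oc aone A)) compA.
  rewrite -[idm (a \ox a)]tensm_id (comp_eq2 _ (assoc_nat _ _ _)).
  by rewrite !(comp_eql _ (esym (tens_comp1 _ _ _))) !compA.
rewrite -!comp_suml -comp_sumr -tensm_sumr -comp_sumr tau_mul tens_comp1 !compA.
rewrite -[LHS]compA -[LHS]compA (compA _ (assoc _ _ _)) trace_snake.
by rewrite -compA tens_rl -tens_lr compA mul1 lunit_nat.
Qed.

(** The linear map of linear_full intertwines the actions because coef is injective. *)
Lemma Phi_full V W (f : Mor (Phi pi V) (Phi pi W)) : exists h : Mor V W, fmor (Phi pi) h = f.
Proof.
have [h hE] := linear_full f.
have hi : intertwines h.
  move=> g; apply/lfunP => v; apply: vdual_sep => psi.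
  suff E : (psi \o h \o ract V g)%VF = (psi \o ract W g \o h)%VF.
    by have := congr1 (fun l : vdual V => l v) E; rewrite /= !comp_lfunE.
  apply: coef_inj2; rewrite hE -[g in LHS]invgK -coef_actV hE -[g in RHS]invgK -coef_actV.
  by rewrite compA.
by exists (mk_rhom hi); apply: coef_ext => psi; rewrite coef_mor hE.
Qed.

End Coordinates.

(** * Representations of a finite group *)

Section Splitting.
Variables (K : fieldType) (C : linCat K).

(** Complete reducibility is used in this form: every morphism is von Neumann
   regular and idempotents split.  Both properties are equations, hence pass
   through any functor. *)
Definition regular_cat := forall (X Y : C) (f : Mor X Y), exists f', f \oc f' \oc f = f.
Definition idem_split := forall (X : C) (p : Mor X X), p \oc p = p ->
  exists U (i : Mor U X) (r : Mor X U), r \oc i = idm U /\ i \oc r = p.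

Lemma split_monic (X Y : C) (i : Mor X Y) r : r \oc i = idm X -> monic i.
Proof.
by move=> ri Z u v /(congr1 (ccomp r)); rewrite !compA ri !comp1m.
Qed.

Lemma simple_idem : idem_split -> forall (X : C) (p : Mor X X),
  simple X -> p \oc p = p -> p = 0 \/ p = idm X.
Proof.
move=> sp X p [_ Xs] pp; have [U [i [r [ri ir]]]] := sp X p pp.
have [U0|[j [ji ij]]] := Xs U i (split_monic ri); [left|right].
  by rewrite -ir [r]((U0 X).1 r) compm0.
suff -> : p = i \oc j by [].
by rewrite -ir -[j in RHS]comp1m -ri -compA ij compm1.
Qed.

Lemma idem_simple : regular_cat -> forall X : C, idm X <> 0 ->
  (forall p : Mor X X, p \oc p = p -> p = 0 \/ p = idm X) -> simple X.
Proof.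
move=> reg X X0 Xp; split=> [/id_zero//|Y m mm].
have [h mhm] := reg Y X m.
have hm : h \oc m = idm Y by apply: mm; rewrite compA mhm compm1.
have [E|E] := Xp (m \oc h) (etrans (compA _ _ _) (congr1 (ccomp^~ h) mhm)).
  by left; apply: zero_id; rewrite -hm -[m]mhm E comp0m compm0.
by right; exists h.
Qed.

End Splitting.

Section Maschke.
Variables (K : numFieldType) (G : topGroupType) (s : seq G).
Hypotheses (s_uniq : uniq s) (s_full : forall g, g \in s).
Local Notation rep := (repCat K G).
Implicit Types V W : rep.

Lemma ractK V x (v : V) : ract V (x^-1)%g (ract V x v) = v.
Proof. by rewrite -comp_lfunE -ractM mulVg ract1 id_lfunE. Qed.

Lemma rhomE V W (f : Mor V W) x v : vsval f (ract V x v) = ract W x (vsval f v).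
Proof. by have /lfunP/(_ v) := rhom_intertwines f x; rewrite !comp_lfunE. Qed.

Lemma average_intertwines V W (h : 'Hom(V, W)) :
  @intertwines K G V W (\sum_(g <- s) (ract W g \o h \o ract V (g^-1)%g)%VF).
Proof.
move=> x; apply/lfunP => v; rewrite !comp_lfunE !sum_lfunE linear_sum.
rewrite -(sum_mulgl s_uniq s_full _ x); apply: eq_bigr => g _.
by rewrite !comp_lfunE invgM !ractM !comp_lfunE ractK.
Qed.

(** Averaging a linear generalized inverse of f over G keeps it a generalized
   inverse, because f commutes with G. *)
Lemma rep_regular : regular_cat (repCat K G).
Proof.
move=> V W f; pose h : 'Hom(W, V) := (vsval f)^-1%VF.
have fhf w : vsval f (h (vsval f w)) = vsval f w by rewrite limg_lfunVK // memv_img ?memvf.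
exists ((size s)%:R^-1 *: mk_rhom (average_intertwines (V := W) (W := V) h)).
apply: rhomP; apply/lfunP => v; rewrite /= !comp_lfunE scale_lfunE linearZ /=.
rewrite sum_lfunE linear_sum.
rewrite (eq_bigr (fun _ => vsval f v)) => [|g _].
  rewrite big_const_seq count_predT iter_addr_0 -(scaler_nat (size s) (vsval f v)).
  by rewrite scalerA mulVf ?scale1r ?(card_neq0 s_full).
by rewrite /= !comp_lfunE rhomE -(rhomE f (g^-1)%g) fhf rhomE -{1}(invgK g) ractK.
Qed.

Definition retract_act V (U : vectType K) (i : 'Hom(U, V)) (r : 'Hom(V, U)) (g : G) :
  'End(U) := (r \o ract V g \o i)%VF.

Lemma retract_rep V (U : vectType K) (i : 'Hom(U, V)) (r : 'Hom(V, U)) (p : Mor V V) :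
  cancel i r -> (forall v, i (r v) = vsval p v) ->
  exists U' : rep, exists (i' : Mor U' V) (r' : Mor V U'),
    rsp U' = U /\ r' \oc i' = idm U' /\ i' \oc r' = p.
Proof.
move=> iK ir.
have a1 : retract_act i r 1%g = \1%VF.
  by apply/lfunP => u; rewrite /retract_act !comp_lfunE ract1 !id_lfunE iK.
have aM g h : retract_act i r (g * h)%g = (retract_act i r g \o retract_act i r h)%VF.
  apply/lfunP => u; rewrite /retract_act !comp_lfunE ractM comp_lfunE.
  by rewrite ir rhomE -ir iK.
have ac : vcontinuous (retract_act i r).
  pose L f := (r \o f \o i)%VF.
  have LE f : linfun L f = L f.
    rewrite linfunP // => c x y.
    by rewrite /L comp_lfunDr comp_lfunDl -comp_lfunZr -comp_lfunZl.
  rewrite (_ : retract_act i r = fun g => linfun L (ract V g)).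
    by apply: vcontinuous_lin; exact: ract_cont.
  by apply/funext => g; rewrite LE.
pose U' := Rep a1 aM ac : rep.
have ii : @intertwines K G U' V i.
  by move=> g; apply/lfunP => u; rewrite !comp_lfunE ir rhomE -ir iK.
have ri : @intertwines K G V U' r.
  by move=> g; apply/lfunP => u; rewrite !comp_lfunE ir -rhomE -ir iK.
exists U', (mk_rhom ii), (mk_rhom ri); split=> //.
by split; apply: rhomP; apply/lfunP => u; rewrite !comp_lfunE ?iK ?ir ?id_lfunE.
Qed.

(** The dimension is recorded for the induction in rep_ind. *)
Lemma rep_split_dim V (p : Mor V V) : p \oc p = p ->
  exists (U : rep) (i : Mor U V) (r : Mor V U),
    [/\ r \oc i = idm U, i \oc r = p & \dim {: U} = \dim (limg (vsval p))].
Proof.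
move=> pp; have ppv v : vsval p (vsval p v) = vsval p v.
  by have := congr1 (fun f : Mor V V => vsval f v) pp; rewrite /= comp_lfunE.
pose L := limg (vsval p); pose i : 'Hom(subvs_of L, V) := linfun (@vsval K V L).
pose r : 'Hom(V, subvs_of L) := linfun (fun v => vsproj L (vsval p v)).
have iE u : i u = vsval u by rewrite linfunP // => c x y; rewrite linearP.
have rE v : r v = vsproj L (vsval p v) by rewrite linfunP // => c x y; rewrite !linearP.
have ir v : i (r v) = vsval p v by rewrite iE rE vsprojK // memv_img ?memvf.
have iK : cancel i r.
  move=> u; rewrite rE iE; have /memv_imgP[v _ uE] := subvsP u.
  by rewrite uE ppv -uE vsvalK.
have [U' [i' [r' [UE [ri ir']]]]] := retract_rep iK ir.
exists U', i', r'; split=> //; rewrite UE.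
by rewrite dimvf.
Qed.

Lemma rep_split : idem_split (repCat K G).
Proof.
by move=> V p /rep_split_dim[U [i [r [ri ir _]]]]; exists U, i, r.
Qed.

Lemma rep_zero : exists Z : rep, is_zero Z.
Proof.
have [U [i [r [ri ir]]]] := rep_split (compm0 _ (0 : Mor (tone : rep) tone)).
by exists U; apply: zero_id; rewrite -[LHS]comp1m -ri -compA (compA i) ir comp0m compm0.
Qed.

(** Induction on the dimension: a nonzero representation that is not simple has a
   nontrivial idempotent p, and p and 1 - p split off smaller summands. *)
Lemma rep_ind (Q : rep -> Prop) :
  (forall Z, is_zero Z -> Q Z) -> (forall V, simple V -> Q V) ->
  (forall V W U (i1 : Mor V U) (i2 : Mor W U) (p1 : Mor U V) (p2 : Mor U W),
    is_biproduct i1 i2 p1 p2 -> Q V -> Q W -> Q U) ->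
  forall V, Q V.
Proof.
move=> Q0 Qs QD V; have [n] := ubnP (\dim {: V}); elim: n V => // n IH V; rewrite ltnS => leVn.
have [V0|V0] := pselect (idm V = 0); first exact/Q0/zero_id.
have [Vs|] := pselect (forall p : Mor V V, p \oc p = p -> p = 0 \/ p = idm V).
  by apply: Qs; apply: idem_simple => //; exact: rep_regular.
move=> /existsNP[p] /not_implyP[pp] /not_orP[p0 p1].
pose q := idm V - p.
have pq : p \oc q = 0 by rewrite compBr compm1 pp subrr.
have qp : q \oc p = 0 by rewrite compBl comp1m pp subrr.
have qq : q \oc q = q by rewrite {1}/q compBl comp1m pq subr0.
have q1 : q <> idm V by move/eqP; rewrite subr_eq addrC -subr_eq subrr => /eqP/esym.
have small (t : Mor V V) : t \oc t = t -> t <> idm V -> (\dim (limg (vsval t)) < n)%N.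
  move=> tt t1; apply: leq_trans leVn; rewrite ltn_neqAle dimvS ?subvf // andbT.
  apply/eqP => dE; apply: t1; apply: rhomP; apply/lfunP => v.
  have /memv_imgP[w _ vE] : v \in limg (vsval t).
    suff -> : limg (vsval t) = fullv by rewrite memvf.
    by apply/eqP; rewrite eqEdim subvf dE /=.
  have := congr1 (fun f : Mor V V => vsval f w) tt; rewrite /= comp_lfunE id_lfunE.
  by rewrite -vE.
have [U1 [i1 [r1 [ri1 ir1 d1]]]] := rep_split_dim pp.
have [U2 [i2 [r2 [ri2 ir2 d2]]]] := rep_split_dim qq.
apply: (QD U1 U2 V i1 i2 r1 r2); last 2 first.
- by apply: IH; rewrite d1; exact: small.
- by apply: IH; rewrite d2; exact: small.
split=> //; last by rewrite ir1 ir2 addrC subrK.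
- rewrite -[i2]compm1 -ri2 -[r1]comp1m -ri1 -2!compA (compA i1) ir1 (compA i2) ir2.
  by rewrite (compA p) pq comp0m compm0.
- rewrite -[i1]compm1 -ri1 -[r2]comp1m -ri2 -2!compA (compA i2) ir2 (compA i1) ir1.
  by rewrite (compA q) qp comp0m compm0.
Qed.

Section DirectSum.
Variables V W : rep.
Let act (g : G) : 'End((V * W)%type) :=
  linfun (fun x : (V * W)%type => (ract V g x.1, ract W g x.2)).

Let actE g x : act g x = (ract V g x.1, ract W g x.2).
Proof. by rewrite linfunP // => c y z; rewrite /= !linearP. Qed.

Let i1 : 'Hom(V, (V * W)%type) := linfun (fun v : V => (v, 0 : W)).
Let i2 : 'Hom(W, (V * W)%type) := linfun (fun w : W => (0 : V, w)).
Let p1 : 'Hom((V * W)%type, V) := linfun (fun x : (V * W)%type => x.1).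
Let p2 : 'Hom((V * W)%type, W) := linfun (fun x : (V * W)%type => x.2).

Let i1E v : i1 v = (v, 0).
Proof. by rewrite linfunP // => c y z; rewrite /= -[RHS]/(_, _) /= scaler0 addr0. Qed.
Let i2E w : i2 w = (0, w).
Proof. by rewrite linfunP // => c y z; rewrite /= -[RHS]/(_, _) /= scaler0 addr0. Qed.
Let p1E x : p1 x = x.1.
Proof. by rewrite linfunP. Qed.
Let p2E x : p2 x = x.2.
Proof. by rewrite linfunP. Qed.

Let act1 : act 1%g = \1%VF.
Proof. by apply/lfunP => -[v w]; rewrite actE !ract1 !id_lfunE. Qed.

Let actM g h : act (g * h)%g = (act g \o act h)%VF.
Proof. by apply/lfunP => -[v w]; rewrite comp_lfunE !actE /= !ractM !comp_lfunE. Qed.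

Let act_cont : vcontinuous act.
Proof.
pose L1 (f : 'End(V)) := (i1 \o f \o p1)%VF.
pose L2 (f : 'End(W)) := (i2 \o f \o p2)%VF.
have L1E f : linfun L1 f = L1 f.
  by rewrite linfunP // => c x y; rewrite /L1 comp_lfunDr comp_lfunDl -comp_lfunZr -comp_lfunZl.
have L2E f : linfun L2 f = L2 f.
  by rewrite linfunP // => c x y; rewrite /L2 comp_lfunDr comp_lfunDl -comp_lfunZr -comp_lfunZl.
move=> l; rewrite (_ : (fun g => _) =
    (fun g => (l (linfun L1 (ract V g)) : K^o) + (l (linfun L2 (ract W g)) : K^o))).
  move=> g; apply: cvgD.
    exact: (@vcontinuous_lin K G _ _ (linfun L1) _ (@ract_cont K G V) l g).
  exact: (@vcontinuous_lin K G _ _ (linfun L2) _ (@ract_cont K G W) l g).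
apply/funext => g; rewrite -linearD L1E L2E; congr (l _); apply/lfunP => -[v w].
rewrite add_lfunE !comp_lfunE actE i1E i2E p1E p2E /=.
by rewrite -[RHS]/(_, _) /= addr0 add0r.
Qed.

Lemma rep_biproduct : exists (U : rep) (i1 : Mor V U) (i2 : Mor W U) (p1 : Mor U V)
  (p2 : Mor U W), is_biproduct i1 i2 p1 p2.
Proof.
pose U : rep := Rep act1 actM act_cont.
have Hi1 : @intertwines K G V U i1.
  by move=> g; apply/lfunP => v; rewrite !comp_lfunE !i1E actE /= linear0.
have Hi2 : @intertwines K G W U i2.
  by move=> g; apply/lfunP => v; rewrite !comp_lfunE !i2E actE /= linear0.
have Hp1 : @intertwines K G U V p1.
  by move=> g; apply/lfunP => v; rewrite !comp_lfunE !p1E actE.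
have Hp2 : @intertwines K G U W p2.
  by move=> g; apply/lfunP => v; rewrite !comp_lfunE !p2E actE.
exists U, (mk_rhom Hi1), (mk_rhom Hi2), (mk_rhom Hp1), (mk_rhom Hp2).
split; apply: rhomP; apply/lfunP => /= v.
- by rewrite comp_lfunE i1E p1E id_lfunE.
- by rewrite comp_lfunE i2E p2E id_lfunE.
- by rewrite comp_lfunE i2E p1E zero_lfunE.
- by rewrite comp_lfunE i1E p2E zero_lfunE.
rewrite add_lfunE !comp_lfunE p1E p2E i1E i2E id_lfunE; case: v => v w.
by rewrite -[LHS]/(_, _) /= addr0 add0r.
Qed.

End DirectSum.

End Maschke.

(** * Dual representations and Schur's lemma *)

Section Dual.
Variables (K : numFieldType) (G : topGroupType).
Local Notation rep := (repCat K G).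
Implicit Types U V W : rep.

Lemma dual_map_subproof V W (f : Mor V W) :
  @intertwines K G (rdual W) (rdual V) (vtr (vsval f)).
Proof.
move=> g; apply/lfunP => psi; apply/lfunP => v.
by rewrite !comp_lfunE !vtrE !comp_lfunE rhomE.
Qed.

Definition dual_map V W (f : Mor V W) : Mor (rdual W : rep) (rdual V) :=
  mk_rhom (dual_map_subproof f).

Lemma dual_mapE V W (f : Mor V W) psi v :
  (vsval (dual_map f) psi : vdual V) v = psi (vsval f v).
Proof. by rewrite vtrE comp_lfunE. Qed.

Lemma dual_map_id V : dual_map (idm V) = idm (rdual V : rep).
Proof.
by apply: rhomP; apply/lfunP => psi; apply/lfunP => v; rewrite dual_mapE !id_lfunE.
Qed.

Lemma dual_map_comp U V W (g : Mor V W) (f : Mor U V) :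
  dual_map (g \oc f) = dual_map f \oc dual_map g.
Proof.
apply: rhomP; apply/lfunP => psi; apply/lfunP => v.
by rewrite dual_mapE /= !comp_lfunE !dual_mapE.
Qed.

Lemma dual_map_inj V W (f f' : Mor V W) : dual_map f = dual_map f' -> f = f'.
Proof.
move=> E; apply: rhomP; apply/lfunP => v; apply: vdual_sep => psi.
by rewrite -!dual_mapE E.
Qed.

Lemma dual_map_full V W (q : Mor (rdual W : rep) (rdual V)) : exists f, dual_map f = q.
Proof.
pose h (v : V) : W := \sum_k ((vsval q (vbd k) : vdual V) v : K) *: vb k.
have hE v : linfun h v = h v.
  rewrite linfunP // => c x y; rewrite /h scaler_sumr -big_split; apply: eq_bigr => k _.
  by rewrite linearP scalerDl scalerA.
have hq (psi : vdual W) v : psi (linfun h v) = (vsval q psi : vdual V) v.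
  rewrite hE /h linear_sum [in RHS](vbd_expand psi) linear_sum sum_lfunE.
  by apply: eq_bigr => k _; rewrite !linearZ scale_lfunE; exact: mulrC.
have hi : @intertwines K G V W (linfun h).
  move=> g; apply/lfunP => v; apply: vdual_sep => psi; rewrite !comp_lfunE hq.
  have := rhomE q (g^-1)%g psi => /(congr1 (fun l : vdual V => l v)).
  by rewrite /= !vtrE comp_lfunE invgK => <-; rewrite -hq comp_lfunE.
exists (mk_rhom hi); apply: rhomP; apply/lfunP => psi; apply/lfunP => v.
by rewrite dual_mapE hq.
Qed.

Lemma dual_map_iso V W (f : Mor V W) : is_iso f -> is_iso (dual_map f).
Proof.
move=> [g [gf fg]]; exists (dual_map g).
by split; rewrite -dual_map_comp ?gf ?fg dual_map_id.
Qed.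

Lemma dual_isomorphic V W : isomorphic V W -> isomorphic (rdual V : rep) (rdual W).
Proof. by move=> /isomorphic_sym[f ff]; exists (dual_map f); exact: dual_map_iso. Qed.

Lemma dual_isomorphicI V W : isomorphic (rdual V : rep) (rdual W) -> isomorphic V W.
Proof.
move=> /isomorphic_sym[f [f' [f'f ff']]].
have [h hE] := dual_map_full f; have [h' h'E] := dual_map_full f'; exists h, h'.
by split; apply: dual_map_inj; rewrite dual_map_comp hE h'E dual_map_id.
Qed.

Definition bidual V : 'Hom(V, vdual (vdual V)) :=
  linfun (fun v : V => linfun (fun phi : vdual V => phi v) : vdual (vdual V)).

Lemma bidualE V (v : V) (phi : vdual V) : bidual V v phi = phi v.
Proof.
have E w psi : (linfun (fun psi : vdual V => psi w) : vdual (vdual V)) psi = psi w.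
  by rewrite linfunP // => c x y; rewrite add_lfunE scale_lfunE.
rewrite linfunP ?E // => c x y; apply/lfunP => psi.
by rewrite add_lfunE scale_lfunE !E linearP.
Qed.

Lemma bidual_act V g (v : V) :
  (bidual V v \o ract (rdual V) (g^-1)%g)%VF = bidual V (ract V g v).
Proof.
by apply/lfunP => phi; rewrite comp_lfunE !bidualE vtrE comp_lfunE invgK.
Qed.

Lemma double_dual V : isomorphic V (rdual (rdual V) : rep).
Proof.
pose c (X : vdual (vdual V)) : V := \sum_k (X (vbd k) : K) *: vb k.
have cE X : linfun c X = c X.
  rewrite linfunP // => d x y; rewrite /c scaler_sumr -big_split; apply: eq_bigr => k _.
  by rewrite add_lfunE scale_lfunE scalerDl scalerA.
have Bi : @intertwines K G V (rdual (rdual V)) (bidual V).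
  by move=> g; apply/lfunP => v; rewrite !comp_lfunE vtrE -bidual_act.
have BK : cancel (bidual V) (linfun c).
  by move=> v; rewrite cE /c [RHS]vb_expand; apply: eq_bigr => k _; rewrite bidualE.
have cK : cancel (linfun c) (bidual V).
  move=> X; apply/lfunP => phi; rewrite bidualE cE /c [in RHS](vbd_expand phi) !linear_sum.
  by apply: eq_bigr => k _; rewrite !linearZ; exact: mulrC.
exists (mk_rhom Bi), (mk_rhom (@inv_intertwines K G V (rdual (rdual V)) _ _ BK cK Bi)).
by split; apply: rhomP; apply/lfunP => x; rewrite /= comp_lfunE id_lfunE ?BK ?cK.
Qed.

Variable s : seq G.
Hypotheses (s_uniq : uniq s) (s_full : forall g, g \in s).

(** Simplicity is detected by idempotents, and duality is an anti-isomorphism of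
   endomorphism rings. *)
Lemma dual_simple V : simple V -> simple (rdual V : rep).
Proof.
move=> Vs; apply: idem_simple; first exact: rep_regular s_uniq s_full.
  rewrite -dual_map_id => E; apply: Vs.1; apply: zero_id; apply: dual_map_inj; rewrite E.
  by apply: rhomP; apply/lfunP => psi; apply/lfunP => v; rewrite dual_mapE !zero_lfunE linear0.
move=> p pp; have [q qE] := dual_map_full p.
have qq : q \oc q = q by apply: dual_map_inj; rewrite dual_map_comp qE.
have [q0|q1] := simple_idem (@rep_split K G) Vs qq; [left|right].
  rewrite -qE q0.
  by apply: rhomP; apply/lfunP => psi; apply/lfunP => v; rewrite dual_mapE !zero_lfunE linear0.
by rewrite -qE q1 dual_map_id.
Qed.

(** W is the dual of its dual, which is one of the F k. *)
Lemma simple_dual_irrep (J : Type) (F : J -> rep) W :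
  is_irreps F -> simple W -> exists k, isomorphic W (rdual (F k) : rep).
Proof.
move=> [_ _ Fall] /dual_simple/Fall[k /dual_isomorphic E]; exists k.
exact: isomorphic_trans (double_dual W) E.
Qed.

End Dual.

Section Schur.
Variables (K : numClosedFieldType) (G : topGroupType) (s : seq G).
Hypotheses (s_uniq : uniq s) (s_full : forall g, g \in s).
Local Notation rep := (repCat K G).
Implicit Types U V W : rep.

Lemma eigenvector (V : vectType K) (f : 'End(V)) : (0 < \dim {: V})%N ->
  exists (c : K) (v : V), v != 0 /\ f v = c *: v.
Proof.
move=> V0; pose M := \matrix_(k < \dim {: V}, l < \dim {: V}) (vbd l (f (vb k)) : K).
have [c /eigenvalueP[u uM u0]] := eigenvalue_closed M V0.
pose v := \sum_k u 0 k *: vb k; exists c, v.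
have vE k : vbd k v = u 0 k.
  rewrite /v linear_sum (bigD1 k) //= big1 => [|j jk]; rewrite linearZ /= vbd_vb.
    by rewrite eqxx addr0; exact: mulr1.
  by rewrite eq_sym (negPf jk); exact: mulr0.
split.
  apply: contraNneq u0 => v0; apply/eqP/rowP => k.
  by rewrite mxE -vE v0 linear0.
rewrite [LHS]vb_expand [in RHS]/v scaler_sumr; apply: eq_bigr => l _.
rewrite scalerA; congr (_ *: _).
have := congr1 (fun r : 'rV_(\dim {: V}) => r 0 l) uM; rewrite !mxE => <-.
rewrite /v !linear_sum; apply: eq_bigr => k _.
by rewrite !linearZ /= mxE.
Qed.

Lemma schur V (f : Mor V V) : simple V -> exists c : K, f = c *: idm V.
Proof.
move=> Vs; have V0 : (0 < \dim {: V})%N.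
  rewrite lt0n; apply/eqP => /eqP; rewrite dimv_eq0 => /eqP V0; apply: Vs.1; apply: zero_id.
  apply: rhomP; apply/lfunP => v; have := memvf v.
  by rewrite V0 memv0 => /eqP ->; rewrite !linear0.
have [c [v [v0 fv]]] := eigenvector (vsval f) V0; exists c.
pose d := f - c *: idm V; have dv : vsval d v = 0.
  by rewrite /= add_lfunE opp_lfunE scale_lfunE id_lfunE fv subrr.
have [h dhd] := rep_regular s_uniq s_full d.
have pp : (h \oc d) \oc (h \oc d) = h \oc d by rewrite -compA (compA d) dhd.
have [E|E] := simple_idem (@rep_split K G) Vs pp.
- by apply/eqP; rewrite -subr_eq0 -/d -dhd -compA E compm0.
have := congr1 (fun f : Mor V V => vsval f v) E; rewrite /= comp_lfunE dv linear0 id_lfunE.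
by move/esym/eqP; rewrite (negPf v0).
Qed.

Lemma schur0 V W (f : Mor V W) : simple V -> simple W -> ~ isomorphic V W -> f = 0.
Proof.
move=> Vs Ws nVW; have [h fhf] := rep_regular s_uniq s_full f.
have pp : (h \oc f) \oc (h \oc f) = h \oc f by rewrite -compA (compA f) fhf.
have [E|E] := simple_idem (@rep_split K G) Vs pp.
- by rewrite -fhf -compA E compm0.
have qq : (f \oc h) \oc (f \oc h) = f \oc h by rewrite compA fhf.
have [E'|E'] := simple_idem (@rep_split K G) Ws qq.
- by rewrite -fhf E' comp0m.
by case: nVW; exists f, h.
Qed.

End Schur.

(** * Equivalences and generated subcategories *)

Section Functors.
Variables (K : fieldType) (C D : linCat K) (F : functor C D).

Lemma fmor0 X Y : fmor F (0 : Mor X Y) = 0.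
Proof. by have := fmor_lin F (-1) (0 : Mor X Y) 0; rewrite scaler0 addr0 scaleN1r addNr. Qed.

Lemma fmorD X Y (f g : Mor X Y) : fmor F (f + g) = fmor F f + fmor F g.
Proof. by have := fmor_lin F 1 f g; rewrite !scale1r. Qed.

Lemma fmorZ X Y c (f : Mor X Y) : fmor F (c *: f) = c *: fmor F f.
Proof. by have := fmor_lin F c f 0; rewrite !addr0 fmor0 addr0. Qed.

Lemma fmorB X Y (f g : Mor X Y) : fmor F (f - g) = fmor F f - fmor F g.
Proof. by rewrite fmorD -scaleN1r fmorZ scaleN1r. Qed.

Lemma fmor_inv X Y (f : Mor X Y) g : is_inv f g -> is_inv (fmor F f) (fmor F g).
Proof. by move=> [gf fg]; split; rewrite -fmor_comp ?gf ?fg fmor_id. Qed.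

Lemma fmor_isomorphic X Y : isomorphic X Y -> isomorphic (F X) (F Y).
Proof. by move=> [f [g /fmor_inv fg]]; exists (fmor F f); exact: inv_iso fg. Qed.

Lemma fmor_zero X : is_zero X -> is_zero (F X).
Proof. by move=> /id_zero X0; apply: zero_id; rewrite -fmor_id X0 fmor0. Qed.

Lemma fmor_biproduct X Y Z (i1 : Mor X Z) (i2 : Mor Y Z) p1 p2 :
  is_biproduct i1 i2 p1 p2 ->
  is_biproduct (fmor F i1) (fmor F i2) (fmor F p1) (fmor F p2).
Proof.
move=> [E1 E2 E3 E4 E5].
by split; rewrite -!fmor_comp ?E1 ?E2 ?E3 ?E4 ?fmor_id ?fmor0 // -fmorD E5 fmor_id.
Qed.

Hypothesis F_faithful : forall X Y (f g : Mor X Y), fmor F f = fmor F g -> f = g.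
Hypothesis F_full : forall X Y (f : Mor (F X) (F Y)), exists g, fmor F g = f.

Lemma ff_isomorphic X Y : isomorphic (F X) (F Y) -> isomorphic X Y.
Proof.
move=> [f [g [gf fg]]]; have [f' f'E] := F_full f; have [g' g'E] := F_full g.
by exists f', g'; split; apply: F_faithful; rewrite fmor_comp f'E g'E fmor_id.
Qed.

Lemma ff_equivalence : (forall Y, exists X, isomorphic (F X) Y) -> is_equivalence F.
Proof.
move=> F_surj.
have [G0 G0P] := choice F_surj.
pose e Y : Mor (F (G0 Y)) Y := projT1 (cid (G0P Y)).
have eP Y : is_iso (e Y) := projT2 (cid (G0P Y)).
pose e' Y : Mor Y (F (G0 Y)) := projT1 (cid (eP Y)).
have e'P Y : is_inv (e Y) (e' Y) := projT2 (cid (eP Y)).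
pose lft X X' (f : Mor (F X) (F X')) : Mor X X' := projT1 (cid (F_full f)).
have lftE X X' (f : Mor (F X) (F X')) : fmor F (lft X X' f) = f := projT2 (cid (F_full f)).
pose G1 Y Y' (f : Mor Y Y') := lft _ _ (e' Y' \oc f \oc e Y).
have G1_lin Y Y' : linear (@G1 Y Y').
  move=> c f g; apply: F_faithful; rewrite fmorD fmorZ !lftE.
  by rewrite compDr compDl compZr compZl.
have G1_id Y : G1 Y Y (idm Y) = idm (G0 Y).
  by apply: F_faithful; rewrite lftE fmor_id compm1 (e'P Y).1.
have G1_comp X Y Z (g : Mor Y Z) (f : Mor X Y) : G1 X Z (g \oc f) = G1 Y Z g \oc G1 X Y f.
  apply: F_faithful; rewrite fmor_comp !lftE !compA.
  by rewrite (comp_eql _ (e'P Y).2) compm1.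
exists (Functor G1_lin G1_id G1_comp), (fun X => lft _ _ (e' (F X))), e; split=> //.
- move=> X; exists (lft _ _ (e (F X))).
  by split; apply: F_faithful; rewrite fmor_comp !lftE fmor_id; case: (e'P (F X)).
- move=> X X' f; apply: F_faithful; rewrite !fmor_comp !lftE.
  by rewrite (comp_eql _ (e'P (F X)).2) compm1.
- by move=> Y Y' f; rewrite lftE !compA (e'P Y').2 comp1m.
Qed.

End Functors.

Section Generated.
Variables (K : fieldType) (C : linCat K) (J : Type) (F : J -> C).

(** An isomorphism onto X is a kernel of the zero endomorphism of X. *)
Lemma ab_generated_iso X Y : isomorphic X Y -> ab_generated F X -> ab_generated F Y.
Proof.
move=> /isomorphic_sym[f [g [gf fg]]] HX.
apply: (@AbKernel _ _ _ _ X X 0 _ f _ HX HX); split; first by rewrite comp0m.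
move=> Z u _; exists (g \oc u); split=> [|v <-]; first by rewrite compA fg comp1m.
by rewrite compA gf comp1m.
Qed.

Lemma kernel_monic (X Y : C) (f : Mor X Y) N (k : Mor N X) : is_kernel f k -> monic k.
Proof.
move=> [fk ku] Z u v uv; have fku : f \oc (k \oc u) = 0 by rewrite compA fk comp0m.
by have [w [_ wu]] := ku Z _ fku; rewrite -(wu u erefl) -(wu v (esym uv)).
Qed.

Lemma cokernel_epic (X Y : C) (f : Mor X Y) Q (q : Mor Y Q) : is_cokernel f q -> epic q.
Proof.
move=> [qf qu] Z u v uv; have uqf : u \oc q \oc f = 0 by rewrite -compA qf compm0.
by have [w [_ wu]] := qu Z _ uqf; rewrite -(wu u erefl) -(wu v (esym uv)).
Qed.

Lemma kernel_unique (X Y : C) (f : Mor X Y) N N' (k : Mor N X) (k' : Mor N' X) :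
  is_kernel f k -> is_kernel f k' -> isomorphic N N'.
Proof.
move=> kf kf'; have [a [ka _]] := kf'.2 _ k kf.1; have [b [kb _]] := kf.2 _ k' kf'.1.
exists a, b; split; [apply: (kernel_monic kf)|apply: (kernel_monic kf')].
  by rewrite compA kb ka compm1.
by rewrite compA ka kb compm1.
Qed.

Lemma cokernel_unique (X Y : C) (f : Mor X Y) Q Q' (q : Mor Y Q) (q' : Mor Y Q') :
  is_cokernel f q -> is_cokernel f q' -> isomorphic Q Q'.
Proof.
move=> qf qf'; have [a [aq _]] := qf.2 _ q' qf'.1; have [b [bq _]] := qf'.2 _ q qf.1.
exists a, b; split; [apply: (cokernel_epic qf)|apply: (cokernel_epic qf')].
  by rewrite -compA aq bq comp1m.
by rewrite -compA bq aq comp1m.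
Qed.

(** A von Neumann inverse h of f turns the splitting of the idempotent 1 - h f
   into a kernel of f, and that of 1 - f h into a cokernel. *)
Lemma regular_kernel (X Y : C) (f : Mor X Y) h U (i : Mor U X) r :
  f \oc h \oc f = f -> r \oc i = idm U -> i \oc r = idm X - h \oc f -> is_kernel f i.
Proof.
move=> fhf ri ir; split.
  rewrite -(compm1 i) -ri (compA i) ir compBl comp1m compBr.
  by rewrite !compA fhf subrr.
move=> Z u fu; exists (r \oc u); split=> [|v <-]; last by rewrite compA ri comp1m.
by rewrite compA ir compBl comp1m -compA fu compm0 subr0.
Qed.

Lemma regular_cokernel (X Y : C) (f : Mor X Y) h U (i : Mor U Y) r :
  f \oc h \oc f = f -> r \oc i = idm U -> i \oc r = idm Y - f \oc h -> is_cokernel f r.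
Proof.
move=> fhf ri ir; split.
  by rewrite -[r]comp1m -[idm U]ri -(compA r) ir compBr compm1 compBl -!compA (compA f) fhf subrr.
move=> Z u uf; exists (u \oc i); split=> [|v <-]; last by rewrite -compA ri compm1.
by rewrite -compA ir compBr compm1 compA uf comp0m subr0.
Qed.

End Generated.

(** * The decomposition of A *)

Section Decomposition.
Variables (K : numClosedFieldType) (C : ribbonCat K) (G : topGroupType) (A : calgebra C).
Variables (S : separable_alg A) (pi : alg_action G A).
Hypothesis pi_faithful : faithful pi.
Hypothesis A_fixed : isomorphic (the_fixed pi : C) tone.
Variable s : seq G.
Hypotheses (s_uniq : uniq s) (s_full : forall g, g \in s).
Local Notation a := (alg A).
Local Notation rep := (repCat K G).
Local Notation tau V := (tau pi s_uniq s_full V).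
Local Notation coef V := (coef pi V).
Implicit Types U V W : rep.

Lemma tau_act V g (v : V) : tau V (ract V g v) \oc pi g = tau V v.
Proof.
apply: coef_ext => phi; rewrite compA !coef_tau comp_suml.
rewrite -[RHS](sum_mulgr s_uniq s_full _ g); apply: eq_bigr => h _.
by rewrite compZl -aactM ractM comp_lfunE.
Qed.

(** End(Phi U) consists of scalars, so the left hand side is an invariant bilinear
   form in u and X; by Schur's lemma it is a multiple of evaluation.  Summing over
   a basis gives the order of G by sum_tau_coef, so the multiple is not zero. *)
Lemma tau_coef_simple U : simple U ->
  exists2 c : K, c != 0 & forall (u : U) (X : vdual U),
    tau U u \oc coef U X = (c * (X u : K)) *: idm (Phi pi U).
Proof.
move=> Us; have n0 : (size s)%:R != 0 :> K := card_neq0 s_full K.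
have endo (f : Mor (Phi pi U) (Phi pi U)) : exists c : K, f = c *: idm _.
  have [h <-] := Phi_full S pi_faithful A_fixed s_uniq s_full f.
  have [c ->] := schur s_uniq s_full h Us; exists c.
  by rewrite fmorZ fmor_id.
have id0 : idm (Phi pi U) <> 0.
  rewrite -(fmor_id (Phi pi)) -(fmor0 (Phi pi)) => E; apply: Us.1; apply: zero_id.
  exact: (Phi_faithful S pi_faithful s_uniq s_full E).
have [L L1] := vdual_normalized id0.
have LE f : f = (L f : K) *: idm _.
  have [c ->] := endo f; congr (_ *: _); rewrite linearZ /= L1.
  by rewrite -[RHS]/(c * 1) mulr1.
pose F (X : vdual U) (u : U) : K^o := L (tau U u \oc coef U X).
pose e (u : U) : U := \sum_k (F (vbd k) u : K) *: vb k.
have eE u : linfun e u = e u.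
  rewrite linfunP // => c x y; rewrite /e scaler_sumr -big_split; apply: eq_bigr => l _.
  by rewrite /F linearP compDl compZl linearP scalerDl scalerA.
have eF (X : vdual U) u : X (linfun e u) = F X u.
  rewrite eE /e linear_sum [in RHS](vbd_expand X) /F linear_sum !comp_sumr linear_sum.
  by apply: eq_bigr => l _; rewrite !linearZ /= !compZr linearZ; exact: mulrC.
have ei : @intertwines K G U U (linfun e).
  move=> g; apply/lfunP => u; apply: vdual_sep => X; rewrite !comp_lfunE eF.
  have -> : X (ract U g (linfun e u)) = (X \o ract U g)%VF (linfun e u) by rewrite comp_lfunE.
  rewrite eF /F -(tau_act (g^-1)%g) ractK -compA coef_actV.
  by rewrite invgK.
have [c cE] := schur s_uniq s_full (mk_rhom ei : Mor U U) Us.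
have main (u : U) (X : vdual U) : tau U u \oc coef U X = (c * (X u : K)) *: idm (Phi pi U).
  rewrite [LHS]LE -[L _]/(F X u) -eF.
  have /(congr1 (fun f : Mor U U => vsval f u)) := cE; rewrite /= scale_lfunE id_lfunE => ->.
  by rewrite linearZ.
exists c => //; apply/eqP => c0; apply: id0; apply: (scalerI n0).
rewrite -(sum_tau_coef pi s_uniq s_full) scaler0 big1 // => l _.
by rewrite main c0 mul0r scale0r.
Qed.

Lemma tau_coef_distinct U U' (u : U') (X : vdual U) : simple U -> simple U' ->
  ~ isomorphic U U' -> tau U' u \oc coef U X = 0.
Proof.
move=> Us Us' UU'.
have [h <-] := Phi_full S pi_faithful A_fixed s_uniq s_full (tau U' u \oc coef U X).
by rewrite (schur0 s_uniq s_full h Us Us' UU') fmor0.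
Qed.

Local Notation M V := (Phi pi (rdual V) : C).
(** The evaluation of V against the dual in M V: on elements, w (x) m is sent to the
   value at w of the A-valued functional m. *)
Definition isotypic_incl V : Mor (V \bx M V) a :=
  \sum_k coef (rdual V) (bidual V (vb k)) \oc bx_proj (V \bx M V) (vbd k).

Lemma isotypic_equivariant V :
  equivariant (fun g => boxm (ract V g) (idm (M V))) pi (isotypic_incl V).
Proof.
move=> g; rewrite /isotypic_incl comp_sumr comp_suml.
transitivity (\sum_k \sum_l (vbd l (ract V g (vb k)) : K) *:
    (coef (rdual V) (bidual V (vb l)) \oc bx_proj (V \bx M V) (vbd k))).
  apply: eq_bigr => k _; rewrite compA coef_actV bidual_act [in LHS](vb_expand (ract V g (vb k))).
  rewrite !linear_sum comp_suml; apply: eq_bigr => l _.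
  by rewrite !linearZ /= compZl.
rewrite exchange_big; apply: eq_bigr => l _ /=.
rewrite -compA boxmE comp1m [in RHS](vbd_expand (vbd l \o ract V g)%VF).
rewrite linear_sum comp_sumr; apply: eq_bigr => k _.
by rewrite linearZ /= compZr comp_lfunE.
Qed.

Lemma box_liftE_lin V (N Y : C) (T : vdual V -> Mor Y N) : linear T ->
  exists h : Mor Y (V \bx N), forall phi, bx_proj (V \bx N) phi \oc h = T phi.
Proof.
by move=> Tlin; exists (box_lift (linfun T : vtens V (Mor Y N))) => phi; rewrite box_liftE linfunP.
Qed.

(** The averages tau phi, for phi in the dual of V, are the components of a morphism
   in the other direction.  It inverts the evaluation up to a scalar, and is
   orthogonal to the evaluations of the other irreducible representations. *)
Lemma isotypic_proj_exists V : exists q : Mor a (V \bx M V),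
  forall phi, bx_proj (V \bx M V) phi \oc q = tau (rdual V) phi.
Proof. by apply: box_liftE_lin => c x y; rewrite linearP. Qed.

Definition isotypic_proj V := projT1 (cid (isotypic_proj_exists V)).

Lemma isotypic_projE V phi : bx_proj (V \bx M V) phi \oc isotypic_proj V = tau (rdual V) phi.
Proof. by rewrite /isotypic_proj; case: cid. Qed.

Lemma isotypic_proj_incl V : simple V ->
  exists2 c : K, c != 0 & isotypic_proj V \oc isotypic_incl V = c *: idm _.
Proof.
move=> /(dual_simple s_uniq s_full)/tau_coef_simple[c c0 H]; exists c => //.
apply: box_ext => phi; rewrite compA isotypic_projE /isotypic_incl comp_sumr compZr compm1.
rewrite [in RHS](vbd_expand phi) linear_sum scaler_sumr; apply: eq_bigr => k _.
by rewrite compA H compZl comp1m bidualE linearZ /= scalerA.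
Qed.

Lemma isotypic_proj_incl_distinct V W : simple V -> simple W -> ~ isomorphic V W ->
  isotypic_proj W \oc isotypic_incl V = 0.
Proof.
move=> Vs Ws VW; apply: box_ext => phi.
rewrite compA isotypic_projE /isotypic_incl comp_sumr compm0 big1 // => k _.
rewrite compA tau_coef_distinct ?comp0m //; first exact: dual_simple s_uniq s_full _ Vs.
  exact: dual_simple s_uniq s_full _ Ws.
by move/dual_isomorphicI.
Qed.

(** Such a family T is the same as a morphism t from A to M V, and T v is the
   evaluation at v composed with t. *)
Lemma isotypic_factor V (T : V -> Mor a a) : linear T ->
  (forall g v, pi g \oc T v = T (ract V g v)) ->
  forall v, exists x, isotypic_incl V \oc x = T v.
Proof.
move=> Tlin Tact v.
have [t tE] : exists t : Mor a (M V), forall X, coef (rdual V) X \oc t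
    = \sum_k (X (vbd k) : K) *: T (vb k).
  apply: coef_lift => [c x y|g X].
    rewrite scaler_sumr -big_split; apply: eq_bigr => k _.
    by rewrite add_lfunE scale_lfunE scalerDl scalerA.
  rewrite comp_sumr.
  transitivity (\sum_k \sum_l (vbd l (ract V g (vb k)) : K) *:
      ((X (vbd k \o ract V (g^-1)%g)%VF : K) *: T (vb l))).
    apply: eq_bigr => k _; rewrite compZr Tact comp_lfunE vtrE.
    rewrite -(linfunP Tlin) [in LHS](vb_expand (ract V g (vb k))) linear_sum scaler_sumr.
    apply: eq_bigr => l _; rewrite linearZ /= (linfunP Tlin) !scalerA.
    by congr (_ *: _); apply: mulrC.
  rewrite exchange_big; apply: eq_bigr => l _ /=.
  under eq_bigr => k _ do rewrite scalerA.
  rewrite -scaler_suml; congr (_ *: _).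
  have E : vbd l = \sum_k (vbd l (ract V g (vb k)) : K) *: (vbd k \o ract V (g^-1)%g)%VF.
    apply/lfunP => w; rewrite sum_lfunE -[w in LHS](ractK g^-1%g) invgK.
    rewrite [in LHS](vb_expand (ract V g^-1%g w)) !linear_sum.
    by apply: eq_bigr => k _; rewrite !linearZ scale_lfunE comp_lfunE /=; exact: mulrC.
  by rewrite [in RHS]E linear_sum; apply: eq_bigr => k _; rewrite linearZ.
have [x xE] : exists x : Mor a (V \bx M V), forall phi, bx_proj (V \bx M V) phi \oc x
    = (phi v : K) *: t.
  by apply: box_liftE_lin => c y z; rewrite add_lfunE scale_lfunE scalerDl scalerA.
exists x; rewrite /isotypic_incl comp_suml -(linfunP Tlin) [in RHS](vb_expand v) linear_sum.
apply: eq_bigr => k _; rewrite -compA xE compZr tE linearZ /= (linfunP Tlin).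
congr (_ *: _); rewrite (bigD1 k) //= big1 => [|l lk]; rewrite bidualE vbd_vb.
  by rewrite eqxx scale1r addr0.
by rewrite (negPf lk) scale0r.
Qed.

(** G acts on End(A) by composition on the left.  The theory of representations of
   G applies to A itself, which is not a representation, through this one. *)
Lemma end_rep : exists (E : rep) (T : E -> Mor a a) (w : E),
  [/\ linear T, forall g v, pi g \oc T v = T (ract E g v) & T w = idm a].
Proof.
pose act (f : Mor a a) : 'End(Mor a a) := linfun (ccomp f).
have actE f u : act f u = f \oc u by rewrite linfunP //; exact: comp_linr.
have a1 : act (pi 1%g) = \1%VF by apply/lfunP => u; rewrite actE aact1 comp1m id_lfunE.
have aM g h : act (pi (g * h)%g) = (act (pi g) \o act (pi h))%VF.
  by apply/lfunP => u; rewrite comp_lfunE !actE aactM compA.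
have ac : vcontinuous (fun g => act (pi g)).
  pose B : 'Hom(Mor a a, 'End(Mor a a)) := linfun act.
  have BE f : B f = act f.
    rewrite linfunP // => c x y; apply/lfunP => u.
    by rewrite add_lfunE scale_lfunE !actE compDl compZl.
  rewrite (_ : (fun g => _) = (fun g => B (pi g))).
    by apply: vcontinuous_lin; exact: aact_cont.
  by apply/funext => g; rewrite BE.
exists (Rep a1 aM ac : rep), (fun v => v), (idm a); split=> // g v.
by rewrite /= actE.
Qed.

Variables (Lam : eqType) (F : Lam -> rep).
Hypothesis F_irreps : is_irreps F.

(** For the representation on End(A) and w = id this bounds the set of irreducible
   constituents of A: a morphism on A vanishes as soon as it does on finitely
   many of the pieces V (x) M V. *)
Lemma equivariant_span W (T : W -> Mor a a) : linear T ->
  (forall g v, pi g \oc T v = T (ract W g v)) ->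
  forall w, exists r : seq Lam, forall Y (h : Mor a Y),
    (forall l, l \in r -> h \oc isotypic_incl (F l) = 0) -> h \oc T w = 0.
Proof.
move: W T; apply: (rep_ind s_uniq s_full)
  => [Z /id_zero Z0|V Vs|V W U i1 i2 p1 p2 bp IV IW] T Tlin Tact w.
- exists [::] => Y h _; suff -> : T w = 0 by rewrite compm0.
  have -> : w = 0.
    by rewrite -[w]id_lfunE -[LHS]/(vsval (idm Z) w) Z0 zero_lfunE.
  by have := Tlin (-1) 0 0; rewrite scaler0 addr0 scaleN1r addNr.
- have [_ _ /(_ V Vs)[l [f [f' [f'f ff']]]]] := F_irreps; exists [:: l] => Y h hl.
  pose T' v := T (vsval f' v).
  have T'lin : linear T' by move=> c x y; rewrite /T' linearP Tlin.
  have T'act g v : pi g \oc T' v = T' (ract (F l) g v) by rewrite /T' Tact rhomE.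
  have [x xE] := isotypic_factor T'lin T'act (vsval f w).
  have <- : T' (vsval f w) = T w.
    rewrite /T'; congr (T _).
    by have /(congr1 (fun f : Mor V V => vsval f w)) := f'f; rewrite /= comp_lfunE id_lfunE.
  by rewrite -xE compA hl ?mem_head // comp0m.
have sub (X : rep) (i : Mor X U) : linear (fun v => T (vsval i v)) /\
    forall g v, pi g \oc T (vsval i v) = T (vsval i (ract X g v)).
  by split=> [c x y|g v]; rewrite ?linearP ?Tlin // Tact rhomE.
have [r1 H1] := IV _ (sub V i1).1 (sub V i1).2 (vsval p1 w).
have [r2 H2] := IW _ (sub W i2).1 (sub W i2).2 (vsval p2 w).
exists (r1 ++ r2) => Y h hl.
have -> : w = (1 : K) *: vsval i1 (vsval p1 w) + vsval i2 (vsval p2 w).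
  have [_ _ _ _ /(congr1 (fun f : Mor U U => vsval f w))] := bp.
  by rewrite /= add_lfunE !comp_lfunE id_lfunE scale1r => ->.
rewrite Tlin scale1r compDr H1 ?H2 ?addr0 // => l lr; apply: hl.
  by rewrite mem_cat lr orbT.
by rewrite mem_cat lr.
Qed.

Lemma isotypic_dsum : is_dsum (fun l => isotypic_incl (F l)).
Proof.
have [Fs Finj Fall] := F_irreps.
have [E [T [w [Tlin Tact Tw]]]] := end_rep.
have [r0 r0P] := equivariant_span Tlin Tact w.
pose r := undup r0.
have rP Y (h : Mor a Y) : (forall l, l \in r -> h \oc isotypic_incl (F l) = 0) -> h = 0.
  move=> H; rewrite -[h]compm1 -Tw; apply: r0P => l lr; apply: H.
  by rewrite mem_undup.
have cP l : exists c : K, c != 0 /\ isotypic_proj (F l) \oc isotypic_incl (F l) = c *: idm _.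
  by have [c c0 H] := isotypic_proj_incl (Fs l); exists c.
have [c cE] := choice cP.
have ortho l m : l != m -> isotypic_proj (F l) \oc isotypic_incl (F m) = 0.
  by move=> lm; apply: isotypic_proj_incl_distinct => // /Finj ml; rewrite ml eqxx in lm.
move=> Y f; pose h := \sum_(l <- r) (c l)^-1 *: (f l \oc isotypic_proj (F l)).
exists h; split=> [m|h' h'E]; last first.
  apply/eqP; rewrite -subr_eq0; apply/eqP; apply: rP => l lr.
  rewrite compBl h'E /h comp_suml (bigD1_seq l) ?undup_uniq //= big1 => [|m ml].
    rewrite addr0 compZl -compA (cE l).2 compZr compm1 scalerA mulVf ?(cE l).1 //.
    by rewrite scale1r subrr.
  by rewrite compZl -compA ortho // compm0 scaler0.
have [mr|mr] := boolP (m \in r).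
  rewrite /h comp_suml (bigD1_seq m) ?undup_uniq //= big1 => [|l lm].
    rewrite addr0 compZl -compA (cE m).2 compZr compm1 scalerA mulVf ?(cE m).1 //.
    by rewrite scale1r.
  by rewrite compZl -compA ortho // compm0 scaler0.
(* an index outside r cannot occur: its summand would vanish *)
have k0 : isotypic_proj (F m) = 0.
  by apply: rP => l lr; apply: ortho; apply: contraNneq mr => ->.
have id0 : idm (F m \bx M (F m)) = 0.
  by apply: (scalerI (cE m).1); rewrite scaler0 -(cE m).2 k0 comp0m.
by rewrite -[f m]compm1 id0 compm0 -[isotypic_incl (F m)]compm1 id0 !compm0.
Qed.

End Decomposition.

(** * The subcategory generated by the M_lambda *)

Section SimpleObjects.
Variables (K : fieldType) (C : linCat K).

Lemma simple_iso (X Y : C) : isomorphic X Y -> simple X -> simple Y.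
Proof.
move=> [f [g [gf fg]]] [X0 Xs]; split=> [/id_zero Y0|Z m mm].
  by apply: X0; apply: zero_id; rewrite -gf -[g]compm1 Y0 compm0 comp0m.
have gm : monic (g \oc m).
  move=> W u v; rewrite -!compA => /(congr1 (ccomp f)); rewrite !compA fg !comp1m.
  exact: mm.
have [|gmi] := Xs Z _ gm; [by left|right].
by rewrite -[m]comp1m -fg -compA; apply: iso_comp => //; exists g.
Qed.

(** In a semisimple category the coordinate idempotents of a decomposition into
   simple summands show that an object without nontrivial idempotents is one of
   its summands. *)
Lemma semisimple_idem_simple (X : C) : semisimple C -> idm X <> 0 ->
  (forall p : Mor X X, p \oc p = p -> p = 0 \/ p = idm X) -> simple X.
Proof.
move=> ss X0 Xp; have [n [T [inj [Ts Tsum]]]] := ss X.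
have ext Y (u v : Mor X Y) : (forall k, u \oc inj k = v \oc inj k) -> u = v.
  by move=> uv; have [h [_ hu]] := Tsum Y (fun k => v \oc inj k); rewrite -(hu u) // -(hu v).
have idem k : exists e : Mor X X, forall l, e \oc inj l = (l == k)%:R *: inj l.
  by have [e [eE _]] := Tsum X (fun l => (l == k)%:R *: inj l); exists e.
have [k ek] : exists k, forall l, inj l = (l == k)%:R *: inj l.
  apply: contrapT => /forallNP H; apply: X0; apply: (ext) => k; rewrite comp1m comp0m.
  have [e eE] := idem k.
  have [|E|E] := Xp e.
  - by apply: ext => l; rewrite -compA eE compZr eE scalerA -natrM mulnb andbb.
  - by have := eE k; rewrite E comp0m eqxx scale1r.
  - by case: (H k) => l; rewrite -eE E comp1m.
pose f l : Mor (T l) (T k) := match l =P k with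
  | ReflectT lk => match lk in _ = z return Mor (T l) (T z) with erefl => idm (T l) end
  | ReflectF _ => 0 end.
have fk : f k = idm (T k).
  by rewrite /f; case: eqP => // kk; rewrite (eq_irrelevance kk erefl).
have f0 l : l != k -> f l = 0 by rewrite /f; case: eqP.
have [q [qE _]] := Tsum (T k) f.
apply: (simple_iso _ (Ts k)); exists (inj k), q; split; first by rewrite qE.
apply: ext => l; rewrite comp1m -compA qE.
have [->|lk] := eqVneq l k; first by rewrite fk compm1.
by rewrite f0 // compm0 [RHS]ek (negPf lk) scale0r.
Qed.

Lemma biproduct_iso (X Y X' Y' P P' : C) (i1 : Mor X P) (i2 : Mor Y P) p1 p2
    (i1' : Mor X' P') (i2' : Mor Y' P') p1' p2' :
  is_biproduct i1 i2 p1 p2 -> is_biproduct i1' i2' p1' p2' ->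
  isomorphic X X' -> isomorphic Y Y' -> isomorphic P P'.
Proof.
move=> [a1 a2 a3 a4 a5] [b1 b2 b3 b4 b5] [f [f' [f'f ff']]] [g [g' [g'g gg']]].
exists (i1' \oc f \oc p1 + i2' \oc g \oc p2), (i1 \oc f' \oc p1' + i2 \oc g' \oc p2').
split.
  rewrite !(compDl, compDr) !compA (comp_eql _ b1) (comp_eql _ b2) (comp_eql _ b3).
  rewrite (comp_eql _ b4) !compm0 !comp0m addr0 add0r !compm1.
  by rewrite (comp_eql _ f'f) (comp_eql _ g'g) !compm1.
rewrite !(compDl, compDr) !compA (comp_eql _ a1) (comp_eql _ a2) (comp_eql _ a3).
rewrite (comp_eql _ a4) !compm0 !comp0m addr0 add0r !compm1.
by rewrite (comp_eql _ ff') (comp_eql _ gg') !compm1.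
Qed.

End SimpleObjects.

Section Image.
Variables (K : numFieldType) (C : ribbonCat K) (G : topGroupType) (A : calgebra C).
Variables (S : separable_alg A) (pi : alg_action G A).
Hypothesis pi_faithful : faithful pi.
Hypothesis A_fixed : isomorphic (the_fixed pi : C) tone.
Variable s : seq G.
Hypotheses (s_uniq : uniq s) (s_full : forall g, g \in s).
Local Notation rep := (repCat K G).
Implicit Types V W : rep.
Variables (Lam : Type) (F : Lam -> rep).
Hypothesis F_irreps : is_irreps F.
Let M l : C := Phi pi (rdual (F l)).

Let faith V W (f f' : Mor V W) : fmor (Phi pi) f = fmor (Phi pi) f' -> f = f' :=
  @Phi_faithful _ _ _ _ S _ pi_faithful _ s_uniq s_full _ _ f f'.
Let full V W (f : Mor (Phi pi V) (Phi pi W)) : exists h, fmor (Phi pi) h = f :=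
  Phi_full S pi_faithful A_fixed s_uniq s_full f.

(** Full faithfulness identifies the idempotents of Phi V with those of V. *)
Lemma Phi_simple V : simple V -> simple (Phi pi V : C).
Proof.
move=> Vs; apply: semisimple_idem_simple; first exact: rc_semisimple.
  by rewrite -(fmor_id (Phi pi)) -(fmor0 (Phi pi)) => /faith E; apply: Vs.1; apply: zero_id.
move=> p pp; have [q qE] := full p.
have qq : q \oc q = q by apply: faith; rewrite fmor_comp qE.
have [q0|q1] := simple_idem (@rep_split K G) Vs qq; [left|right].
  by rewrite -qE q0 fmor0.
by rewrite -qE q1 fmor_id.
Qed.

Lemma Phi_generated W : ab_generated M (Phi pi W : C).
Proof.
move: W; apply: (rep_ind s_uniq s_full) => [Z Z0|V Vs|V W U i1 i2 p1 p2 bp IV IW].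
- by apply: AbZero; exact: fmor_zero.
- have [l lV] := simple_dual_irrep s_uniq s_full F_irreps Vs.
  apply: (ab_generated_iso _ (AbGen M l)); apply: isomorphic_sym.
  exact: fmor_isomorphic.
- exact: AbBiproduct (fmor_biproduct (Phi pi) bp) IV IW.
Qed.

(** The essential image of Phi is closed under kernels and cokernels: up to
   isomorphism, a morphism f between objects of the image is Phi h by fullness, and
   Phi carries the split idempotents that give the kernel and cokernel of h to
   such idempotents for f. *)
Lemma generated_Phi X : ab_generated M X -> exists W, isomorphic (Phi pi W : C) X.
Proof.
have lift V W X' Y' (f : Mor X' Y') (e : Mor (Phi pi V : C) X')
      (e' : Mor (Phi pi W : C) Y') b b' :
    is_inv e b -> is_inv e' b' -> exists (h : Mor V W) (h' : Mor W V),
    [/\ h \oc h' \oc h = h, fmor (Phi pi) h = b' \oc f \oc e &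
      f \oc (e \oc fmor (Phi pi) h' \oc b') \oc f = f].
  move=> eb eb'; have [h hE] := full (b' \oc f \oc e).
  have [h' hh] := rep_regular s_uniq s_full h; exists h, h'; split=> //.
  have := congr1 (fun u => e' \oc fmor (Phi pi) u \oc b) hh.
  rewrite !fmor_comp hE !compA eb'.2 comp1m.
  by rewrite (comp_eql _ eb.2) compm1 (comp_eql _ eb.2) compm1.
elim=> {X} [l|Z Z0|X Y P i1 i2 p1 p2 bp _ [V VX] _ [W WY]|
    X Y f N k fk _ [V [e [b eb]]] _ [W [e' [b' eb']]]|
    X Y f Q q fq _ [V [e [b eb]]] _ [W [e' [b' eb']]]].
- by exists (rdual (F l)); exists (idm _); exact: iso_id.
- have [U U0] := rep_zero K G; exists U; exists 0, 0.
  by rewrite /is_inv (id_zero Z0) (id_zero (fmor_zero (Phi pi) U0)) !comp0m.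
- have [U [j1 [j2 [q1 [q2 bq]]]]] := rep_biproduct V W; exists U.
  exact: biproduct_iso (fmor_biproduct (Phi pi) bq) bp VX WY.
- have [h [h' [hh hE fe]]] := lift _ _ _ _ f _ _ _ _ eb eb'.
  have pp : (idm V - h' \oc h) \oc (idm V - h' \oc h) = idm V - h' \oc h.
    by rewrite compBr compm1 compBl comp1m !compA -(compA h' h h') -(compA h') hh subrr subr0.
  have [U [i [r [ri ir]]]] := rep_split pp; exists U.
  apply: kernel_unique fk.
  apply: (regular_kernel (i := e \oc fmor (Phi pi) i) (r := fmor (Phi pi) r \oc b) fe).
    by rewrite compA (comp_eql _ eb.1) compm1 -fmor_comp ri fmor_id.
  rewrite compA -[e \oc _ \oc _]compA -fmor_comp ir fmorB fmor_id compBr compm1 compBl eb.2.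
  congr (_ - _); rewrite fmor_comp hE !compA.
  by rewrite (comp_eql _ eb.2) compm1.
- have [h [h' [hh hE fe]]] := lift _ _ _ _ f _ _ _ _ eb eb'.
  have pp : (idm W - h \oc h') \oc (idm W - h \oc h') = idm W - h \oc h'.
    by rewrite compBr compm1 compBl comp1m !compA hh subrr subr0.
  have [U [i [r [ri ir]]]] := rep_split pp; exists U.
  apply: cokernel_unique fq.
  apply: (regular_cokernel (i := e' \oc fmor (Phi pi) i) (r := fmor (Phi pi) r \oc b') fe).
    by rewrite compA (comp_eql _ eb'.1) compm1 -fmor_comp ri fmor_id.
  rewrite compA -[e' \oc _ \oc _]compA -fmor_comp ir fmorB fmor_id compBr compm1 compBl eb'.2.
  congr (_ - _); rewrite fmor_comp hE !compA.
  by rewrite eb'.2 comp1m.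
Qed.

Lemma generated_tone : ab_generated M tone.
Proof.
have [u uiso _] := tensor_unit A_fixed.
apply: (ab_generated_iso _ (Phi_generated tone)).
by apply: isomorphic_sym; exists u.
Qed.

Lemma generated_tens (X Y : C) :
  ab_generated M X -> ab_generated M Y -> ab_generated M (X \ox Y).
Proof.
move=> /generated_Phi[V [f ff]] /generated_Phi[W [g gg]].
apply: (ab_generated_iso _ (Phi_generated (V \ox W))).
apply: isomorphic_trans (_ : isomorphic _ (Phi pi V \ox Phi pi W)) _.
  apply: isomorphic_sym; exists (PhiJ pi V W).
  by apply: (PhiJ_iso S) => //; exact: s_uniq.
by exists (f \om g); exact: tens_iso.
Qed.

Lemma generated_symmetric : symmetric_on (ab_generated M).
Proof.
move=> X Y /generated_Phi[V [f ff]] /generated_Phi[W [g gg]].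
apply: (iso_epi (tens_iso ff gg)).
rewrite -compA braid_nat compA braid_nat -compA.
by rewrite (Phi_symmetric S pi_faithful A_fixed s_uniq s_full) compm1 comp1m.
Qed.

Lemma Phi_equivalence :
  @is_tensor_equivalence _ rep (fullsub_mon generated_tone generated_tens)
    (corestrict Phi_generated) (PhiJ pi).
Proof.
have [T1 T2 T3 T4] := Phi_tensor_functor S pi_faithful A_fixed s_uniq s_full.
split; first by split.
apply: ff_equivalence => [V W f f'|V W f|[X HX]].
- exact: faith.
- exact: full.
- by have [W WX] := generated_Phi HX; exists W.
Qed.

End Image.

Theorem theorem2p11 (R : realType) (C : ribbonCat R[i]) (A : calgebra C)
  (A_rigid : rigid_alg A) (A_twist : twist (alg A) = idm (alg A))
  (G : topGroupType) (G_compact : compact [set: G])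
  (G_hausdorff : hausdorff_space G)
  (pi : alg_action G A) (pi_faithful : faithful pi)
  (A_fixed : isomorphic (the_fixed pi : C) tone)
  (Lam : Type) (V : Lam -> repCat R[i] G) (V_irreps : is_irreps V) :
  let M l : C := Phi pi (rdual (V l)) in
  [/\ exists j : forall l, Mor (V l \bx M l : C) (alg A),
        (forall l, equivariant (fun g => boxm (ract (V l) g) (idm (M l))) pi (j l))
        /\ is_dsum j,
      forall l, ~ is_zero (M l) /\ simple (M l),
      forall l m, l <> m -> ~ isomorphic (M l) (M m) &
      exists (C1_one : ab_generated M tone)
        (C1_tens : forall X Y : C,
          ab_generated M X -> ab_generated M Y -> ab_generated M (X \ox Y))
        (Phi_C1 : forall W, ab_generated M (Phi pi W)),
        symmetric_on (ab_generated M) /\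
        @is_tensor_equivalence _ (repCat R[i] G)
          (fullsub_mon C1_one C1_tens) (corestrict Phi_C1) (PhiJ pi)].
Proof.
move=> M; have [S] := rigid_separable A_rigid A_twist.
have [s [s_uniq s_full]] := group_finite S pi_faithful.
have simpleM l : simple (rdual (V l) : repCat R[i] G).
  by apply: (dual_simple s_uniq s_full); case: V_irreps.
split.
- exists (fun l => isotypic_incl pi (V l)); split.
    by move=> l; exact: isotypic_equivariant.
  (* the index type is given its classical decidable equality *)
  exact: (@isotypic_dsum _ C G A S pi pi_faithful A_fixed s s_uniq s_full {classic Lam} V).
- move=> l; have Ms := Phi_simple S pi_faithful A_fixed s_uniq s_full (simpleM l).
  by split=> //; case: Ms.
- move=> l m lm E; apply: lm; case: V_irreps => _ inj _; apply: inj.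
  apply: dual_isomorphicI; apply: ff_isomorphic E.
    by move=> X Y f g; exact: (Phi_faithful S pi_faithful s_uniq s_full).
  exact: (Phi_full S pi_faithful A_fixed s_uniq s_full).
exists (generated_tone A_fixed s_uniq s_full V_irreps).
exists (generated_tens S pi_faithful A_fixed s_uniq s_full V_irreps).
exists (Phi_generated pi s_uniq s_full V_irreps); split.
  exact: (generated_symmetric S pi_faithful A_fixed s_uniq s_full).
exact: Phi_equivalence.
Qed.
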